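(* Let $k\ge1$, let $\boldsymbol\alpha$ be in the interior of $\Delta^{k-1}$ (i.e. $\alpha_i>0$ for all $i$ and $\sum_i\alpha_i=1$) and for $\mathbf p\in(\mathbb Z_{\ge0})^k$ let $D_{\boldsymbol\alpha}^{\mathbf p}$ be the posterior distribution of the Dirichlet distribution $D_{\boldsymbol\alpha}$ given atoms of mass $p_i$ at the points $i\in[k]$. Let $\mathfrak l\cong\mathfrak{sl}_{k+1}(\mathbb C)$ be the complex Lie algebra of operators described in the context, with its subalgebras $\mathfrak h,\mathfrak r^+,\mathfrak f$. Then: (i) the space $\mathcal O_{\Lambda_{\boldsymbol\alpha}^+}$ is a weight $\mathfrak l$-module (with respect to the Cartan subalgebra $\mathfrak h$), and an $\mathfrak U(\mathfrak l)$-module; (ii) the action of $\mathfrak U(\mathfrak f)\subset\mathfrak U(\mathfrak l)$ maps $\mathcal O_{M_{\boldsymbol\alpha,\ell}}$ into itself for every integer $\ell\geq 1$, while the actions of $\mathfrak U(\mathfrak h)$ and of $\mathfrak U(\mathfrak r^+)$ map $\mathcal O_{H_{\boldsymbol\alpha}}$ into itself; (iii) for every $\mathbf p\in(\mathbb Z_{\ge0})^k$ there exists a $v=v(\mathbf p)\in\mathfrak U(\mathfrak r^+)$, unique up to a non-zero scalar factor, such that $v.\mathcal O_{\{\boldsymbol\alpha\}}=\mathcal O_{\{\boldsymbol\alpha+\mathbf p\}}\cong\mathbb C\,\widehat{D_{\boldsymbol\alpha}^{\mathbf p}}$, the last identification being $f_{\boldsymbol\alpha+\mathbf p}\mapsto\big(\mathbf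 s\mapsto f_{\boldsymbol\alpha+\mathbf p}(\mathrm i\mathbf s,\mathbf 1,1)\big)=\widehat{D_{\boldsymbol\alpha}^{\mathbf p}}$; (iv) the canonical action of $\mathfrak S_k$ on $\mathscr P([k])$ corresponds to the natural action of the unique subgroup isomorphic to $\mathfrak S_k$ of the Weyl group of $\mathfrak l$ permuting the roots corresponding to the basis elements of $\mathfrak r^+$. That is, denoting by $\gamma_{i}$ the root (with respect to $\mathfrak h$) of $E_{\alpha_i}$, $i\in[k]$: the Weyl group of $(\mathfrak l,\mathfrak h)$ has a unique subgroup isomorphic to $\mathfrak S_k$ that maps $\{\gamma_1,\dots,\gamma_k\}$ into itself, and its elements can be indexed by $\pi\in\mathfrak S_k$ through a group isomorphism so that $\pi$ acts by $\gamma_i\mapsto\gamma_{\pi(i)}$, just as $\pi$ acts on the vertices of $\mathscr P([k])$ by $\delta_i\mapsto\pi_\sharp\delta_i=\delta_{\pi(i)}$.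
   Context: $[k]=\{1,\dots,k\}$; $\mathscr P([k])$ is the set of probability measures on $[k]$, identified with $\Delta^{k-1}=\{\mathbf y\in\mathbb R^k:y_i\ge0,\sum_iy_i=1\}$ via $\mathbf y\leftrightarrow\sum_iy_i\delta_i$, and $\mathfrak S_k$ acts on it by push-forward. For $\mathbf y\in\mathbb C^k$ write $|\mathbf y|_\bullet=\sum_iy_i$; $\mathbf e_i$ is the $i$-th standard basis vector, $\mathbf1=(1,\dots,1)$, $\langle a\rangle_m=a(a+1)\cdots(a+m-1)$, $\langle\boldsymbol\alpha\rangle_{\mathbf m}=\prod_i\langle\alpha_i\rangle_{m_i}$, $\mathbf m!=\prod_im_i!$. For $\boldsymbol\alpha$ in the interior of $\Delta^{k-1}$ set $\Lambda_{\boldsymbol\alpha}^+=\{\boldsymbol\alpha'\in\boldsymbol\alpha+\mathbb Z^k:|\boldsymbol\alpha'|_\bullet>0\}$, $H_{\boldsymbol\alpha}=\{\boldsymbol\alpha'\in\Lambda^+_{\boldsymbol\alpha}:\alpha_i'>0\ \forall i\}$, $M_{\boldsymbol\alpha,\ell}=\{\boldsymbol\alpha'\in\Lambda^+_{\boldsymbol\alpha}:|\boldsymbol\alpha'|_\bullet=\ell\}$. For $\boldsymbol\alpha'\in\Lambda^+_{\boldsymbol\alpha}$ put $$f_{\boldsymbol\alpha'}(\mathbf s,\mathbf u,t)=\Big(\sum_{\mathbf m\in\mathbb N_0^k}\frac{\langle\boldsymbol\alpha'\rangle_{\mathbf m}}{\langle|\boldsymbol\alpha'|_\bullet\rangle_{|\mathbf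 m|_\bullet}}\frac{\mathbf s^{\mathbf m}}{\mathbf m!}\Big)\mathbf u^{\boldsymbol\alpha'}t^{|\boldsymbol\alpha'|_\bullet};$$ these functions are linearly independent. For $A\subset\Lambda_{\boldsymbol\alpha}^+$, $\mathcal O_A$ is the complex linear span of $\{f_{\boldsymbol\alpha'}:\boldsymbol\alpha'\in A\}$. Define linear operators on $\mathcal O_{\Lambda_{\boldsymbol\alpha}^+}$, for $i,j\in[k]$, $i\ne j$, by $$E_{\alpha_i}f_{\boldsymbol\alpha'}=\alpha'_if_{\boldsymbol\alpha'+\mathbf e_i},\quad E_{-\alpha_i}f_{\boldsymbol\alpha'}=(1-|\boldsymbol\alpha'|_\bullet)f_{\boldsymbol\alpha'-\mathbf e_i},\quad E_{\alpha_i,-\alpha_j}f_{\boldsymbol\alpha'}=\alpha_i'f_{\boldsymbol\alpha'+\mathbf e_i-\mathbf e_j},\quad J_{\alpha_i}f_{\boldsymbol\alpha'}=(|\boldsymbol\alpha'|_\bullet+\alpha'_i-1)f_{\boldsymbol\alpha'},$$ where $E_{-\alpha_i}f_{\boldsymbol\alpha'}=0$ when $|\boldsymbol\alpha'|_\bullet=1$. Let $\mathfrak l$ be the complex linear span of all these operators with the commutator bracket; it is a Lie algebra isomorphic to $\mathfrak{sl}_{k+1}(\mathbb C)$, with Cartan subalgebra $\mathfrak h=\mathrm{span}\{J_{\alpha_i}\}_{i\in[k]}$. Put $\mathfrak r^+=\mathrm{span}\{E_{\alpha_i}\}_{i\in[k]}$ (an Abelian subalgebra) and $\mathfrak f=\mathrm{span}\{E_{\alpha_i,-\alpha_j},J_{\alpha_i}-J_{\alpha_j}\}_{i\neq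 j}\cong\mathfrak{sl}_k(\mathbb C)$. $\mathfrak U(\cdot)$ denotes the universal enveloping algebra. $D_{\boldsymbol\alpha}$ (all $\alpha_i>0$) is the Dirichlet distribution on $\Delta^{k-1}$, with density $\frac{\Gamma(|\boldsymbol\alpha|_\bullet)}{\prod_i\Gamma(\alpha_i)}\prod_iy_i^{\alpha_i-1}$ with respect to $dy_1\cdots dy_{k-1}$ ($\delta_1$ if $k=1$), and for a measure $\mu$ on $\Delta^{k-1}$, $\widehat\mu(\mathbf s)=\int e^{\mathrm i\mathbf s\cdot\mathbf y}d\mu(\mathbf y)$, $\mathbf s\in\mathbb R^k$. The posterior $D_{\boldsymbol\alpha}^{\mathbf p}$ is the conditional law of $\mathbf Y\sim D_{\boldsymbol\alpha}$ given that, among $|\mathbf p|_\bullet$ random variables in $[k]$ that are conditionally i.i.d. given $\mathbf Y$ with probabilities $\mathbf Y$, exactly $p_i$ take value $i$ for each $i$; it equals $D_{\boldsymbol\alpha+\mathbf p}$. *)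

(* Defs.v *)
From HB Require Import structures.
From mathcomp Require Import all_boot all_order all_algebra perm.
From mathcomp Require Import complex.
From mathcomp Require Import all_classical all_reals all_analysis.

Set Implicit Arguments.
Unset Strict Implicit.
Unset Printing Implicit Defensive.

Import Order.TTheory GRing.Theory Num.Theory numFieldNormedType.Exports.

Local Open Scope classical_set_scope.
Local Open Scope complex_scope.
Local Open Scope quotient_scope.
Local Open Scope ring_scope.

Section Span.
Variables (K : fieldType) (V : lmodType K).
Implicit Types B : set V.

Definition lin_subspace B : Prop :=
  B 0 /\ forall (a : K) (x y : V), B x -> B y -> B (a *: x + y).

Definition lin_span B : set V :=
  [set v | exists s : seq (K * V),
     (forall p, p \in s -> B p.2) /\ v = \sum_(p <- s) p.1 *: p.2].

Lemma span_subset B : B `<=` lin_span B.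
Proof.
move=> v Bv; exists [:: (1, v)]; split; last by rewrite big_seq1 scale1r.
by move=> p; rewrite inE => /eqP ->.
Qed.

Lemma span_subspace B : lin_subspace (lin_span B).
Proof.
split; first by exists [::]; split => //; rewrite big_nil.
move=> a x y [s [sB ->]] [t [tB ->]].
exists ([seq (a * p.1, p.2) | p <- s] ++ t); split.
  move=> p; rewrite mem_cat => /orP[/mapP[q qs ->]|/tB//]; exact: (sB q).
rewrite big_cat big_map scaler_sumr; congr (_ + _).
by apply: eq_bigr => p _; rewrite scalerA.
Qed.

Lemma span_min B C : lin_subspace C -> B `<=` C -> lin_span B `<=` C.
Proof.
move=> [C0 CL] BC _ [s [sB ->]]; elim: s sB => [|p s IH] sB.
  by rewrite big_nil.
rewrite big_cons; apply: CL; first by apply: BC; apply: sB; exact: mem_head.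
by apply: IH => q qs; apply: sB; rewrite inE qs orbT.
Qed.

Definition span_pred B : {pred V} := fun v => v \in lin_span B.

Lemma span_pred_closed B : submod_closed (span_pred B).
Proof.
have [h0 hL] := span_subspace B.
split=> [|a x y]; rewrite /span_pred /in_mem /= ?mem_setE; first exact/asboolP.
by move=> /asboolP hx /asboolP hy; apply/asboolP; exact: hL.
Qed.

HB.instance Definition _ B :=
  GRing.isSubmodClosed.Build K V (span_pred B) (span_pred_closed B).

Record spanned B : Type :=
  Spanned { spanned_val :> V; _ : spanned_val \in span_pred B }.

HB.instance Definition _ B := [isSub for @spanned_val B].
HB.instance Definition _ B := [Choice of spanned B by <:].
HB.instance Definition _ B := [SubChoice_isSubLmodule of spanned B by <:].

Lemma spanned_valP B (a : K) (x y : spanned B) :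
  val (a *: x + y) = a *: val x + val y.
Proof. exact: linearP. Qed.

End Span.

Section Dual.
Variables (K : fieldType) (E : lmodType K) (h : set E).

(* Linearity on the subspace [h] of [E]; [h] itself is not an [lmodType]. *)
Definition functional_pred : {pred (h -> K^o)} := fun l =>
  `[< forall (a : K) (x y z : h),
        val z = a *: val x + val y -> l z = a * l x + l y >].

Lemma functional_pred_closed : submod_closed functional_pred.
Proof.
split=> [|c l m]; rewrite /functional_pred /in_mem /=.
  by apply/asboolP => a x y z _ /=; rewrite mulr0 addr0.
move=> /asboolP hl /asboolP hm; apply/asboolP => a x y z e.
rewrite !fctE /= (hl a x y z e) (hm a x y z e) /GRing.scale /=.
by rewrite !mulrDr addrACA !mulrA (mulrC c a).
Qed.

HB.instance Definition _ :=
  GRing.isSubmodClosed.Build K (h -> K^o) functional_pred functional_pred_closed.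

Record dual_space : Type :=
  Dual { dual_val :> h -> K^o; _ : dual_val \in functional_pred }.

HB.instance Definition _ := [isSub for dual_val].
HB.instance Definition _ := [Choice of dual_space by <:].
HB.instance Definition _ := [SubChoice_isSubLmodule of dual_space by <:].

End Dual.

(* A Lie algebra is given as a subspace [g] of a vector space [E], with a
   bracket on [E] that only needs to be well behaved on [g]. *)
Section LieAlgebra.
Variables (K : fieldType) (E : lmodType K) (br : E -> E -> E).
Implicit Types g h : set E.

Record lie_algebra g : Prop := LieAlgebra {
  lie_subspace : lin_subspace g;
  lie_closed : forall x y, g x -> g y -> g (br x y);
  lie_linearl : forall (a : K) x y z, g x -> g y -> g z ->
    br (a *: x + y) z = a *: br x z + br y z;
  lie_linearr : forall (a : K) x y z, g x -> g y -> g z ->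
    br z (a *: x + y) = a *: br z x + br z y;
  lie_alternating : forall x, g x -> br x x = 0;
  lie_jacobi : forall x y z, g x -> g y -> g z ->
    br x (br y z) + br y (br z x) + br z (br x y) = 0 }.

Section Modules.
Variables (M : lmodType K) (act : E -> M -> M).

Record lie_module g : Prop := LieModule {
  lie_module_alg : lie_algebra g;
  lie_actDr : forall x (a : K) u v, g x ->
    act x (a *: u + v) = a *: act x u + act x v;
  lie_actDl : forall (a : K) x y v, g x -> g y ->
    act (a *: x + y) v = a *: act x v + act y v;
  lie_act_br : forall x y v, g x -> g y ->
    act (br x y) v = act x (act y v) - act y (act x v) }.

Definition weight_space h (l : dual_space h) : set M :=
  [set v | forall x : h, act (val x) v = (l x : K) *: v].

(* [M] is a [g]-module and the direct sum of its weight spaces for [h]. *)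
Record weight_module g h : Prop := WeightModule {
  weight_lie_module : lie_module g;
  weight_sub : h `<=` g;
  weight_spanned : lin_span (\bigcup_l @weight_space h l) = setT;
  weight_direct : forall (s : seq (dual_space h)) (v : dual_space h -> M),
    uniq s ->
    (forall l, l \in s -> @weight_space h l (v l)) ->
    \sum_(l <- s) v l = 0 -> forall l, l \in s -> v l = 0 }.

End Modules.

Section WeylGroup.
Variables (g h : set E).
Implicit Types c l : dual_space h.

Definition root_space c : set E :=
  [set x | g x /\ forall H : h, br (val H) x = (c H : K) *: x].

Definition lie_root c : Prop := c != 0 /\ exists2 x, root_space c x & x != 0.

(* [H] is the coroot of the root [c], the element of [[g_c, g_(-c)]] with
   [c H = 2]. *)
Definition coroot c (H : h) : Prop :=
  lin_span [set z | exists x y,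
          [/\ root_space c x, root_space (- c) y & z = br x y]] (val H) /\
  c H = 2.

Definition reflection c (s : dual_space h -> dual_space h) : Prop :=
  exists2 H : h, coroot c H & forall l, s l = l - (l H : K) *: c.

(* Reflections are involutions, so that the monoid which they generate is a
   group. *)
Inductive weyl_group : set (dual_space h -> dual_space h) :=
| weyl_id : weyl_group idfun
| weyl_comp c s w : lie_root c -> reflection c s -> weyl_group w ->
    weyl_group (s \o w).

End WeylGroup.

End LieAlgebra.

Section TransformationGroups.
Variable T : Type.

Record subgroup (W G : set (T -> T)) : Prop := Subgroup {
  subgroup_sub : G `<=` W;
  subgroup_id : G idfun;
  subgroup_comp : forall v w, G v -> G w -> G (v \o w);
  subgroup_inv : forall w, G w ->
    exists v, [/\ G v, v \o w = idfun & w \o v = idfun] }.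

(* [phi] is an isomorphism onto [G] of the symmetric group of degree [k], with
   composition of permutations as its law; [t * s] is the permutation
   [i |-> s (t i)]. *)
Definition sym_iso k (G : set (T -> T)) (phi : 'S_k -> T -> T) : Prop :=
  [/\ forall s t : 'S_k, phi (t * s)%g = phi s \o phi t,
      injective phi & range phi = G].

End TransformationGroups.

(* The enveloping algebra of [g] is presented as the associative unital
   [K]-algebra with generators [x] in [g], subject to linearity in [x] and to
   [br x y = x * y - y * x]; its universal property is [uea_universal]. *)
Section EnvelopingAlgebra.
Variables (K : fieldType) (E : lmodType K) (br : E -> E -> E) (g : set E).

Inductive uterm : Type :=
| UGen of g
| UScal of K
| UAdd of uterm & uterm
| UMul of uterm & uterm.

Inductive ueq : uterm -> uterm -> Prop :=
| ueq_refl a : ueq a a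
| ueq_sym a b : ueq a b -> ueq b a
| ueq_trans a b c : ueq a b -> ueq b c -> ueq a c
| ueq_add a a' b b' : ueq a a' -> ueq b b' -> ueq (UAdd a b) (UAdd a' b')
| ueq_mul a a' b b' : ueq a a' -> ueq b b' -> ueq (UMul a b) (UMul a' b')
| ueq_addA a b c : ueq (UAdd a (UAdd b c)) (UAdd (UAdd a b) c)
| ueq_addC a b : ueq (UAdd a b) (UAdd b a)
| ueq_add0 a : ueq (UAdd (UScal 0) a) a
| ueq_mulA a b c : ueq (UMul a (UMul b c)) (UMul (UMul a b) c)
| ueq_mul1 a : ueq (UMul (UScal 1) a) a
| ueq_mul0 a : ueq (UMul (UScal 0) a) (UScal 0)
| ueq_mulDl a b c : ueq (UMul (UAdd a b) c) (UAdd (UMul a c) (UMul b c))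
| ueq_mulDr a b c : ueq (UMul a (UAdd b c)) (UAdd (UMul a b) (UMul a c))
| ueq_scalD k l : ueq (UScal (k + l)) (UAdd (UScal k) (UScal l))
| ueq_scalM k l : ueq (UScal (k * l)) (UMul (UScal k) (UScal l))
| ueq_scalC k a : ueq (UMul (UScal k) a) (UMul a (UScal k))
| ueq_lin k (x y z : g) : val z = k *: val x + val y ->
    ueq (UGen z) (UAdd (UMul (UScal k) (UGen x)) (UGen y))
| ueq_br (x y z : g) : val z = br (val x) (val y) ->
    ueq (UGen z) (UAdd (UMul (UGen x) (UGen y))
                       (UMul (UScal (-1)) (UMul (UGen y) (UGen x)))).

HB.instance Definition _ := gen_eqMixin uterm.
HB.instance Definition _ := gen_choiceMixin uterm.

Definition ueqb : rel uterm := fun a b => `[< ueq a b >].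

Lemma ueqb_refl : reflexive ueqb.
Proof. by move=> a; apply/asboolP; exact: ueq_refl. Qed.

Lemma ueqb_sym : symmetric ueqb.
Proof. by move=> a b; apply/asboolP/asboolP => /ueq_sym. Qed.

Lemma ueqb_trans : transitive ueqb.
Proof.
move=> b a c /asboolP ab /asboolP bc; by apply/asboolP; exact: (ueq_trans ab bc).
Qed.

Canonical ueqb_equiv := EquivRel ueqb ueqb_refl ueqb_sym ueqb_trans.

Definition uea : Type := {eq_quot ueqb}.

HB.instance Definition _ := Choice.on uea.
HB.instance Definition _ := EqQuotient.on uea.

Lemma upiP a b : \pi_uea a = \pi_uea b <-> ueq a b.
Proof.
split=> [/eqmodP/asboolP //|/asboolP ab]; exact/eqmodP.
Qed.

Lemma ueq_repr a : ueq (repr (\pi_uea a)) a.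
Proof. by apply/upiP; rewrite reprK. Qed.

Lemma upi_ind (P : uea -> Prop) : (forall a, P (\pi_uea a)) -> forall u, P u.
Proof. by move=> H u; rewrite -[u]reprK. Qed.

Let uscal (k : K) : uea := \pi_uea (UScal k).
Let uadd (u v : uea) : uea := \pi_uea (UAdd (repr u) (repr v)).
Let umul (u v : uea) : uea := \pi_uea (UMul (repr u) (repr v)).
Let uopp (u : uea) : uea := umul (uscal (-1)) u.

Let uaddE a b : uadd (\pi_uea a) (\pi_uea b) = \pi_uea (UAdd a b).
Proof. by apply/upiP; apply: ueq_add; exact: ueq_repr. Qed.

Let umulE a b : umul (\pi_uea a) (\pi_uea b) = \pi_uea (UMul a b).
Proof. by apply/upiP; apply: ueq_mul; exact: ueq_repr. Qed.

Let uE := (uaddE, umulE).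

Let uaddA : associative uadd.
Proof.
elim/upi_ind=> a; elim/upi_ind=> b; elim/upi_ind=> c; rewrite !uE.
by apply/upiP; exact: ueq_addA.
Qed.

Let uaddC : commutative uadd.
Proof.
by elim/upi_ind=> a; elim/upi_ind=> b; rewrite !uE; apply/upiP; exact: ueq_addC.
Qed.

Let uadd0 : left_id (uscal 0) uadd.
Proof. by elim/upi_ind=> a; rewrite /uscal !uE; apply/upiP; exact: ueq_add0. Qed.

Let umul1 : left_id (uscal 1) umul.
Proof. by elim/upi_ind=> a; rewrite /uscal !uE; apply/upiP; exact: ueq_mul1. Qed.

Let umulC k u : umul (uscal k) u = umul u (uscal k).
Proof.
by elim/upi_ind: u => a; rewrite /uscal !uE; apply/upiP; exact: ueq_scalC.
Qed.

Let umulr1 : right_id (uscal 1) umul.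
Proof. by move=> u; rewrite -umulC umul1. Qed.

Let umulA : associative umul.
Proof.
elim/upi_ind=> a; elim/upi_ind=> b; elim/upi_ind=> c; rewrite !uE.
by apply/upiP; exact: ueq_mulA.
Qed.

Let umulDl : left_distributive umul uadd.
Proof.
elim/upi_ind=> a; elim/upi_ind=> b; elim/upi_ind=> c; rewrite !uE.
by apply/upiP; exact: ueq_mulDl.
Qed.

Let umulDr : right_distributive umul uadd.
Proof.
elim/upi_ind=> a; elim/upi_ind=> b; elim/upi_ind=> c; rewrite !uE.
by apply/upiP; exact: ueq_mulDr.
Qed.

Let uscalD k l : uscal (k + l) = uadd (uscal k) (uscal l).
Proof. by rewrite /uscal uE; apply/upiP; exact: ueq_scalD. Qed.

Let uscalM k l : uscal (k * l) = umul (uscal k) (uscal l).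
Proof. by rewrite /uscal uE; apply/upiP; exact: ueq_scalM. Qed.

Let uaddN : left_inverse (uscal 0) uopp uadd.
Proof.
move=> u; rewrite /uopp -{2}[u]umul1 -umulDl -uscalD addNr.
by elim/upi_ind: u => a; rewrite /uscal uE; apply/upiP; exact: ueq_mul0.
Qed.

HB.instance Definition _ := GRing.isZmodule.Build uea uaddA uaddC uadd0 uaddN.

Section Eval.
Variables (A : algType K) (phi : g -> A).

Fixpoint ueval (t : uterm) : A :=
  match t with
  | UGen x => phi x
  | UScal k => k%:A
  | UAdd a b => ueval a + ueval b
  | UMul a b => ueval a * ueval b
  end.

(* [phi] is a morphism of Lie algebras from [g] to [A] with the commutator. *)
Definition lie_morphism : Prop :=
  (forall (k : K) (x y z : g), val z = k *: val x + val y ->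
     phi z = k *: phi x + phi y) /\
  (forall x y z : g, val z = br (val x) (val y) ->
     phi z = phi x * phi y - phi y * phi x).

Lemma ueval_eq : lie_morphism -> forall a b, ueq a b -> ueval a = ueval b.
Proof.
move=> [philin phibr] a b; elim=> {a b} //=.
- by move=> a b c _ -> _ ->.
- by move=> a a' b b' _ -> _ ->.
- by move=> a a' b b' _ -> _ ->.
- by move=> a b c; rewrite addrA.
- by move=> a b; rewrite addrC.
- by move=> a; rewrite scale0r add0r.
- by move=> a b c; rewrite mulrA.
- by move=> a; rewrite scale1r mul1r.
- by move=> a; rewrite scale0r mul0r.
- by move=> a b c; rewrite mulrDl.
- by move=> a b c; rewrite mulrDr.
- by move=> k l; rewrite scalerDl.
- by move=> k l; rewrite mulr_algl scalerA.
- by move=> k a; rewrite mulr_algl mulr_algr.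
- by move=> k x y z /philin ->; rewrite mulr_algl.
- by move=> x y z /phibr ->; rewrite mulr_algl scaleN1r.
Qed.

Definition uea_lift (u : uea) : A := ueval (repr u).

Lemma uea_liftE : lie_morphism -> forall a, uea_lift (\pi_uea a) = ueval a.
Proof. by move=> hphi a; apply: ueval_eq => //; exact: ueq_repr. Qed.

End Eval.

Let uone_neq0 : uscal 1 != 0.
Proof.
have h0 : @lie_morphism K^o (fun=> 0).
  by split=> *; rewrite ?scaler0 ?mulr0 ?subrr ?addr0.
apply/eqP => /upiP /(ueval_eq h0) /= /eqP.
by rewrite scale1r scale0r oner_eq0.
Qed.

HB.instance Definition _ := GRing.Zmodule_isNzRing.Build uea
  umulA umul1 umulr1 umulDl umulDr uone_neq0.

Let uscale k (u : uea) : uea := uscal k * u.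

Let uscaleA k l u : uscale k (uscale l u) = uscale (k * l) u.
Proof. by rewrite /uscale uscalM mulrA. Qed.

Let uscale1 : left_id 1 uscale.
Proof. exact: mul1r. Qed.

Let uscaleDr : right_distributive uscale +%R.
Proof. by move=> k u v; exact: mulrDr. Qed.

Let uscaleDl u : {morph uscale^~ u : k l / k + l}.
Proof. by move=> k l; rewrite /uscale uscalD mulrDl. Qed.

HB.instance Definition _ := GRing.Zmodule_isLmodule.Build K uea
  uscaleA uscale1 uscaleDr uscaleDl.

Let uscaleAl k (u v : uea) : k *: (u * v) = (k *: u) * v.
Proof. exact: mulrA. Qed.

HB.instance Definition _ := GRing.Lmodule_isLalgebra.Build K uea uscaleAl.

Let uscaleAr k (u v : uea) : k *: (u * v) = u * (k *: v).
Proof.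
rewrite -[LHS]/(uscal k * (u * v)) -[RHS]/(u * (uscal k * v)) !mulrA.
by congr (_ * _); exact: umulC.
Qed.

HB.instance Definition _ := GRing.Lalgebra_isAlgebra.Build K uea uscaleAr.

Definition uea_gen (x : g) : uea := \pi_uea (UGen x).

Lemma upiD a b : \pi_uea (UAdd a b) = \pi_uea a + \pi_uea b.
Proof. by rewrite -uaddE. Qed.

Lemma upiM a b : \pi_uea (UMul a b) = \pi_uea a * \pi_uea b.
Proof. by rewrite -umulE. Qed.

Lemma upi_scal k : \pi_uea (UScal k) = k%:A.
Proof. by rewrite -[RHS]/(uscal k * 1) mulr1. Qed.

Lemma uea_genP : lie_morphism uea_gen.
Proof.
split=> [k x y z e|x y z e]; rewrite /uea_gen.
  have /upiP -> := ueq_lin e.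
  by rewrite upiD upiM upi_scal mulr_algl.
have /upiP -> := ueq_br e.
by rewrite upiD !upiM upi_scal mulr_algl scaleN1r.
Qed.

Lemma uea_universal (A : algType K) (phi : g -> A) : lie_morphism phi ->
  exists Phi : {lrmorphism uea -> A},
    (forall x, Phi (uea_gen x) = phi x) /\
    forall Psi : {lrmorphism uea -> A},
      (forall x, Psi (uea_gen x) = phi x) -> Psi =1 Phi.
Proof.
move=> hphi; have liftE := uea_liftE hphi.
have lD : {morph uea_lift phi : u v / u + v}.
  by elim/upi_ind=> a; elim/upi_ind=> b; rewrite -upiD !liftE.
have lM : {morph uea_lift phi : u v / u * v}.
  by elim/upi_ind=> a; elim/upi_ind=> b; rewrite -upiM !liftE.
have l1 : uea_lift phi 1 = 1.
  by rewrite -[X in uea_lift _ X]scale1r -upi_scal liftE /= scale1r.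
have lZ : scalable (uea_lift phi).
  move=> k; elim/upi_ind=> a.
  by rewrite -mulr_algl -upi_scal -upiM !liftE /= mulr_algl.
have lL : linear (uea_lift phi) by move=> k u v; rewrite lD lZ.
pose m1 := GRing.isLinear.Build K uea A _ (uea_lift phi) lL.
pose m2 := GRing.isMonoidMorphism.Build uea A (uea_lift phi) (conj l1 lM).
pose Phi : {lrmorphism uea -> A} := HB.pack (uea_lift phi) m1 m2.
exists Phi; split=> [x|Psi hPsi].
  by rewrite [LHS]liftE.
elim/upi_ind=> a; rewrite [RHS]liftE.
elim: a => [x|k|a IHa b IHb|a IHa b IHb] /=; first exact: hPsi.
- by rewrite upi_scal [LHS]linearZ rmorph1.
- by rewrite upiD [LHS]raddfD; congr (_ + _).
- by rewrite upiM [LHS]rmorphM; congr (_ * _).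
Qed.

End EnvelopingAlgebra.

Section EnvelopingAlgebraInclusion.
Variables (K : fieldType) (E : lmodType K) (br : E -> E -> E).
Variables (g' g : set E) (sub : g' `<=` g).

(* The algebra morphism extending the inclusion of [g'] into [g]. *)
Definition uea_incl : uea br g' -> uea br g :=
  uea_lift (fun x : g' => uea_gen br (subfun sub x)).

End EnvelopingAlgebraInclusion.

Section EnvelopingAlgebraAction.
Variables (K : fieldType) (E : lmodType K) (br : E -> E -> E) (g : set E).
Variables (M : lmodType K) (act : E -> M -> M).

Fixpoint uterm_act (t : uterm g) (v : M) : M :=
  match t with
  | UGen x => act (val x) v
  | UScal k => k *: v
  | UAdd a b => uterm_act a v + uterm_act b v
  | UMul a b => uterm_act a (uterm_act b v)
  end.

(* The action on [M] of the enveloping algebra of [g]; it does not depend on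
   the chosen representatives when [M] is a [g]-module, see [uea_actE]. *)
Definition uea_act (u : uea br g) (v : M) : M := uterm_act (repr u) v.

Lemma uterm_act_linear : lie_module br act g ->
  forall t (k : K) u v, uterm_act t (k *: u + v) =
    k *: uterm_act t u + uterm_act t v.
Proof.
move=> gM; elim=> [x|c|a IHa b IHb|a IHa b IHb] k u v /=.
- exact: (lie_actDr gM _ _ _ (set_valP x)).
- by rewrite scalerDr !scalerA mulrC.
- by rewrite IHa IHb scalerDr addrACA.
- by rewrite IHb IHa.
Qed.

Lemma uterm_act_eq : lie_module br act g ->
  forall a b, ueq br a b -> uterm_act a =1 uterm_act b.
Proof.
move=> gM a b; elim=> {a b} //=.
- by move=> a b _ ab v; rewrite ab.
- by move=> a b c _ ab _ bc v; rewrite ab.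
- by move=> a a' b b' _ aa' _ bb' v; rewrite aa' bb'.
- by move=> a a' b b' _ aa' _ bb' v; rewrite bb' aa'.
- by move=> a b c v; rewrite addrA.
- by move=> a b v; rewrite addrC.
- by move=> a v; rewrite scale0r add0r.
- by move=> a v; rewrite scale1r.
- by move=> a v; rewrite !scale0r.
- move=> a b c v.
  have := uterm_act_linear gM a 1 (uterm_act b v) (uterm_act c v).
  by rewrite !scale1r.
- by move=> k l v; rewrite scalerDl.
- by move=> k l v; rewrite scalerA.
- move=> k a v; have a0 : uterm_act a 0 = 0.
    have := uterm_act_linear gM a (-1) 0 0.
    by rewrite !scaleN1r oppr0 addr0 addNr.
  by rewrite -[k *: v]addr0 uterm_act_linear// a0 addr0.
- move=> k x y z -> v.
  exact: (lie_actDl gM _ _ (set_valP x) (set_valP y)).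
- move=> x y z -> v; rewrite scaleN1r.
  exact: (lie_act_br gM _ (set_valP x) (set_valP y)).
Qed.

Lemma uea_actE : lie_module br act g ->
  forall t, uea_act (\pi_(uea br g) t) =1 uterm_act t.
Proof. by move=> gM t; apply: uterm_act_eq => //; exact: ueq_repr. Qed.

End EnvelopingAlgebraAction.

Section AlgebraModules.
Variables (K : fieldType) (A : algType K) (M : lmodType K).
Variable act : A -> M -> M.

Record algebra_module : Prop := AlgebraModule {
  alg_act1 : forall v, act 1 v = v;
  alg_actM : forall a b v, act (a * b) v = act a (act b v);
  alg_actDl : forall (k : K) a b v, act (k *: a + b) v = k *: act a v + act b v;
  alg_actDr : forall (k : K) a u v, act a (k *: u + v) = k *: act a u + act a v }.

End AlgebraModules.

Section Functions.
Variables (R : realType) (k : nat).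
Local Notation C := R[i].
Implicit Types (a : 'rV[R]_k) (s u : 'rV[C]_k).

Definition mass a : R := \sum_i a 0 i.

Definition rising (x : R) (m : nat) : R := \prod_(j < m) (x + j%:R).

(* Principal branch, cut along the negative real axis. *)
Definition principal_arg (z : C) : R :=
  let theta := acos (complex.Re z / Normc.normc z) in
  if complex.Im z < 0 then - theta else theta.

Definition cpow (z : C) (x : R) : C :=
  let theta := x * principal_arg z in
  (Normc.normc z `^ x)%:C * (cos theta +i* sin theta).

Definition series_term a s (m : 'I_k -> nat) : C :=
  ((\prod_i rising (a 0 i) (m i)) / rising (mass a) (\sum_i m i)%N)%:C
  * (\prod_i s 0 i ^+ m i) / (\prod_i (m i)`!)%:R.

(* The series converges absolutely; it is summed along the cubes
   [{0, ..., N - 1}^k]. *)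
Definition lauricella a s : C :=
  limn (fun N => \sum_(m : {ffun 'I_k -> 'I_N})
                   series_term a s (fun i => nat_of_ord (m i)) : C^o).

Definition basis_fun a : 'rV[C]_k -> 'rV[C]_k -> C -> C^o :=
  fun s u t =>
    lauricella a s * (\prod_i cpow (u 0 i) (a 0 i)) * cpow t (mass a).

(* [O_A] *)
Definition fun_span (A : set 'rV[R]_k) : set ('rV[C]_k -> 'rV[C]_k -> C -> C^o) :=
  lin_span (basis_fun @` A).

End Functions.

Section SymmetryAlgebra.
Variables (R : realType) (k : nat) (alpha : 'rV[R]_k).
Local Notation C := R[i].
Implicit Types (a : 'rV[R]_k) (i j : 'I_k).

Definition latp : set 'rV[R]_k :=
  [set a | (exists z : 'I_k -> int, a = alpha + \row_i (z i)%:~R) /\ 0 < mass a].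

Definition lat_H : set 'rV[R]_k := latp `&` [set a | forall i, 0 < a 0 i].

Definition lat_M (l : nat) : set 'rV[R]_k := latp `&` [set a | mass a = l%:R].

Definition Osp : Type := spanned (@basis_fun R k @` latp).

HB.instance Definition _ := GRing.Lmodule.on Osp.

(* [O_A] as a subspace of [O_latp], for [A] included in [latp]. *)
Definition Osub (A : set 'rV[R]_k) : set Osp := [set x | fun_span A (val x)].

(* Only meaningful for [a] in [latp], see [val_fO]. *)
Definition fO a : Osp := insubd (0 : Osp) (@basis_fun R k a).

Lemma val_fO a : latp a -> val (fO a) = @basis_fun R k a.
Proof.
move=> la; rewrite /fO.
have fa : @basis_fun R k a \in span_pred (@basis_fun R k @` latp).
  by apply/asboolP; apply: span_subset; exists a.
by rewrite val_insubd fa.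
Qed.

(* The operator is unique, and it exists because the functions [basis_fun a],
   for [a] in [latp], are linearly independent. *)
Definition linext (c : 'rV[R]_k -> Osp) : Osp -> Osp :=
  xget (fun=> 0) [set T : Osp -> Osp |
    (forall (z : C) x y, T (z *: x + y) = z *: T x + T y) /\
    (forall a, latp a -> T (fO a) = c a)].

Definition ev i : 'rV[R]_k := delta_mx 0 i.

Definition Ep i := linext (fun a => (a 0 i)%:C *: fO (a + ev i)).

(* When [mass a = 1] the vector [a - ev i] is not in [latp], and the
   coefficient is zero. *)
Definition Em i := linext (fun a => (1 - mass a)%:C *: fO (a - ev i)).

Definition Epm i j := linext (fun a => (a 0 i)%:C *: fO (a + ev i - ev j)).

Definition Jop i := linext (fun a => (mass a + a 0 i - 1)%:C *: fO a).

Definition commutator (S T : Osp -> Osp) : Osp -> Osp :=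
  fun x => S (T x) - T (S x).

Definition opact (T : Osp -> Osp) (x : Osp) : Osp := T x.

Definition gens_l : set (Osp -> Osp) :=
  range Ep `|` range Em `|` [set Epm p.1 p.2 | p in [set p | p.1 != p.2]]
  `|` range Jop.

Definition alg_l : set (Osp -> Osp) := lin_span gens_l.

Definition alg_h : set (Osp -> Osp) := lin_span (range Jop).

Definition alg_r : set (Osp -> Osp) := lin_span (range Ep).

Definition alg_f : set (Osp -> Osp) :=
  lin_span ([set Epm p.1 p.2 | p in [set p | p.1 != p.2]] `|`
        [set Jop p.1 - Jop p.2 | p in [set p | p.1 != p.2]]).

Lemma sub_hl : alg_h `<=` alg_l.
Proof.
apply: span_min; first exact: span_subspace.
by apply: subset_trans (@span_subset _ _ _) => T; right.
Qed.

Lemma sub_rl : alg_r `<=` alg_l.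
Proof.
apply: span_min; first exact: span_subspace.
by apply: subset_trans (@span_subset _ _ _) => T; left; left; left.
Qed.

Lemma sub_fl : alg_f `<=` alg_l.
Proof.
have [l0 lL] := @span_subspace _ _ gens_l.
apply: span_min => // T [[p pneq <-]|[p pneq <-]].
  by apply: span_subset; left; right; exists p.
rewrite addrC -scaleN1r; apply: lL; apply: span_subset; right.
  by exists p.2.
by exists p.1.
Qed.

Definition Ul : Type := uea commutator alg_l.
Definition Uh : Type := uea commutator alg_h.
Definition Ur : Type := uea commutator alg_r.
Definition Uf : Type := uea commutator alg_f.

HB.instance Definition _ := GRing.Algebra.on Ul.
HB.instance Definition _ := GRing.Algebra.on Uh.
HB.instance Definition _ := GRing.Algebra.on Ur.
HB.instance Definition _ := GRing.Algebra.on Uf.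

Definition actl (u : Ul) : Osp -> Osp := uea_act opact u.
Definition acth (u : Uh) : Osp -> Osp := actl (uea_incl sub_hl u).
Definition actr (u : Ur) : Osp -> Osp := actl (uea_incl sub_rl u).
Definition actf (u : Uf) : Osp -> Osp := actl (uea_incl sub_fl u).

Definition slice (x : Osp) : 'rV[R]_k -> C^o :=
  fun s => val x (\row_i (0 +i* s 0 i)) (const_mx 1) 1.

Lemma slice_linear : linear slice.
Proof.
move=> c x y.
have valE : val (c *: x + y) = c *: val x + val y by exact: spanned_valP.
by rewrite /slice valE.
Qed.

End SymmetryAlgebra.

Section Dirichlet.
Variable R : realType.

Definition Gamma (x : R) : R :=
  (\int[@lebesgue_measure R]_(t in `]0, +oo[%classic)
     (t `^ (x - 1) * expR (- t))).

(* The [n]-dimensional Lebesgue measure. *)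
Fixpoint lebesgue_tuple (n : nat) : set (n.-tuple R) -> \bar R :=
  match n with
  | 0 => dirac [tuple]
  | n.+1 => pushforward (@lebesgue_measure R \x @lebesgue_tuple n)%E
              (fun p => [tuple of p.1 :: p.2])
  end.
Arguments lebesgue_tuple : clear implicits.

Variable k : nat.

Definition simplex : set (k.-tuple R) :=
  [set y | (forall i, 0 <= tnth y i) /\ \sum_i tnth y i = 1].

(* [(y_1, ..., y_(k-1)) |-> (y_1, ..., y_(k-1), 1 - y_1 - ... - y_(k-1))] *)
Definition chart (y : k.-1.-tuple R) : k.-tuple R :=
  [tuple (if (i < k.-1)%N then nth 0 y i else 1 - \sum_(x <- y) x) | i < k].

Definition dirichlet_density (a : 'rV[R]_k) (y : k.-tuple R) : R :=
  Gamma (mass a) / (\prod_i Gamma (a 0 i)) * \prod_i tnth y i `^ (a 0 i - 1).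

(* For [k = 1] this is the Dirac mass at [1]. *)
Definition dirichlet (a : 'rV[R]_k) (A : set (k.-tuple R)) : \bar R :=
  (\int[lebesgue_tuple k.-1]_(y in chart @^-1` (A `&` simplex))
     (dirichlet_density a (chart y))%:E)%E.

(* The sequences of length [p_1 + ... + p_k] in which each [i] occurs [p_i]
   times. *)
Definition samples (p : 'I_k -> nat) : pred {ffun 'I_(\sum_i p i)%N -> 'I_k} :=
  [pred x : {ffun _ -> _} | [forall i, #|[pred j | x j == i]| == p i]].

(* The probability that [Y] is in [A] and that the sample has counts [p], when
   [Y] has law [mu] and the sample is i.i.d. with law [Y] given [Y]. *)
Definition joint (mu : set (k.-tuple R) -> \bar R) (p : 'I_k -> nat)
    (A : set (k.-tuple R)) : \bar R :=
  (\sum_(x | samples (p := p) x) \int[mu]_(y in A) (\prod_j tnth y (x j))%:E)%E.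

Definition posterior (mu : set (k.-tuple R) -> \bar R) (p : 'I_k -> nat)
    (A : set (k.-tuple R)) : \bar R :=
  (joint mu p A * ((fine (joint mu p setT))^-1)%:E)%E.

Definition charfun (mu : set (k.-tuple R) -> \bar R) : 'rV[R]_k -> (R[i])^o :=
  fun s =>
    fine (\int[mu]_y (cos (\sum_i s 0 i * tnth y i))%:E)%E +i*
    fine (\int[mu]_y (sin (\sum_i s 0 i * tnth y i))%:E)%E.

(* [delta_i] and the push-forward by [pi], for probability measures on the set
   of [k] points. *)
Definition vertex (i : 'I_k) : k.-tuple R := [tuple (j == i)%:R | j < k].

Definition push (pi : 'S_k) (y : k.-tuple R) : k.-tuple R :=
  [tuple \sum_(j | pi j == i) tnth y j | i < k].

End Dirichlet.

Arguments weyl_group {K E} br g h.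
Arguments commutator {R k} alpha S T.
Arguments opact {R k} alpha T x.
Arguments actl {R k} alpha u x.
Arguments actf {R k} alpha u x.
Arguments acth {R k} alpha u x.
Arguments actr {R k} alpha u x.
Arguments slice {R k} alpha x.
Arguments vertex R {k} i.
Arguments alg_l {R k} alpha _.
Arguments alg_h {R k} alpha _.
Arguments alg_r {R k} alpha _.
Arguments alg_f {R k} alpha _.
Arguments latp {R k} alpha _.
Arguments lat_H {R k} alpha _.
Arguments lat_M {R k} alpha l _.
Arguments Osp {R k} alpha.
Arguments Osub {R k} alpha A _.
Arguments fO {R k} alpha a.
Arguments Ep {R k} alpha i _.
Arguments Em {R k} alpha i _.
Arguments Epm {R k} alpha i j _.
Arguments Jop {R k} alpha i _.
Arguments Ul {R k} alpha.
Arguments Uh {R k} alpha.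
Arguments Ur {R k} alpha.
Arguments Uf {R k} alpha.

(* Main.v *)
Require Import Defs.
From HB Require Import structures.
From mathcomp Require Import all_boot all_order all_algebra perm.
From mathcomp Require Import complex.
From mathcomp Require Import all_classical all_reals all_analysis.
From mathcomp Require Import measurable_realfun ring lra.

Set Implicit Arguments.
Unset Strict Implicit.
Unset Printing Implicit Defensive.

Import Order.TTheory GRing.Theory Num.Theory numFieldNormedType.Exports.

Local Open Scope classical_set_scope.
Local Open Scope complex_scope.
Local Open Scope quotient_scope.
Local Open Scope ring_scope.

(** Everything becomes symmetric in homogeneous coordinates.  Complete a lattice
    vector [a] to the vector [(1 - |a|, a)] of total mass 1, and put [e_0 = 0].
    Each of the given operators is then one of, or a difference of two of,
    [E_ij : f_a |-> a_i f_(a + e_i - e_j)] for [i, j] in [{0, ..., k}]: raising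
    operators are the [E_i0], lowering ones the [E_0j], and the convention for
    [|a| = 1] only says that the coefficient [1 - |a|] vanishes.  The [E_ij]
    satisfy the commutation relations of the matrix units, so that they define a
    representation [rho] of [gl_(k+1)] ([commutator_rho]).  It is faithful
    ([rho_inj]), and it maps the traceless matrices onto [l] ([alg_lE]) and the
    traceless diagonal ones onto [h] ([alg_hE]).  All of this presupposes that
    the [f_a] are linearly independent: at [s = 0] and [t = 1] they restrict to
    the monomials [u^a] on positive vectors [u], which are distinct characters of
    a multiplicative group, and Dedekind's argument applies ([rmono_free]).

    Hence the [f_a] are weight vectors that span, and weight spaces are always
    independent; this gives a weight module.  For [i, j <> 0] the operator [E_ij]
    preserves [|a|], diagonal matrices act by scalars on each [f_a], and raising
    keeps the coordinates positive, which gives the stability properties.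

    The raising operators commute, so that [U(r)] is spanned by monomials that
    depend only on the number of times that each raising operator occurs
    ([mon_basis]).  Because [alpha] has positive coordinates, the monomial with
    counts [m] maps [f_alpha] to a nonzero multiple of [f_(alpha + m)]
    ([mon_act]).  Different monomials reach independent vectors, and only
    multiples of the monomial with counts [p] map the first line onto the second
    ([raising_unique]).

    The identification with the Fourier transform is a moment computation
    ([lauricella_charfun]).  Integrating out one coordinate at a time turns the
    Dirichlet integral into a product of Beta integrals, whose recurrences yield
    the moments [<a>_m / <|a|>_|m|].  The likelihood of a sample with counts [p]
    is [y^p], and so the posterior has a density proportional to
    [y^(alpha + p - 1)].  The partial sum of the series of [f_a] over a cube is
    the integral of a product of truncated exponential series, and dominated
    convergence gives [exp (i s.y)] in the limit.

    Finally, by faithfulness of [rho] the roots are the [eps_i - eps_j] with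
    [i <> j], and the reflection in such a root exchanges the coordinates [i] and
    [j] on [h].  The Weyl group is therefore the group of all permutations of
    [{0, ..., k}] ([weyl_groupE]).  As the root of the [i]-th raising operator is
    [eps_i - eps_0], an element preserves the set of these roots exactly when it
    fixes 0 ([weyl_stabilizer]).  The elements fixing 0 form a symmetric group of
    degree [k], and a subgroup of it that is isomorphic to it is everything
    ([weyl_sym_unique]). *)

(** * The Beta integral *)

Section Beta.
Variable R : realType.
Notation mu := (@lebesgue_measure R).

(** A factor of the Dirichlet density. The cut-off at 0 turns integrals over
    intervals and simplices into integrals over the whole space. *)
Definition pospow (p x : R) : R := if 0 < x then x `^ (p - 1) else 0.

Lemma pospow_ge0 p x : 0 <= pospow p x.
Proof. by rewrite /pospow; case: ifP => // _; exact: powR_ge0. Qed.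

Lemma pospow_le0 p x : x <= 0 -> pospow p x = 0.
Proof. by rewrite /pospow ltNge => ->. Qed.

Lemma pospowS p x : pospow (p + 1) x = x * pospow p x.
Proof.
rewrite /pospow; case: ifP => x0; last by rewrite mulr0.
rewrite addrK -{2}[x]powRr1 ?ltW// -powRD; last by rewrite (gt_eqF x0) implybT.
by rewrite addrCA subrr addr0.
Qed.

Lemma measurable_pospow p : measurable_fun setT (pospow p).
Proof.
apply: measurable_fun_ifT => //.
  exact: measurable_fun_ltr.
Qed.

Definition Beta p q : \bar R :=
  (\int[mu]_x (pospow p x * pospow q (1 - x))%:E)%E.

Lemma measurable_pospow2 p q (r : R) :
  measurable_fun setT (fun x => pospow p x * pospow q (r - x)).
Proof.
apply: measurable_funM; first exact: measurable_pospow.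
apply: measurableT_comp; first exact: measurable_pospow.
exact: measurable_funB.
Qed.

Lemma Beta_ge0 p q : (0 <= Beta p q)%E.
Proof. by apply: integral_ge0 => x _; rewrite lee_fin mulr_ge0 ?pospow_ge0. Qed.

(** Because [x + (1 - x) = 1]. *)
Lemma Beta_split p q : (Beta (p + 1) q + Beta p (q + 1) = Beta p q)%E.
Proof.
rewrite /Beta -ge0_integralD//=.
- apply: eq_integral => x _; rewrite -EFinD; congr EFin.
  by rewrite !pospowS; ring.
- by move=> x _; rewrite lee_fin mulr_ge0 ?pospow_ge0.
- by apply/measurable_EFinP; exact: measurable_pospow2.
- by move=> x _; rewrite lee_fin mulr_ge0 ?pospow_ge0.
- by apply/measurable_EFinP; exact: measurable_pospow2.
Qed.

(** Integration by parts takes place on [[eps n, 1 - eps n]], away from the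
    singularities that the integrand may have at 0 and 1. *)
Let eps (n : nat) : R := n.+3%:R^-1.

Let eps_gt0 n : 0 < eps n. Proof. by rewrite invr_gt0. Qed.
Let eps_lt n : eps n < 1 - eps n.
Proof.
rewrite ltrBrDr -mulr2n -mulr_natr mulrC /eps ltr_pdivrMr// mul1r ltr_nat//.
Qed.

Let I n : set R := `[eps n, 1 - eps n]%classic.

Let I_cup : \bigcup_n I n = `]0, 1[%classic.
Proof.
apply/seteqP; split => [x [n _]|x]; rewrite /I /= !in_itv /=.
  by move: (eps_gt0 n) => e0 /andP[xe xe1]; apply/andP; split; lra.
move=> /andP[x0 x1].
have m0 : 0 < Num.min x (1 - x) by rewrite lt_min x0 subr_gt0.
have := @near_infty_natSinv_lt R (PosNum m0).
move=> [N _ /(_ N (leqnn _))] /=; rewrite lt_min => /andP[h1 h2].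
exists N => //=; rewrite in_itv/=.
have : eps N <= N.+1%:R^-1.
  rewrite /eps lef_pV2 ?posrE ?ltr0n// ler_nat; exact: leqW.
move: (eps N) (N.+1%:R^-1) h1 h2 => e d h1 h2 ed.
by apply/andP; split; lra.
Qed.

Let nd_I : nondecreasing_seq I.
Proof.
move=> m n mn; rewrite subsetEset => x; rewrite /I /= !in_itv/= => /andP[h1 h2].
have : eps n <= eps m by rewrite /eps lef_pV2 ?posrE ?ltr0n// ler_nat !ltnS.
move: (eps n) (eps m) h1 h2 => e d h1 h2 ed.
by apply/andP; split; lra.
Qed.

Let Beta_cvg p q :
  (\int[mu]_(x in I n) (pospow p x * pospow q (1 - x))%:E @[n --> \oo] --> Beta p q)%E.
Proof.
have -> : Beta p q = (\int[mu]_(x in \bigcup_n I n) (pospow p x * pospow q (1 - x))%:E)%E.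
  rewrite I_cup /Beta [RHS]integral_mkcond; apply: eq_integral => x _.
  rewrite patchE mem_setE in_itv /=; case: ifP => // /negbT.
  rewrite negb_and -!leNgt => /orP[x0|x1].
    by rewrite pospow_le0 ?mul0r.
  by rewrite mulrC pospow_le0 ?mul0r// subr_le0.
apply: ge0_nondecreasing_set_cvg_integral => //.
- by move=> n; exact: measurable_itv.
- move=> n; apply/measurable_EFinP.
  by apply: measurable_funTS; exact: measurable_pospow2.
- by move=> *; rewrite lee_fin mulr_ge0 ?pospow_ge0.
Qed.

Lemma pospow_gt p x : 0 < x -> pospow p x = x `^ (p - 1).
Proof. by rewrite /pospow => ->. Qed.

Let derivable_LR (F f : R -> R) (a b : R) : a < b ->
  (forall x, a <= x <= b -> is_derive x 1 F (f x)) ->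
  derivable_oo_LRcontinuous F a b /\ {in `]a, b[, F^`()%classic =1 f}.
Proof.
move=> ab dF; split; last first.
  move=> x /itvP xab; rewrite derive1E; apply: (@derive_val _ _ _ _ _ _ _ (dF x _)).
  by rewrite !xab.
have cF x : a <= x <= b -> {for x, continuous F}.
  by move=> /dF[dFx _]; apply/differentiable_continuous/derivable1_diffP.
split.
- by move=> x /itvP xab; apply: (@ex_derive _ _ _ _ _ _ _ (dF x _)); rewrite !xab.
- by apply: cvg_at_right_filter; apply: cF; rewrite lexx ltW.
- by apply: cvg_at_left_filter; apply: cF; rewrite lexx ltW.
Qed.

Let is_derive_onem (q x : R) : 0 < 1 - x ->
  is_derive x 1 (fun x => - (1 - x) `^ q) (q * (1 - x) `^ (q - 1)).
Proof.
move=> x1.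
have h : is_derive x 1 (fun x : R => 1 - x) (- 1).
  rewrite -[X in is_derive _ _ _ X]add0r.
  exact: is_deriveB.
have := @is_derive1_comp _ (fun y : R => y `^ q) (fun x : R => 1 - x) x _ _
  (is_derive1_powR q x1) h.
move=> /is_deriveN; rewrite mulrN1 opprK; exact.
Qed.

Let parts p q n : 0 < p -> 0 < q ->
  (\int[mu]_(x in I n) (pospow (p + 1) x * pospow q (1 - x))%:E * q%:E =
   ((eps n) `^ p * (1 - eps n) `^ q - (1 - eps n) `^ p * (eps n) `^ q)%:E +
   \int[mu]_(x in I n) (pospow p x * pospow (q + 1) (1 - x))%:E * p%:E)%E.
Proof.
move=> p0 q0; have e0 := eps_gt0 n; have e1 := eps_lt n.
pose F x : R := x `^ p; pose f x : R := p * x `^ (p - 1).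
pose G x : R := - (1 - x) `^ q; pose g x : R := q * (1 - x) `^ (q - 1).
have bd x : eps n <= x <= 1 - eps n -> 0 < x /\ 0 < 1 - x.
  by move=> /andP[h1 h2]; split; lra.
have [dF eF] : derivable_oo_LRcontinuous F (eps n) (1 - eps n) /\
    {in `]eps n, (1 - eps n)[, F^`()%classic =1 f}.
  by apply: derivable_LR => // x /bd[x0 _]; exact: is_derive1_powR.
have [dG eG] : derivable_oo_LRcontinuous G (eps n) (1 - eps n) /\
    {in `]eps n, (1 - eps n)[, G^`()%classic =1 g}.
  by apply: derivable_LR => // x /bd[_ x0]; exact: is_derive_onem.
have cf : {within `[eps n, 1 - eps n], continuous f}.
  apply: derivable_within_continuous => x; rewrite in_itv/= => /bd[x0 _].
  apply: derivableM => //; apply: derivable_powR.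
  by rewrite in_itv/= x0.
have cg : {within `[eps n, 1 - eps n], continuous g}.
  apply: derivable_within_continuous => x; rewrite in_itv/= => /bd[_ x0].
  apply: derivableM => //.
  have := @is_derive_onem (q - 1) x x0 => -[/derivableN + _].
  by under [X in derivable X]eq_fun do rewrite opprK.
have := integration_by_parts e1 cf dF eF cg dG eG.
rewrite /F /G subKr => h.
transitivity (\int[mu]_(x in `[eps n, (1 - eps n)%R]) (F x * g x)%:E)%E.
  rewrite muleC -ge0_integralZl//=; last 4 first.
  - exact: measurable_itv.
  - apply: measurable_funTS; apply/measurable_EFinP; exact: measurable_pospow2.
  - by move=> x _; rewrite lee_fin mulr_ge0 ?pospow_ge0.
  - by rewrite lee_fin ltW.
  apply: eq_integral => x; rewrite inE /I /= in_itv /= => /bd[x0 x1].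
  by rewrite -EFinM !pospow_gt// addrK; congr EFin; rewrite /F /g; ring.
rewrite /F h; congr (_ + _)%E; first by congr EFin; ring.
under eq_integral do rewrite mulrN EFinN.
rewrite integral_ge0N ?oppeK; last first.
  move=> x; rewrite /= in_itv /= => /bd[x0 x1].
  by rewrite lee_fin !mulr_ge0 ?powR_ge0// ltW.
rewrite muleC -ge0_integralZl//=; last 4 first.
- exact: measurable_itv.
- apply: measurable_funTS; apply/measurable_EFinP; exact: measurable_pospow2.
- by move=> x _; rewrite lee_fin mulr_ge0 ?pospow_ge0.
- by rewrite lee_fin ltW.
apply: eq_integral => x; rewrite inE /I /= in_itv /= => /bd[x0 x1].
by rewrite -EFinM !pospow_gt// addrK; congr EFin; rewrite /f; ring.
Qed.

Let eps_cvg : eps n @[n --> \oo] --> (0 : R).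
Proof.
have := @cvg_harmonic R; rewrite -(cvg_shiftn 2) => h.
by apply: cvg_trans h; apply: near_eq_cvg; near=> n; rewrite /eps /= addn2.
Unshelve. all: by end_near. Qed.

Let eps_pow_cvg p : 0 < p -> eps n `^ p @[n --> \oo] --> (0 : R).
Proof.
move=> p0; have := powR_cvg0 p0 => /cvg_at_rightP; apply; split => //.
Qed.

Let eps_pow_cvg1 q : 0 < q -> (1 - eps n) `^ q @[n --> \oo] --> (1 : R).
Proof.
move=> q0; have e1 : (1 : R) `^ q = 1 by rewrite powR1.
have h : 1 - eps n @[n --> \oo] --> (1 : R).
  by rewrite -[X in _ --> X]subr0; apply: cvgB => //; exact: cvg_cst.
have c : {for 1, continuous (fun y : R => y `^ q)}.
  apply/differentiable_continuous/derivable1_diffP.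
  by apply: derivable_powR; rewrite in_itv/= ltr01.
rewrite -[X in _ --> X]e1; exact: (cvg_comp _ _ h c).
Qed.

(** The limit of [parts]: the boundary terms vanish because [p] and [q] are
    positive. Together with [Beta_split] this is a linear system for
    [Beta (p + 1) q] and [Beta p (q + 1)]. *)
Lemma Beta_sym p q : 0 < p -> 0 < q ->
  (Beta (p + 1) q * q%:E = Beta p (q + 1) * p%:E)%E.
Proof.
move=> p0 q0.
have h1 : (\int[mu]_(x in I n) (pospow (p + 1) x * pospow q (1 - x))%:E * q%:E
    @[n --> \oo] --> Beta (p + 1) q * q%:E)%E.
  by apply: cvgeZr => //; exact: Beta_cvg.
have h2 : (\int[mu]_(x in I n) (pospow p x * pospow (q + 1) (1 - x))%:E * p%:E
    @[n --> \oo] --> Beta p (q + 1) * p%:E)%E.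
  by apply: cvgeZr => //; exact: Beta_cvg.
have h3 : ((eps n) `^ p * (1 - eps n) `^ q - (1 - eps n) `^ p * (eps n) `^ q)
    @[n --> \oo] --> (0 : R).
  have -> : 0 = 0 * 1 - 1 * 0 :> R by rewrite mul0r mulr0 subrr.
  apply: cvgB; apply: cvgM.
  - exact: eps_pow_cvg.
  - exact: eps_pow_cvg1.
  - exact: eps_pow_cvg1.
  - exact: eps_pow_cvg.
have h3' : (((eps n) `^ p * (1 - eps n) `^ q - (1 - eps n) `^ p * (eps n) `^ q)%:E
    @[n --> \oo] --> 0%:E)%E.
  by apply: cvg_EFin => //; apply: nearW.
have := cvgeD (fin_num_adde_defr _ (isT : (0%:E : \bar R) \is a fin_num)) h3' h2.
rewrite add0e => h4; rewrite (_ : (fun n => _) = (fun n => (eps n `^ p * (1 - eps n) `^ q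
    - (1 - eps n) `^ p * eps n `^ q)%:E + \int[mu]_(x in I n) (pospow p x *
    pospow (q + 1) (1 - x))%:E * p%:E)%E) in h1; last by apply/funext => n; rewrite parts.
exact: (cvg_unique _ h1 (h4 _)).
Qed.

Lemma Beta_succl p q : 0 < p -> 0 < q ->
  (Beta (p + 1) q * (p + q)%:E = Beta p q * p%:E)%E.
Proof.
move=> p0 q0; rewrite -(Beta_split p q).
move: (Beta_ge0 (p + 1) q) (Beta_ge0 p (q + 1)) (Beta_sym p0 q0).
move: (Beta (p + 1) q) (Beta p (q + 1)) => x y x0 y0 e.
rewrite ge0_muleDl//.
by rewrite -e -ge0_muleDr ?lee_fin ?ltW.
Qed.

Lemma Beta_succr p q : 0 < p -> 0 < q ->
  (Beta p (q + 1) * (p + q)%:E = Beta p q * q%:E)%E.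
Proof.
move=> p0 q0; rewrite -(Beta_split p q).
move: (Beta_ge0 (p + 1) q) (Beta_ge0 p (q + 1)) (Beta_sym p0 q0).
move: (Beta (p + 1) q) (Beta p (q + 1)) => x y x0 y0 e.
rewrite ge0_muleDl//.
by rewrite e -ge0_muleDr ?lee_fin ?ltW.
Qed.

Let mulrE_fin (x : \bar R) (c : R) : 0 < c ->
  ((x * c%:E)%E \is a fin_num) = (x \is a fin_num).
Proof.
move=> c0; case: x => [x| |] //=.
- by rewrite gt0_mulye.
- by rewrite gt0_mulNye.
Qed.

(** The two recurrences reduce finiteness to [Beta (p + 1) (q + 1)], whose
    integrand is at most 1. *)
Lemma Beta_fin p q : 0 < p -> 0 < q -> Beta p q \is a fin_num.
Proof.
move=> p0 q0; rewrite -(mulrE_fin _ p0) -Beta_succl// mulrE_fin ?addr_gt0//.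
have p1 : 0 < p + 1 by rewrite addr_gt0.
rewrite -(mulrE_fin _ q0) -Beta_succr// mulrE_fin ?addr_gt0//.
rewrite ge0_fin_numE ?Beta_ge0//.
have : (\int[mu]_(x in `]0%R, 1%R[) (1%:E : \bar R) < +oo)%E.
  by rewrite integral_cst//= mul1e lebesgue_measure_itv/= lte_fin ltr01 -EFinD ltry.
apply: le_lt_trans; rewrite integral_mkcond; apply: ge0_le_integral => //.
- by move=> x _; rewrite lee_fin mulr_ge0 ?pospow_ge0.
- by apply/measurable_EFinP; exact: measurable_pospow2.
- by apply/(measurable_restrictT (fun=> 1%E) _).1 => //; exact: measurable_cst.
move=> x _; rewrite patchE mem_setE in_itv /=; case: ifP => [/andP[x0 x1]|].
  rewrite lee_fin !pospow_gt ?subr_gt0// !addrK mulr_ile1 ?powR_ge0//.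
    by rewrite -[leRHS](congr1 (@^~ p) (powR1 R)) ge0_ler_powR ?nnegrE ?ltW.
  by rewrite -[leRHS](congr1 (@^~ q) (powR1 R)) ge0_ler_powR ?nnegrE//; lra.
move/negbT; rewrite negb_and -!leNgt lee_fin => /orP[x0|x1].
  by rewrite pospow_le0 ?mul0r.
by rewrite mulrC pospow_le0 ?mul0r// subr_le0.
Qed.

(** On [[1/4, 1/2]] both [x] and [1 - x] are at least 1/4, and there the
    constant [c] bounds the integrand from below. *)
Lemma Beta_gt0 p q : 0 < p -> 0 < q -> (0 < Beta p q)%E.
Proof.
move=> p0 q0; pose c : R := 4^-1 `^ p * 4^-1 `^ q.
have c0 : 0 < c by rewrite mulr_gt0 ?powR_gt0 ?invr_gt0.
have : (0 < \int[mu]_(x in `[4^-1%R, 2^-1%R]) (c%:E))%E.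
  rewrite integral_cst//= lebesgue_measure_itv/= lte_fin.
  have -> : (4^-1 < 2^-1 :> R) by lra.
  by rewrite -EFinD -EFinM lte_fin mulr_gt0// subr_gt0; lra.
move=> /lt_le_trans; apply; rewrite integral_mkcond; apply: ge0_le_integral => //.
- by move=> x _; rewrite patchE; case: ifP => // _; rewrite lee_fin ltW.
- by apply/(measurable_restrictT (fun=> c%:E) _).1 => //; exact: measurable_cst.
- by apply/measurable_EFinP; exact: measurable_pospow2.
move=> x _; rewrite patchE mem_setE in_itv /=; case: ifP => [/andP[x0 x1]|_]; last first.
  by rewrite lee_fin mulr_ge0 ?pospow_ge0.
have x0' : 0 < x by lra.
have x1' : 0 < 1 - x by lra.
have bound (a y : R) : 0 < a -> 4^-1 <= y -> y <= 1 -> 4^-1 `^ a <= y `^ (a - 1).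
  move=> a0 y0 y1; apply: (@le_trans _ _ (y `^ a)).
    by rewrite ge0_ler_powR ?nnegrE//; lra.
  by apply: ger_powR; [apply/andP; split; lra|lra].
by rewrite lee_fin !pospow_gt// ler_pM ?powR_ge0// bound//; lra.
Qed.

End Beta.

Section Scale.
Variable R : realType.
Notation mu := (@lebesgue_measure R).

Lemma pospow_scale (p r x : R) : 0 < r -> pospow p (r * x) = r `^ (p - 1) * pospow p x.
Proof.
move=> r0; rewrite /pospow pmulr_rgt0//; case: ifP => x0; last by rewrite mulr0.
by rewrite powRM ?ltW.
Qed.

Let hom (r : R) (x : measurableTypeR R) : measurableTypeR R := r * x.

Let measurable_hom r : measurable_fun setT (hom r).
Proof. exact: measurable_funM. Qed.

Let push_hom r : {measure set (measurableTypeR R) -> \bar R} :=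
  measure_function_pushforward__canonical__measure_function_Measure mu (measurable_hom r).

Let lebesgue_hom (r : R) (r0 : 0 < r) (A : set R) : measurable A ->
  (r%:E * pushforward mu (hom r) A)%E = mu A.
Proof.
move=> mA.
have := @lebesgue_measure_unique R (mscale (NngNum (ltW r0)) (push_hom r)).
move=> /(_ _ _ mA) -> //.
move=> X [[a b]] _ <-.
rewrite -[RHS]/(r%:E * mu (hom r @^-1` `]a, b]%classic))%E.
have -> : hom r @^-1` `]a, b]%classic = `](a / r), (b / r)]%classic.
  apply/seteqP; split => x /=; rewrite !in_itv /= /hom.
    by rewrite ltr_pdivrMr// ler_pdivlMr// mulrC.
  by rewrite ltr_pdivrMr// ler_pdivlMr// mulrC.
rewrite !lebesgue_measure_itv/= !lte_fin ltr_pM2r ?invr_gt0//.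
case: ifP => _; last by rewrite mule0.
rewrite -!EFinD -EFinM; congr EFin; field; exact: lt0r_neq0.
Qed.

(** By uniqueness of Lebesgue measure, whose image under [hom r] is scaled by
    [r^-1] on intervals. *)
Lemma integral_hom (r : R) (f : R -> \bar R) : 0 < r ->
  measurable_fun setT f -> (forall x, 0 <= f x)%E ->
  (\int[mu]_x f x = r%:E * \int[mu]_x f (r * x)%R)%E.
Proof.
move=> r0 mf f0.
transitivity (\int[mscale (NngNum (ltW r0)) (push_hom r)]_x f x)%E.
  by apply: eq_measure_integral => A mA _; apply/esym; exact: lebesgue_hom.
rewrite ge0_integral_mscale//=; congr (_ * _)%E.
by rewrite ge0_integral_pushforward.
Qed.

(** For [r > 0] the substitution [x = r x'] reduces the convolution to the case
    [r = 1]; for [r <= 0] one of the two factors vanishes everywhere. *)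
Lemma pospow_conv (p q r : R) : 0 < p -> 0 < q ->
  (\int[mu]_x (pospow p x * pospow q (r - x))%:E = Beta p q * (pospow (p + q) r)%:E)%E.
Proof.
move=> p0 q0; have [r0|r0] := leP r 0.
  rewrite (pospow_le0 _ r0) mule0 integral0_eq// => x _.
  have [x0|x0] := leP x 0; first by rewrite pospow_le0 ?mul0r.
  by rewrite mulrC pospow_le0 ?mul0r//; lra.
rewrite (integral_hom r0)//; last 2 first.
- by apply/measurable_EFinP; exact: measurable_pospow2.
- by move=> x; rewrite lee_fin mulr_ge0 ?pospow_ge0.
under eq_integral => x _.
  have -> : r - r * x = r * (1 - x) by ring.
  rewrite !pospow_scale// mulrACA EFinM; over.
rewrite ge0_integralZl//; last 3 first.
- by apply/measurable_EFinP; exact: measurable_pospow2.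
- by move=> x _; rewrite lee_fin mulr_ge0 ?pospow_ge0.
- by rewrite lee_fin mulr_ge0 ?powR_ge0.
rewrite muleA -EFinM muleC; congr (_ * _%:E)%E; rewrite pospow_gt//.
rewrite -{1}[r]powRr1 ?ltW// -!powRD ?(gt_eqF r0) ?implybT//.
by congr powR; ring.
Qed.

End Scale.

(** * Image measures with a density, and Lebesgue measure on tuples *)

Section RawIntegral.
Import HBNNSimple.

(** The integral is built from the measures of level sets of simple functions,
    and these are measurable. The lemma lets a set function be exchanged for a
    genuine measure. *)
Lemma eq_integral_raw d (T : measurableType d) (R : realType)
    (m1 m2 : set T -> \bar R) (f : T -> \bar R) :
  (forall A, measurable A -> m1 A = m2 A) ->
  (\int[m1]_x f x = \int[m2]_x f x)%E.
Proof.
move=> e; rewrite /integral.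
have s (h : {nnsfun T >-> R}) : sintegral m1 h = sintegral m2 h.
  by rewrite /sintegral; apply: eq_fsbigr => r _; rewrite e.
congr (ereal_sup _ - ereal_sup _)%E; apply: eq_imagel => h _; exact: s.
Qed.

End RawIntegral.

Section Density.
Context d d' (X : measurableType d) (Y : measurableType d') (R : realType).
Variables (m : {measure set X -> \bar R}) (phi : X -> Y) (w : X -> R).
Hypotheses (mphi : measurable_fun setT phi) (mw : measurable_fun setT w).
Hypothesis w0 : forall x, 0 <= w x.

(** The image under [phi] of the measure with density [w]. *)
Definition image_density (A : set Y) : \bar R :=
  (\int[m]_(x in phi @^-1` A) (w x)%:E)%E.

Let mpre A : measurable A -> measurable (phi @^-1` A).
Proof. by move=> mA; rewrite -[X in measurable X]setTI; exact: mphi. Qed.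

Let d0 : image_density set0 = 0%E.
Proof. by rewrite /image_density preimage_set0 integral_set0. Qed.

Let d_ge0 A : (0 <= image_density A)%E.
Proof. by apply: integral_ge0 => x _; rewrite lee_fin. Qed.

Let d_sigma_additive : semi_sigma_additive image_density.
Proof.
move=> F mF tF mUF; rewrite /image_density preimage_bigcup ge0_integral_bigcup//=.
- apply: is_cvg_ereal_nneg_natsum_cond => n _ _; exact: d_ge0.
- by move=> n; exact: mpre.
- by apply: measurable_funTS; apply/measurable_EFinP.
- by move=> x _; rewrite lee_fin.
- apply/trivIsetP => /= i j _ _ ij; rewrite -preimage_setI.
  by move/trivIsetP : tF => /(_ _ _ _ _ ij) ->//; rewrite preimage_set0.
Qed.

HB.instance Definition _ := isMeasure.Build _ _ _
  image_density d0 d_ge0 d_sigma_additive.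

Import HBNNSimple.

Let integral_density_nnsfun (h : {nnsfun Y >-> R}) :
  (\int[image_density]_y (h y)%:E = \int[m]_x (h (phi x) * w x)%:E)%E.
Proof.
rewrite integralT_nnsfun sintegralE.
transitivity (\int[m]_x (\sum_(r \in range h) (r * \1_(phi @^-1` (h @^-1` [set r])) x * w x)%:E))%E.
  rewrite ge0_integral_fsum//=.
  - apply: eq_fsbigr => r; rewrite inE => -[y _ <-].
    rewrite /image_density integral_mkcond -ge0_integralZl//=.
    + apply: eq_integral => x _; rewrite patchE indicE.
      by case: ifPn => _; rewrite ?mulr1 ?mulr0 ?mul0r ?mule0// -EFinM.
    + apply/(measurable_restrictT (EFin \o w) _).1; first exact: mpre.
      by apply: measurable_funTS; apply/measurable_EFinP.
    + by move=> x _; rewrite patchE; case: ifP => // _; rewrite lee_fin.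
    + by rewrite lee_fin.
  - move=> r; apply/measurable_EFinP; apply: measurable_funM => //.
    by apply: measurable_funM => //; apply: measurable_indic; exact: mpre.
  - by move=> r x _; rewrite lee_fin mulr_ge0// -lee_fin nnfun_muleindic_ge0.
apply: eq_integral => x _; rewrite fsumEFin//; congr EFin.
rewrite (fimfunE h (phi x)) mulr_fsuml//.
Qed.

Let ge0_integral_density (f : Y -> \bar R) : measurable_fun setT f ->
  (forall y, 0 <= f y)%E ->
  (\int[image_density]_y f y = \int[m]_x (f (phi x) * (w x)%:E))%E.
Proof.
move=> mf f0; pose f_ := nnsfun_approx measurableT mf.
transitivity (limn (fun n => \int[image_density]_x (f_ n x)%:E)%E).
  rewrite -monotone_convergence//=.
  - by apply: eq_integral => x _; apply/esym/cvg_lim => //; exact: cvg_nnsfun_approx.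
  - by move=> n; apply/measurable_EFinP.
  - by move=> n x _; rewrite lee_fin.
  - by move=> x _ a b ab; rewrite lee_fin; exact/lefP/nd_nnsfun_approx.
under eq_fun do rewrite integral_density_nnsfun.
rewrite -monotone_convergence//=.
- apply: eq_integral => x _; apply/cvg_lim => //.
  under eq_fun do rewrite EFinM.
  by apply: cvgeZr => //; exact: cvg_nnsfun_approx.
- move=> n; apply/measurable_EFinP; apply: measurable_funM => //.
  exact: measurableT_comp.
- by move=> n x _; rewrite lee_fin mulr_ge0.
- move=> x _ a b ab; rewrite lee_fin ler_wpM2r//.
  exact/lefP/nd_nnsfun_approx.
Qed.

(** The change of variables holds for simple functions, passes to nonnegative
    functions by monotone convergence, and to signed ones by taking positive and
    negative parts. *)
Lemma integral_density (nu : set Y -> \bar R) (f : Y -> R) :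
  (forall A, measurable A -> nu A = \int[m]_(x in phi @^-1` A) (w x)%:E)%E ->
  measurable_fun setT f ->
  (\int[nu]_y (f y)%:E = \int[m]_x (f (phi x) * w x)%:E)%E.
Proof.
move=> nuE mf; rewrite (eq_integral_raw _ nuE) -/image_density.
rewrite [LHS]integralE [RHS]integralE.
have mEf : measurable_fun setT (EFin \o f) by exact/measurable_EFinP.
rewrite !ge0_integral_density//; last 2 first.
- exact: measurable_funeneg.
- exact: measurable_funepos.
congr (_ - _)%E; apply: eq_integral => x _.
- by rewrite !funeposE -EFin_max -EFinM -EFin_max maxr_pMl// mul0r.
- by rewrite !funenegE -!EFinN -!EFin_max -EFinM maxr_pMl// mul0r mulNr.
Qed.

End Density.

Lemma sigma_finite_prod d1 d2 (T1 : measurableType d1) (T2 : measurableType d2)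
    (R : realType) (m1 : {sigma_finite_measure set T1 -> \bar R})
    (m2 : {sigma_finite_measure set T2 -> \bar R}) :
  sigma_finite setT (m1 \x m2)%E.
Proof.
have /sigma_finiteP[F [FT F_nd Ffin]] := sigma_finiteT m1.
have /sigma_finiteP[G [GT G_nd Gfin]] := sigma_finiteT m2.
exists (fun n => F n `*` G n); last first.
  move=> n; have [mF Foo] := Ffin n; have [mG Goo] := Gfin n.
  split; first exact: measurableX.
  by rewrite product_measure1E// lte_mul_pinfty// ge0_fin_numE.
apply/seteqP; split=> // -[x y] _.
have [i _ Fx] : (\bigcup_i F i) x by rewrite -FT.
have [j _ Gy] : (\bigcup_i G i) y by rewrite -GT.
exists (maxn i j) => //; split => /=.
  by move/subsetPset : (F_nd _ _ (leq_maxl i j)); apply.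
by move/subsetPset : (G_nd _ _ (leq_maxr i j)); apply.
Qed.

Section LebesgueTuple.
Variable R : realType.
Notation mu := (@lebesgue_measure R).
Notation lebt n := (@lebesgue_tuple R n).

Let cns n (p : measurableTypeR R * n.-tuple R) : n.+1.-tuple R := [tuple of p.1 :: p.2].

Let mcns n : measurable_fun setT (@cns n).
Proof. exact: measurable_cons. Qed.

(** Sigma-finiteness is carried along the recursion because the next product
    measure and Tonelli's theorem depend on it. *)
Definition lebesgue_tuple_measure n :
  {m : {sigma_finite_measure set (n.-tuple R) -> \bar R} | lebt n = m}.
Proof.
elim: n => [|n [m IH]].
  by exists [the {sigma_finite_measure set _ -> \bar R} of dirac [tuple]].
pose p : {measure set (n.+1.-tuple R) -> \bar R} :=
  measure_function_pushforward__canonical__measure_function_Measure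
    (mu \x m)%E (@mcns n).
have sf : sigma_finite setT (p : set _ -> \bar R).
  have [F FT mF] := sigma_finite_prod mu m.
  pose h (t : n.+1.-tuple R) : measurableTypeR R * n.-tuple R := (thead t, [tuple of behead t]).
  have mh : measurable_fun setT h.
    apply: measurable_fun_pair; first exact: measurable_tnth.
    exact: measurable_behead.
  have hK x : h (cns x) = x.
    by case: x => a t; rewrite /h /cns theadE; congr (_, _); exact: val_inj.
  exists (fun i => h @^-1` F i).
    by rewrite -preimage_bigcup -FT preimage_setT.
  move=> i; split.
    by rewrite -[X in measurable X]setTI; apply: mh => //; case: (mF i).
  rewrite /p /= /pushforward.
  have -> : @cns n @^-1` (h @^-1` F i) = F i.
    by apply/seteqP; split => x; rewrite /preimage /= hK.
  by case: (mF i).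
pose q : {sigma_finite_measure set (n.+1.-tuple R) -> \bar R} :=
  HB.pack (p : set _ -> \bar R) (Measure.on p)
    (Measure_isSigmaFinite.Build _ _ _ (p : set _ -> \bar R) sf).
exists q; rewrite /= IH //.
Defined.

Definition lebn n := projT1 (lebesgue_tuple_measure n).

Lemma lebnE n : lebt n = lebn n.
Proof. exact: (projT2 (lebesgue_tuple_measure n)). Qed.

Lemma integral_lebnS n (f : n.+1.-tuple R -> \bar R) :
  measurable_fun setT f -> (forall t, 0 <= f t)%E ->
  (\int[lebn n.+1]_t f t = \int[mu]_x \int[lebn n]_t f [tuple of x :: t])%E.
Proof.
move=> mf f0.
transitivity (\int[pushforward (mu \x lebn n)%E (@cns n)]_t f t)%E.
  by apply: eq_integral_raw => A mA; rewrite -lebnE /= lebnE.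
rewrite ge0_integral_pushforward//.
rewrite preimage_setT fubini_tonelli1//.
- exact: (measurableT_comp mf (@mcns n)).
- by move=> x; exact: f0.
- exact: mcns.
Qed.

Lemma integral_lebn0 (f : 0.-tuple R -> \bar R) :
  measurable_fun setT f -> (\int[lebn 0]_t f t = f [tuple])%E.
Proof.
move=> mf; transitivity (\int[dirac [tuple]]_t f t)%E.
  by apply: eq_integral_raw => A mA; rewrite -lebnE.
by rewrite integral_dirac// diracT mul1e.
Qed.

End LebesgueTuple.

(** * The Dirichlet integral *)

Section DirichletIntegral.
Variable R : realType.
Notation mu := (@lebesgue_measure R).

Lemma rising0 (x : R) : rising x 0 = 1.
Proof. by rewrite /rising big_ord0. Qed.

Lemma risingS (x : R) n : rising x n.+1 = rising x n * (x + n%:R).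
Proof. by rewrite /rising big_ord_recr. Qed.

Lemma rising_gt0 (x : R) n : 0 < x -> 0 < rising x n.
Proof. by move=> x0; apply: prodr_gt0 => i _; rewrite ltr_wpDr. Qed.

Definition beta_fun (p q : R) : R := fine (Beta p q).

Lemma beta_funE p q : 0 < p -> 0 < q -> Beta p q = (beta_fun p q)%:E.
Proof. by move=> p0 q0; rewrite /beta_fun fineK// Beta_fin. Qed.

Lemma beta_fun_gt0 p q : 0 < p -> 0 < q -> 0 < beta_fun p q.
Proof. by move=> p0 q0; rewrite -lte_fin -beta_funE// Beta_gt0. Qed.

Lemma beta_fun_succl p q : 0 < p -> 0 < q -> beta_fun (p + 1) q = beta_fun p q * (p / (p + q)).
Proof.
move=> p0 q0; have := Beta_succl p0 q0.
rewrite !beta_funE ?addr_gt0// -!EFinM => -[e].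
by rewrite mulrA -e mulfK// gt_eqF ?addr_gt0.
Qed.

Lemma beta_fun_succr p q : 0 < p -> 0 < q -> beta_fun p (q + 1) = beta_fun p q * (q / (p + q)).
Proof.
move=> p0 q0; have := Beta_succr p0 q0.
rewrite !beta_funE ?addr_gt0// -!EFinM => -[e].
by rewrite mulrA -e mulfK// gt_eqF ?addr_gt0.
Qed.

Lemma beta_fun_shift p q m l : 0 < p -> 0 < q ->
  beta_fun (p + m%:R) (q + l%:R) =
  beta_fun p q * (rising p m * rising q l / rising (p + q) (m + l)).
Proof.
move=> p0 q0; elim: m => [|m IH].
  rewrite addr0 rising0 mul1r add0n; elim: l => [|l IH].
    by rewrite addr0 !rising0 divr1 mulr1.
  have ql : 0 < q + l%:R by rewrite ltr_wpDr.
  rewrite -natr1 addrA beta_fun_succr// IH !risingS.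
  have h1 := gt_eqF (rising_gt0 l (addr_gt0 p0 q0)).
  have h2 : p + q + l%:R != 0 by apply: lt0r_neq0; lra.
  by field; rewrite h2 h1.
have pm : 0 < p + m%:R by rewrite ltr_wpDr.
have ql : 0 < q + l%:R by rewrite ltr_wpDr.
rewrite -natr1 addrA beta_fun_succl// IH addSn !risingS natrD.
have h1 := gt_eqF (rising_gt0 (m + l) (addr_gt0 p0 q0)).
have h2 : p + m%:R + (q + l%:R) != 0 by apply: lt0r_neq0; exact: addr_gt0.
rewrite [p + q + _]addrACA; move: (p + m%:R + _) h2 => u h2.
by field; rewrite h2 h1.
Qed.

(** The normalising constant of a Dirichlet law. Integrating out the first
    coordinate leaves a Beta integral whose second parameter is the sum of the
    remaining ones, [c] being the last of all. *)
Fixpoint iter_beta n (b : nat -> R) (c : R) : R :=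
  if n is n'.+1 then
    beta_fun (b 0%N) (\sum_(i < n') b i.+1 + c) * iter_beta n' (b \o S) c
  else 1.

Lemma iter_beta_gt0 n (b : nat -> R) c : (forall i, 0 < b i) -> 0 < c -> 0 < iter_beta n b c.
Proof.
move=> + c0; elim: n b => [|n IH] b b0 //=.
rewrite mulr_gt0 ?IH ?beta_fun_gt0//; last by move=> i; exact: b0.
by rewrite ltr_wpDl ?sumr_ge0// => i _; exact: ltW.
Qed.

(** The rising factorials of the partial sums cancel between consecutive Beta
    factors; only the first denominator survives. *)
Lemma iter_beta_shift n (b : nat -> R) c (m : nat -> nat) l :
  (forall i, 0 < b i) -> 0 < c ->
  iter_beta n (fun i => b i + (m i)%:R) (c + l%:R) = iter_beta n b c *
   ((\prod_(i < n) rising (b i) (m i)) * rising c l /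
    rising (\sum_(i < n) b i + c) (\sum_(i < n) m i + l)).
Proof.
move=> + c0; elim: n b m => [|n IH] b m b0 /=.
  by rewrite !big_ord0 mul1r add0n add0r mul1r divff// gt_eqF ?rising_gt0.
have -> : \sum_(i < n) (b i.+1 + (m i.+1)%:R) + (c + l%:R) =
    \sum_(i < n) b i.+1 + c + (\sum_(i < n) m i.+1 + l)%:R.
  by rewrite big_split /= natrD natr_sum addrACA.
have S0 : 0 < \sum_(i < n) b i.+1 + c.
  by rewrite ltr_wpDl ?sumr_ge0// => i _; exact: ltW.
rewrite beta_fun_shift// (IH (b \o S) (m \o S)); last by move=> i; exact: b0.
have sumS (F : nat -> R) : \sum_(i < n.+1) F i = F 0%N + \sum_(i < n) F i.+1.
  by rewrite big_ord_recl.
have sumSn (F : nat -> nat) : (\sum_(i < n.+1) F i = F 0 + \sum_(i < n) F i.+1)%N.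
  by rewrite big_ord_recl.
have prodS (F : nat -> R) : \prod_(i < n.+1) F i = F 0%N * \prod_(i < n) F i.+1.
  by rewrite big_ord_recl.
rewrite (sumS b) (sumSn m) (prodS (fun i => rising (b i) (m i))) /=.
rewrite -!addrA -addnA.
have h1 := gt_eqF (rising_gt0 (\sum_(i < n) m i.+1 + l) S0).
have h2 := gt_eqF (rising_gt0 (m 0%N + (\sum_(i < n) m i.+1 + l)) (addr_gt0 (b0 0%N) S0)).
by field; rewrite h2 h1.
Qed.

(** The total mass [r] is left free so that fixing one coordinate gives an
    integrand of the same form, with [r] diminished. *)
Definition dir_integrand n (b : nat -> R) c r (y : n.-tuple R) : R :=
  \prod_(i < n) pospow (b i) (nth 0 y i) * pospow c (r - \sum_(x <- y) x).

Lemma measurable_tuple_nth n (i : 'I_n) :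
  measurable_fun setT (fun y : n.-tuple R => nth 0 y i).
Proof.
under eq_fun do rewrite -tnth_nth; exact: measurable_tnth.
Qed.

Lemma measurable_tuple_sum n :
  measurable_fun setT (fun y : n.-tuple R => \sum_(x <- y) x).
Proof.
under eq_fun do rewrite big_tuple; apply: measurable_sum => i.
exact: measurable_tnth.
Qed.

Lemma measurable_dir_integrand n b c r : measurable_fun setT (@dir_integrand n b c r).
Proof.
apply: measurable_funM.
  apply: measurable_prod => i _; apply: measurableT_comp.
    exact: measurable_pospow.
  exact: measurable_tuple_nth.
apply: measurableT_comp; first exact: measurable_pospow.
by apply: measurable_funB => //; exact: measurable_tuple_sum.
Qed.

Lemma dir_integrand_ge0 n b c r (y : n.-tuple R) : 0 <= dir_integrand b c r y.
Proof. by rewrite mulr_ge0 ?pospow_ge0// prodr_ge0// => i _; exact: pospow_ge0. Qed.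

(** Integrating out the inner coordinates leaves a power of [r - x], and the
    integral over [x] is then the convolution [pospow_conv]. *)
Lemma integral_dir_integrand n (b : nat -> R) c r :
  (forall i, 0 < b i) -> 0 < c ->
  (\int[lebn R n]_y (dir_integrand b c r y)%:E =
   (iter_beta n b c * pospow (\sum_(i < n) b i + c) r)%:E)%E.
Proof.
move=> + c0; elim: n b r => [|n IH] b r b0.
  rewrite integral_lebn0; last by apply/measurable_EFinP; exact: measurable_dir_integrand.
  by rewrite /dir_integrand !big_ord0 !mul1r big_nil subr0 add0r.
have S0 : 0 < \sum_(i < n) b i.+1 + c.
  by rewrite ltr_wpDl ?sumr_ge0// => i _; exact: ltW.
rewrite integral_lebnS; last 2 first.
- by apply/measurable_EFinP; exact: measurable_dir_integrand.
- by move=> t; rewrite lee_fin dir_integrand_ge0.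
transitivity (\int[mu]_x ((pospow (b 0%N) x)%:E *
   (iter_beta n (b \o S) c * pospow (\sum_(i < n) b i.+1 + c) (r - x))%:E))%E.
  apply: eq_integral => x _; rewrite -(IH (b \o S)); last by move=> i; exact: b0.
  rewrite -ge0_integralZl//; last 3 first.
  - by apply/measurable_EFinP; exact: measurable_dir_integrand.
  - by move=> t _; rewrite lee_fin dir_integrand_ge0.
  - by rewrite lee_fin pospow_ge0.
  apply: eq_integral => t _; rewrite -EFinM; congr EFin.
  rewrite /dir_integrand big_ord_recl /= big_cons opprD addrA.
  by rewrite -mulrA.
transitivity (\int[mu]_x ((iter_beta n (b \o S) c)%:E *
   (pospow (b 0%N) x * pospow (\sum_(i < n) b i.+1 + c) (r - x))%:E))%E.
  by apply: eq_integral => x _; rewrite -!EFinM; congr EFin; ring.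
rewrite ge0_integralZl//; last 3 first.
- by apply/measurable_EFinP; exact: measurable_pospow2.
- by move=> x _; rewrite lee_fin mulr_ge0 ?pospow_ge0.
- by rewrite lee_fin ltW// iter_beta_gt0// => i; exact: b0.
rewrite pospow_conv// beta_funE// -!EFinM; congr EFin.
rewrite [in RHS]big_ord_recl /= -addrA mulrA; congr (_ * _).
exact: mulrC.
Qed.

End DirichletIntegral.

(** * Dirichlet laws and their posteriors *)

Section GammaPositive.
Variable R : realType.
Notation mu := (@lebesgue_measure R).

(** Both bounds are needed, since [fine] maps infinity to 0: the integrand is at
    least [exp (-1)] times that of [Beta x 1], and at most the sum of the latter
    and of the exponential density. *)
Lemma Gamma_gt0 (x : R) : 0 < x -> x <= 1 -> 0 < Gamma x.
Proof.
move=> x0 x1; rewrite /Gamma /Rintegral.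
set D := `]0, +oo[%classic : set R.
have mD : measurable (D : set (measurableTypeR R)) by exact: measurable_itv.
pose f (t : R) := t `^ (x - 1) * expR (- t).
have f0 t : 0 <= f t by rewrite mulr_ge0 ?powR_ge0 ?expR_ge0.
have mf : measurable_fun setT f.
  apply: measurable_funM; first exact: measurable_powR.
  by apply: measurableT_comp => //; exact: measurable_funN.
pose g (t : R) := pospow x t * pospow 1 (1 - t).
have mg : measurable_fun setT g by exact: measurable_pospow2.
have g0 t : 0 <= g t by rewrite mulr_ge0 ?pospow_ge0.
have gE t : g t = if 0 < t < 1 then t `^ (x - 1) else 0.
  rewrite /g /pospow subr_gt0 subrr powRr0.
  by case: (0 < t); case: (t < 1); rewrite ?mulr1 ?mulr0.
have BE : Beta x 1 = (\int[mu]_t (g t)%:E)%E by [].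
have B0 := Beta_gt0 x0 ltr01; have Bf := Beta_fin x0 ltr01.
change (0 < fine (\int[mu]_(t in D) (f t)%:E)%E).
rewrite fine_gt0//; apply/andP; split.
  apply: (@lt_le_trans _ _ ((expR (- 1))%:E * Beta x 1)%E).
    by rewrite mule_gt0// lte_fin expR_gt0.
  rewrite BE -ge0_integralZl//; last 2 first.
  - by apply/measurable_EFinP.
  - by move=> t _; rewrite lee_fin.
  rewrite [leRHS]integral_mkcond; apply: ge0_le_integral => //.
  - by move=> t _; rewrite -EFinM lee_fin mulr_ge0 ?expR_ge0.
  - by apply/measurable_EFinP; exact: measurable_funM.
  - apply: (measurable_restrictT (EFin \o f) mD).1.
    by apply: measurable_funTS; apply/measurable_EFinP.
  - move=> t _; rewrite patchE mem_setE in_itv /= andbT -EFinM gE.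
    case: ifPn => [/andP[t0 t1]|_].
      by rewrite t0 lee_fin /f mulrC ler_wpM2l ?powR_ge0// ler_expR lerN2 ltW.
    by rewrite mulr0; case: ifP => _; rewrite lee_fin.
pose e (t : R) := exponential_pdf 1 t.
have e0 t : 0 <= e t by exact: exponential_pdf_ge0.
have me : measurable_fun setT e by exact: measurable_exponential_pdf.
apply: (@le_lt_trans _ _ (\int[mu]_t ((g t)%:E + (e t)%:E))%E).
  rewrite [leLHS]integral_mkcond; apply: ge0_le_integral => //.
  - by move=> t _; rewrite patchE; case: ifP => // _; rewrite lee_fin.
  - apply: (measurable_restrictT (EFin \o f) mD).1.
    by apply: measurable_funTS; apply/measurable_EFinP.
  - by apply/measurable_EFinP; exact: measurable_funD.
  move=> t _; rewrite patchE mem_setE in_itv /= andbT -EFinD gE.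
  case: ifPn => t0; last by rewrite /= add0r lee_fin.
  rewrite lee_fin /=; case: ifPn => t1.
    apply: (@le_trans _ _ (t `^ (x - 1))); last by rewrite lerDl.
    rewrite /f -[leRHS]mulr1 ler_wpM2l ?powR_ge0//.
    by rewrite -expR0 ler_expR oppr_le0 ltW.
  rewrite add0r /e (exponential_pdfE _ (ltW t0)) mul1r mulN1r -[X in _ <= X]mul1r.
  rewrite ler_wpM2r ?expR_ge0//.
  have t1' : 1 <= t by move: t1; rewrite -leNgt.
  by rewrite -[X in _ <= X](powRr0 t) ler_powR// subr_le0.
rewrite ge0_integralD//; last 4 first.
- by move=> t _; rewrite lee_fin.
- by apply/measurable_EFinP.
- by move=> t _; rewrite lee_fin.
- by apply/measurable_EFinP.
rewrite -BE integral_exponential_pdf// lte_add_pinfty// ?ltry//.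
by rewrite -ge0_fin_numE ?Beta_ge0.
Qed.

End GammaPositive.

Lemma integral_mkcond_raw d (T : measurableType d) (R : realType)
    (m : set T -> \bar R) (D : set T) (f : T -> \bar R) :
  (\int[m]_(x in D) f x = \int[m]_x (f \_ D) x)%E.
Proof. by rewrite /integral /= patch_setT. Qed.

(** List each [i] in turn, [p i] times. *)
Lemma word_counts_surj k (p : 'I_k -> nat) :
  exists w : seq 'I_k, forall i, count_mem i w = p i.
Proof.
exists (flatten [seq nseq (p i) i | i <- enum 'I_k]) => i.
rewrite count_flatten -map_comp sumnE big_map big_enum /= (bigD1 i)//=.
rewrite count_nseq /= eqxx mul1n big1 ?addn0// => j /negbTE ji.
by rewrite count_nseq /= ji mul0n.
Qed.

Section Posterior.
Variables (R : realType) (n : nat).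
Notation mu := (@lebesgue_measure R).
Implicit Types (a : 'rV[R]_n.+1) (y : n.-tuple R).

Definition chartn (y : n.-tuple R) : n.+1.-tuple R := @chart R n.+1 y.

Lemma measurable_chartn : measurable_fun setT chartn.
Proof.
apply/measurable_fun_tnthP => i.
rewrite (_ : _ \o _ = fun y : n.-tuple R =>
  if (i < n)%N then nth 0 y i else 1 - \sum_(x <- y) x); last first.
  by apply/funext => y /=; rewrite tnth_mktuple.
case: ltnP => ni; first exact: (@measurable_tuple_nth R n (Ordinal ni)).
by apply: measurable_funB => //; exact: measurable_tuple_sum.
Qed.

Definition dir_weight a y : R := \prod_i pospow (a 0 i) (tnth (chartn y) i).

(** [iter_beta] reads its parameters off a sequence. The last one is passed
    separately, since the last barycentric coordinate is a function of the
    others. *)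
Let bseq a (i : nat) : R := a 0 (inord i).

Definition dir_const a : R := iter_beta n (bseq a) (a 0 ord_max).

Let bseqE a (i : 'I_n) : bseq a i = a 0 (widen_ord (leqnSn n) i).
Proof.
congr (a 0 _); apply/val_inj.
by rewrite /= inordK// ltnW// ltnS.
Qed.

Let bseq_gt0 a i : (forall i, 0 < a 0 i) -> 0 < bseq a i.
Proof. by move=> a0; exact: a0. Qed.

Lemma dir_weightE a y : dir_weight a y = dir_integrand (bseq a) (a 0 ord_max) 1 y.
Proof.
rewrite /dir_weight /dir_integrand big_ord_recr /= tnth_mktuple /= ltnn; congr (_ * _).
by apply: eq_bigr => i _; rewrite tnth_mktuple /= ltn_ord bseqE.
Qed.

Lemma dir_weight_ge0 a y : 0 <= dir_weight a y.
Proof. by rewrite dir_weightE dir_integrand_ge0. Qed.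

Lemma measurable_dir_weight a : measurable_fun setT (dir_weight a).
Proof.
rewrite (_ : dir_weight a = fun y => dir_integrand (bseq a) (a 0 ord_max) 1 y).
  exact: measurable_dir_integrand.
by apply/funext => y; exact: dir_weightE.
Qed.

Lemma dir_const_gt0 a : (forall i, 0 < a 0 i) -> 0 < dir_const a.
Proof. by move=> a0; rewrite iter_beta_gt0// => i; exact: bseq_gt0. Qed.

Lemma integral_dir_weight a : (forall i, 0 < a 0 i) ->
  (\int[lebn R n]_y (dir_weight a y)%:E = (dir_const a)%:E)%E.
Proof.
move=> a0; under eq_integral do rewrite dir_weightE.
rewrite integral_dir_integrand//; last by move=> i; exact: bseq_gt0.
rewrite pospow_gt// powR1 mulr1 //.
Qed.

Lemma dir_const_shift a (m : 'I_n.+1 -> nat) : (forall i, 0 < a 0 i) ->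
  dir_const (a + \row_i (m i)%:R) =
  dir_const a * ((\prod_i rising (a 0 i) (m i)) / rising (mass a) (\sum_i m i)%N).
Proof.
move=> a0; rewrite /dir_const.
have := @iter_beta_shift R n (bseq a) (a 0 ord_max) (fun i => m (inord i))
  (m ord_max) (fun i => bseq_gt0 i a0) (a0 _).
have rnE i : inord (widen_ord (leqnSn n) i) = widen_ord (leqnSn n) i :> 'I_n.+1.
  by rewrite inord_val.
rewrite /mass !(big_ord_recr n) /=.
rewrite (_ : iter_beta n _ (_ + _) = iter_beta n (bseq (a + \row_i (m i)%:R))
  ((a + \row_i (m i)%:R) 0 ord_max)).
  move=> ->; congr (_ * (_ * _ / rising (_ + _) (_ + _))).
  - by apply: eq_bigr => i _; rewrite bseqE (rnE i).
  - by apply: eq_bigr => i _; rewrite bseqE.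
  - by apply: eq_bigr => i _; rewrite (rnE i).
by congr (iter_beta n _ _); [apply/funext => i; rewrite /bseq|]; rewrite !mxE.
Qed.

(** Multiplying the weight by a monomial shifts its parameters; all moments are
    thus ratios of normalising constants. *)
Lemma dir_weight_moment a (m : 'I_n.+1 -> nat) y :
  dir_weight (a + \row_i (m i)%:R) y = (\prod_i tnth (chartn y) i ^+ m i) * dir_weight a y.
Proof.
rewrite /dir_weight -big_split; apply: eq_bigr => i _ /=; rewrite !mxE.
elim: (m i) => [|j IH]; first by rewrite addr0 expr0 mul1r.
by rewrite -natr1 addrA pospowS IH exprS mulrA.
Qed.

(** The two sides could differ only where a coordinate [y_i] vanishes and
    [a_i = 1]. As the positive [a_i] sum to 1 there would then be no other
    coordinate, but [y_i] would have to be 1. *)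
Lemma simplex_chartn (a : 'rV[R]_n.+1) y : (forall i, 0 < a 0 i) -> \sum_i a 0 i = 1 ->
  simplex (chartn y) ->
  \prod_i tnth (chartn y) i `^ (a 0 i - 1) = dir_weight a y.
Proof.
move=> a0 a1 [y0 y1]; apply: eq_bigr => i _; rewrite /pospow.
case: ifPn => //; rewrite -leNgt => yi0.
have yi : tnth (chartn y) i = 0 by apply/eqP; rewrite eq_le yi0 y0.
rewrite yi powR0// subr_eq0; apply/eqP => ai.
have aj0 : \sum_(j | j != i) a 0 j = 0.
  move: a1; rewrite (bigD1 i)//= ai => /eqP.
  by rewrite -[X in _ == X]addr0 (inj_eq (addrI _)) => /eqP.
have : \sum_(j | j != i) tnth (chartn y) j = 1 by move: y1; rewrite (bigD1 i)//= yi add0r.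
have [j ji|nj] := pickP (fun j => j != i).
  move: aj0; rewrite (bigD1 j)//= => /eqP; rewrite gt_eqF//.
  by rewrite ltr_wpDr ?a0// sumr_ge0// => *; exact: ltW.
by rewrite big_pred0// => /eqP; rewrite eq_sym oner_eq0.
Qed.

Lemma nsimplex_chartn (a : 'rV[R]_n.+1) y : ~ simplex (chartn y) -> dir_weight a y = 0.
Proof.
move=> ns; have [[i yi]|h] := pselect (exists i, tnth (chartn y) i < 0).
  by rewrite /dir_weight (bigD1 i)//= pospow_le0 ?mul0r// ltW.
case: ns; split=> [i|]; first by rewrite leNgt; apply/negP => yi; apply: h; exists i.
rewrite big_ord_recr /= tnth_mktuple /= ltnn.
rewrite [X in X + _](_ : _ = \sum_(x <- y) x); first by rewrite addrC subrK.
by rewrite big_tuple; apply: eq_bigr => i _; rewrite tnth_mktuple /= ltn_ord -tnth_nth.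
Qed.

Lemma dirichletE (a : 'rV[R]_n.+1) A : (forall i, 0 < a 0 i) -> \sum_i a 0 i = 1 ->
  dirichlet a A = (\int[lebn R n]_(y in chartn @^-1` A)
    (Gamma (mass a) / (\prod_i Gamma (a 0 i)) * dir_weight a y)%:E)%E.
Proof.
move=> a0 a1; rewrite /dirichlet /= lebnE.
rewrite [LHS]integral_mkcond [RHS]integral_mkcond; apply: eq_integral => y _.
rewrite !patchE /dirichlet_density; have [Ay|nAy] := pselect (A (chartn y)); last first.
  rewrite [in LHS]ifF ?[in RHS]ifF//; apply/negbTE/negP; rewrite inE; last by case.
  by move=> Ay; exact: nAy.
rewrite [in RHS]mem_set//; have [Sy|nSy] := pselect (simplex (chartn y)).
  by rewrite mem_set//; congr (_ * _)%:E; exact: simplex_chartn.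
rewrite (nsimplex_chartn _ nSy) mulr0 ifF//.
by apply/negbTE/negP; rewrite inE => -[].
Qed.

Lemma sumr_pred_const (T : finType) (P : pred T) (r : R) :
  \sum_(x | P x) r = #|P|%:R * r.
Proof. by rewrite mulr_natl -sumr_const; apply: eq_bigl => x. Qed.

Lemma samples_exist k (p : 'I_k -> nat) : exists x, samples (p := p) x.
Proof.
have [w wp] := word_counts_surj p.
have sw : size w = (\sum_i p i)%N.
  rewrite -sum1_size (partition_big id predT)//=; apply: eq_bigr => i _.
  by rewrite sum1_count wp.
exists [ffun j => tnth (in_tuple w) (cast_ord (esym sw) j)].
apply/forallP => i; apply/eqP; rewrite -wp.
rewrite -sum1_card -sum1_count [RHS]big_tnth.
rewrite (reindex (cast_ord (esym sw))) /=; last first.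
  by apply: onW_bij; exists (cast_ord sw) => j; rewrite ?cast_ordK ?cast_ordKV.
by apply: eq_bigl => j; rewrite inE ffunE.
Qed.

Lemma prod_samples k (p : 'I_k -> nat) x (y : k.-tuple R) :
  samples (p := p) x -> \prod_j tnth y (x j) = \prod_i tnth y i ^+ p i.
Proof.
move=> /forallP px; rewrite (partition_big x predT)//=; apply: eq_bigr => i _.
rewrite -(eqP (px i)) -prodr_const; apply: eq_big => j; first by rewrite inE.
by move=> /eqP ->.
Qed.

Section Given.
Variables (alpha : 'rV[R]_n.+1) (p : 'I_n.+1 -> nat).
Hypotheses (alpha0 : forall i, 0 < alpha 0 i) (alpha1 : \sum_i alpha 0 i = 1).

Let a := alpha + \row_i (p i)%:R.
Let C : R := Gamma (mass alpha) / \prod_i Gamma (alpha 0 i).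

Let C_gt0 : 0 < C.
Proof.
have le1 i : alpha 0 i <= 1.
  by rewrite -alpha1 (bigD1 i)//= lerDl sumr_ge0// => j _; exact: ltW.
rewrite divr_gt0 ?prodr_gt0//; last by move=> i _; exact: Gamma_gt0.
by rewrite /mass alpha1 Gamma_gt0.
Qed.

Let a0 i : 0 < a 0 i. Proof. by rewrite !mxE ltr_wpDr. Qed.

Let joint_term x A : samples (p := p) x -> measurable A ->
  (\int[dirichlet alpha]_(y in A) (\prod_j tnth y (x j))%:E =
   \int[lebn R n]_(y in chartn @^-1` A) (C * dir_weight a y)%:E)%E.
Proof.
move=> px mA; pose g (y : n.+1.-tuple R) : R := \prod_j tnth y (x j).
transitivity (\int[dirichlet alpha]_y ((g \_ A) y)%:E)%E.
  rewrite integral_mkcond_raw; congr (integral _ _ _); apply/funext => y.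
  by rewrite !patchE; case: ifP.
rewrite (@integral_density _ _ _ _ R (lebn R n) chartn
  (fun y => C * dir_weight alpha y) _ _ _ (dirichlet alpha) (g \_ A)).
- rewrite [RHS]integral_mkcond; apply: eq_integral => y _; rewrite !patchE.
  rewrite [y \in _](_ : _ = (chartn y \in A)); last first.
    by apply/idP/idP; rewrite !inE.
  case: ifP => _; last by rewrite mul0r.
  by rewrite /g (prod_samples _ px) /a dir_weight_moment mulrCA.
- exact: measurable_chartn.
- by apply: measurable_funM => //; exact: measurable_dir_weight.
- by move=> y; rewrite mulr_ge0 ?dir_weight_ge0// ltW.
- by move=> B _; exact: dirichletE.
- apply: (measurable_restrictT g mA).1; apply: measurable_funTS.
  by apply: measurable_prod => j _; exact: measurable_tnth.
Qed.

Let mpre (A : set (n.+1.-tuple R)) : measurable A -> measurable (chartn @^-1` A).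
Proof. by move=> mA; rewrite -[X in measurable X]setTI; exact: measurable_chartn. Qed.

Let N := #|samples (p := p)|.

Let jointE A : measurable A ->
  joint (dirichlet alpha) p A = ((N%:R * C)%:E *
    \int[lebn R n]_(y in chartn @^-1` A) (dir_weight a y)%:E)%E.
Proof.
move=> mA; rewrite /joint.
transitivity (\sum_(x | samples (p := p) x)
    \int[lebn R n]_(y in chartn @^-1` A) (C * dir_weight a y)%:E)%E.
  by apply: eq_bigr => x px; exact: joint_term.
have mw : measurable_fun (chartn @^-1` A) (EFin \o dir_weight a).
  by apply: measurable_funTS; apply/measurable_EFinP; exact: measurable_dir_weight.
have -> : (\int[lebn R n]_(y in chartn @^-1` A) (C * dir_weight a y)%:E = C%:E *
    \int[lebn R n]_(y in chartn @^-1` A) (dir_weight a y)%:E)%E.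
  rewrite -ge0_integralZl//; first exact: mpre.
  - by move=> y _; rewrite lee_fin dir_weight_ge0.
  - by rewrite lee_fin ltW.
set I := integral _ _ _.
have If : I \is a fin_num.
  rewrite ge0_fin_numE; last by apply: integral_ge0 => y _; rewrite lee_fin dir_weight_ge0.
  apply: (@le_lt_trans _ _ (dir_const a)%:E); last exact: ltry.
  rewrite -(integral_dir_weight a0); apply: ge0_subset_integral => //.
  - exact: mpre.
  - by apply/measurable_EFinP; exact: measurable_dir_weight.
  - by move=> y _; rewrite lee_fin dir_weight_ge0.
rewrite -(fineK If) -!EFinM sumEFin; congr EFin.
by rewrite sumr_pred_const (mulrA _ C).
Qed.

(** Every sample with counts [p] has the same likelihood [y^p], so that the
    number of samples cancels in the normalisation, as does the constant of the
    prior. *)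
Lemma posteriorE A : measurable A ->
  posterior (dirichlet alpha) p A =
  (\int[lebn R n]_(y in chartn @^-1` A) ((dir_const a)^-1 * dir_weight a y)%:E)%E.
Proof.
move=> mA; rewrite /posterior !jointE// preimage_setT integral_dir_weight//.
have NC : 0 < N%:R * C.
  rewrite mulr_gt0// ltr0n /N; have [x px] := samples_exist p.
  by apply/card_gt0P; exists x.
have I0 := dir_const_gt0 a0.
rewrite -EFinM /= muleAC -EFinM invfM mulrA divff ?gt_eqF// mul1r.
rewrite -ge0_integralZl//; first exact: mpre.
- by apply: measurable_funTS; apply/measurable_EFinP; exact: measurable_dir_weight.
- by move=> y _; rewrite lee_fin dir_weight_ge0.
- by rewrite lee_fin invr_ge0 ltW.
Qed.

Lemma integral_posterior (f : n.+1.-tuple R -> R) : measurable_fun setT f ->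
  (\int[posterior (dirichlet alpha) p]_y (f y)%:E =
   \int[lebn R n]_y (f (chartn y) * ((dir_const a)^-1 * dir_weight a y))%:E)%E.
Proof.
move=> mf; apply: (@integral_density _ _ _ _ R (lebn R n) chartn) => //.
- exact: measurable_chartn.
- by apply: measurable_funM => //; exact: measurable_dir_weight.
- by move=> y; rewrite mulr_ge0 ?dir_weight_ge0// invr_ge0 ltW// dir_const_gt0.
- by move=> A mA; exact: posteriorE.
Qed.

End Given.
End Posterior.

(** * The characteristic function of a posterior *)

Section ComplexSeq.
Variable R : realType.
Local Notation C := R[i].
Implicit Types (u v : nat -> C) (z w : C) (theta : R).

Lemma ReD z w : complex.Re (z + w) = complex.Re z + complex.Re w.
Proof. by case: z; case: w. Qed.

Lemma ImD z w : complex.Im (z + w) = complex.Im z + complex.Im w.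
Proof. by case: z; case: w. Qed.

Lemma ReM z w : complex.Re (z * w) =
  complex.Re z * complex.Re w - complex.Im z * complex.Im w.
Proof. by case: z; case: w. Qed.

Lemma ImM z w : complex.Im (z * w) =
  complex.Re z * complex.Im w + complex.Im z * complex.Re w.
Proof. by case: z; case: w. Qed.

Lemma Re_scale (r : R) z : complex.Re (r%:C * z) = r * complex.Re z.
Proof. by rewrite ReM /= mul0r subr0. Qed.

Lemma Im_scale (r : R) z : complex.Im (r%:C * z) = r * complex.Im z.
Proof. by rewrite ImM /= mul0r addr0. Qed.

(** Convergence of real and imaginary parts, each of which will come from a
    convergence of real integrals. *)
Definition cvgC u z :=
  complex.Re (u n) @[n --> \oo] --> complex.Re z /\
  complex.Im (u n) @[n --> \oo] --> complex.Im z.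

Lemma cvgCM u v z w : cvgC u z -> cvgC v w -> cvgC (fun n => u n * v n) (z * w).
Proof.
move=> [ur ui] [vr vi]; split.
  under eq_fun do rewrite ReM; rewrite ReM.
  by apply: cvgB; apply: cvgM.
under eq_fun do rewrite ImM; rewrite ImM.
by apply: cvgD; apply: cvgM.
Qed.

Lemma cvgC_prod (I : Type) (r : seq I) (u : I -> nat -> C) (z : I -> C) :
  (forall i, cvgC (u i) (z i)) ->
  cvgC (fun n => \prod_(i <- r) u i n) (\prod_(i <- r) z i).
Proof.
move=> h; elim: r => [|i r IH].
  rewrite big_nil; under eq_fun do rewrite big_nil.
  by split; exact: cvg_cst.
rewrite big_cons; under eq_fun do rewrite big_cons.
exact: cvgCM.
Qed.

Lemma cvgC_lim u z : cvgC u z -> limn (u : nat -> C^o) = z.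
Proof.
move=> [ur ui]; apply: cvg_lim; first exact: norm_hausdorff.
apply/(@cvgrPdist_lt _ C^o) => e e0.
have [eI eR] : complex.Im e = 0 /\ 0 < complex.Re e.
  by move: e0; rewrite ltcE /= => /andP[/eqP -> ->].
have e2 : 0 < complex.Re e / 2 by rewrite divr_gt0.
have hr := (@cvgrPdist_lt _ R^o _ _ _ _ _).1 ur _ e2.
have hi := (@cvgrPdist_lt _ R^o _ _ _ _ _).1 ui _ e2.
near=> n.
have h1 : `|complex.Re z - complex.Re (u n)| < complex.Re e / 2 by near: n; exact: hr.
have h2 : `|complex.Im z - complex.Im (u n)| < complex.Re e / 2 by near: n; exact: hi.
rewrite (complexE (z - u n)).
apply: le_lt_trans (ler_normD _ _) _.
rewrite normrM [`|'i%C|](_ : _ = 1) ?mul1r; last by rewrite normc_def /= expr0n expr1n add0r sqrtr1.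
have nr (x : R) : `|x%:C| = `|x|%:C :> C.
  by rewrite normc_def /= expr0n addr0 sqrtr_sqr.
rewrite !nr -raddfD /= ltcE /= eI eqxx /=.
move: h1 h2; case: (z) => a b; case: (u n) => c d /= h1 h2.
by rewrite [ltRHS]splitr ltrD.
Unshelve. all: by end_near. Qed.

Lemma expi_coeff theta l : (0 +i* theta) ^+ l =
  ((~~ odd l)%:R * (-1) ^+ l./2 * theta ^+ l) +i*
  ((odd l)%:R * (-1) ^+ l.-1./2 * theta ^+ l).
Proof.
elim: l => [|l IH]; first by rewrite !expr0 /= mul0r !mulr1.
rewrite exprSr IH /=; apply/eqP; rewrite eq_complex /=.
have hl := odd_double_half l; rewrite uphalf_half.
case: (boolP (odd l)) hl => ol /= hl; rewrite ?mulr0n ?mulr1n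
  ?(mul0r, mulr0, mul1r, mulr1, add0r, addr0, subr0, sub0r) !exprS ?eqxx ?andbT.
  have -> : l.-1./2 = l./2 by rewrite -{1}hl /= doubleK.
  by apply/eqP; ring.
by rewrite oppr0 eqxx /=; apply/eqP; ring.
Qed.

(** Truncated exponential series at [i theta]. *)
Definition expi N theta : C := \sum_(l < N) (0 +i* theta) ^+ l / (l`!)%:R.

Let Re_div_nat z n : complex.Re (z / n%:R) = complex.Re z / n%:R.
Proof. by rewrite mulrC -(rmorph_nat (real_complex R)) -fmorphV Re_scale mulrC. Qed.

Let Im_div_nat z n : complex.Im (z / n%:R) = complex.Im z / n%:R.
Proof. by rewrite mulrC -(rmorph_nat (real_complex R)) -fmorphV Im_scale mulrC. Qed.

Lemma cvg_expi theta : cvgC (expi ^~ theta) (cos theta +i* sin theta).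
Proof.
split=> /=.
  rewrite (_ : (fun N => _) = series (cos_coeff theta)).
    by rewrite unlock; exact: is_cvg_series_cos_coeff.
  apply/funext => N; rewrite /series /= /expi (big_morph _ ReD (erefl : complex.Re 0 = 0)).
  rewrite big_mkord; apply: eq_bigr => l _.
  by rewrite Re_div_nat expi_coeff.
rewrite (_ : (fun N => _) = series (sin_coeff theta)).
  by rewrite unlock; exact: is_cvg_series_sin_coeff.
apply/funext => N; rewrite /series /= /expi (big_morph _ ImD (erefl : complex.Im 0 = 0)).
rewrite big_mkord; apply: eq_bigr => l _.
by rewrite Im_div_nat expi_coeff.
Qed.

Lemma norm_expi N theta : `|expi N theta| <= (expR `|theta|)%:C.
Proof.
apply: (le_trans (ler_norm_sum _ _ _)).
have nr (x : R) : `|0 +i* x| = `|x|%:C :> C.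
  by rewrite normc_def /= expr0n add0r sqrtr_sqr.
rewrite (eq_bigr (fun l : 'I_N => (exp_coeff `|theta| l)%:C)); last first.
  move=> l _; rewrite normrM normfV normrX nr normr_nat.
  by rewrite rmorphM fmorphV rmorphXn rmorph_nat.
rewrite -rmorph_sum lecR /expR.
have := @nondecreasing_cvgn_le R (series (exp_coeff `|theta|)).
rewrite /series /= => /(_ _ _ N); rewrite big_mkord; apply.
  apply/nondecreasing_seqP => n; rewrite big_nat_recr//= lerDl.
  by rewrite divr_ge0// exprn_ge0.
exact: is_cvg_series_exp_coeff.
Qed.

Lemma prod_cos_sin (I : Type) (r : seq I) (f : I -> R) :
  \prod_(i <- r) (cos (f i) +i* sin (f i)) =
  cos (\sum_(i <- r) f i) +i* sin (\sum_(i <- r) f i).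
Proof.
elim: r => [|i r IH]; first by rewrite !big_nil cos0 sin0.
rewrite !big_cons IH cosD sinD; apply/eqP; rewrite eq_complex /=.
by rewrite eqxx /= addrC.
Qed.

End ComplexSeq.

Section Charfun.
Variables (R : realType) (n : nat) (alpha : 'rV[R]_n.+1) (p : 'I_n.+1 -> nat).
Local Notation C := R[i].
Hypotheses (alpha0 : forall i, 0 < alpha 0 i) (alpha1 : \sum_i alpha 0 i = 1).

Let a := alpha + \row_i (p i)%:R.
Let a0 i : 0 < a 0 i. Proof. by rewrite !mxE ltr_wpDr. Qed.
Let w (y : n.-tuple R) : R := (dir_const a)^-1 * dir_weight a y.

Let I0 : 0 < dir_const a. Proof. exact: dir_const_gt0. Qed.

Let w_ge0 y : 0 <= w y.
Proof. by rewrite mulr_ge0 ?dir_weight_ge0// invr_ge0 ltW. Qed.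

Let mw : measurable_fun setT w.
Proof. by apply: measurable_funM => //; exact: measurable_dir_weight. Qed.

Let moment (m : 'I_n.+1 -> nat) : R :=
  (\prod_i rising (a 0 i) (m i)) / rising (mass a) (\sum_i m i)%N.

Let mon (m : 'I_n.+1 -> nat) y : R := \prod_i tnth (chartn y) i ^+ m i.

Let measurable_mon m : measurable_fun setT (mon m).
Proof.
apply: measurable_prod => i _; apply: measurable_funX.
by apply: (measurableT_comp (measurable_tnth i)); exact: measurable_chartn.
Qed.

Let mon_w m y : mon m y * w y = (dir_const a)^-1 * dir_weight (a + \row_i (m i)%:R) y.
Proof. by rewrite dir_weight_moment /w mulrCA. Qed.

Let integral_mon m :
  (\int[lebn R n]_y (mon m y * w y)%:E = (moment m)%:E)%E.
Proof.
under eq_integral do rewrite mon_w EFinM.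
rewrite ge0_integralZl//; last 3 first.
- by apply/measurable_EFinP; exact: measurable_dir_weight.
- by move=> y _; rewrite lee_fin dir_weight_ge0.
- by rewrite lee_fin invr_ge0 ltW.
rewrite integral_dir_weight; last by move=> i; rewrite mxE [X in _ + X]mxE ltr_wpDr.
by rewrite -EFinM dir_const_shift// mulKf// gt_eqF.
Qed.

Let integrable_mon m : (lebn R n).-integrable setT (fun y => (mon m y * w y)%:E).
Proof.
apply/integrableP; split.
  by apply/measurable_EFinP; exact: measurable_funM.
rewrite (eq_integral (fun y => (mon m y * w y)%:E)) ?integral_mon ?ltry//.
move=> y _; rewrite /= ger0_norm// mon_w mulr_ge0 ?dir_weight_ge0// invr_ge0 ltW//.
Qed.

Let integrable_w : (lebn R n).-integrable setT (EFin \o w).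
Proof.
have := integrable_mon (fun=> 0%N); rewrite (_ : (fun y => _) = EFin \o w)//.
by apply/funext => y /=; rewrite /mon big1 ?mul1r// => i _; rewrite expr0.
Qed.

Variable s : 'rV[R]_n.+1.

Let coef (m : 'I_n.+1 -> nat) : C := \prod_i ((0 +i* s 0 i) ^+ m i / (m i)`!%:R).

Let T N y : C := \prod_j expi N (s 0 j * tnth (chartn y) j).

(** Expanding the product of the truncated series gives exactly the monomials
    with exponents in the cube over which the series is summed. *)
Let TE N y : T N y = \sum_(m : {ffun 'I_n.+1 -> 'I_N})
  (mon (fun i => m i) y)%:C * coef (fun i => m i).
Proof.
rewrite /T /expi bigA_distr_bigA; apply: eq_bigr => m _.
rewrite /mon /coef rmorph_prod -big_split; apply: eq_bigr => j _ /=.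
rewrite mulrA; congr (_ / _); rewrite rmorphXn -exprMn; congr (_ ^+ _).
by apply/eqP; rewrite eq_complex /=; apply/andP; split; apply/eqP; ring.
Qed.

Let termE m : series_term a (\row_i (0 +i* s 0 i)) m = (moment m)%:C * coef m.
Proof.
rewrite /series_term /coef -mulrA; congr (_ * _).
rewrite natr_prod -prodf_div.
by apply: eq_bigr => i _; rewrite mxE.
Qed.

Let M : R := \prod_j expR `|s 0 j|.

(** On the simplex all coordinates are at most 1, and off the simplex the weight
    vanishes. *)
Let T_bound N y : `|T N y| * (w y)%:C <= (M * w y)%:C.
Proof.
have [Sy|nSy] := pselect (simplex (chartn y)); last first.
  by rewrite /w (nsimplex_chartn a nSy) mulr0 mulr0 mulr0.
rewrite [leRHS](rmorphM _ M) -subr_ge0 -mulrBl; apply: mulr_ge0; last by rewrite ler0c.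
rewrite subr_ge0.
rewrite normr_prod rmorph_prod.
apply: ler_prod => j _; rewrite normr_ge0 /=.
apply: (le_trans (norm_expi _ _)); rewrite lecR ler_expR normrM.
case: Sy => y0 y1; rewrite ler_piMr// ger0_norm// -y1 (bigD1 j)//= lerDl.
by apply: sumr_ge0 => i _.
Qed.

Let L y : C := cos (\sum_i s 0 i * tnth (chartn y) i) +i* sin (\sum_i s 0 i * tnth (chartn y) i).

Let T_cvg y : cvgC (T ^~ y) (L y).
Proof. rewrite /L -prod_cos_sin; apply: cvgC_prod => j; exact: cvg_expi. Qed.

Section Part.
Variable phi : C -> R.
Hypotheses (phiD : forall z z', phi (z + z') = phi z + phi z') (phi0 : phi 0 = 0).
Hypothesis phiZ : forall r z, phi (r%:C * z) = r * phi z.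
Hypothesis phi_le : forall z, `|phi z|%:C <= `|z|.
Hypothesis phi_cvg : forall y, phi (T N y) @[N --> \oo] --> phi (L y).

Let phiTE N y : phi (T N y) * w y = \sum_(m : {ffun 'I_n.+1 -> 'I_N})
  phi (coef (fun i => m i)) * (mon (fun i => m i) y * w y).
Proof.
rewrite TE (big_morph phi phiD phi0) mulr_suml; apply: eq_bigr => m _.
by rewrite phiZ; ring.
Qed.

Let integral_phiT N : (\int[lebn R n]_y (phi (T N y) * w y)%:E =
  (phi (\sum_(m : {ffun 'I_n.+1 -> 'I_N})
     series_term a (\row_i (0 +i* s 0 i)) (fun i => m i)))%:E)%E.
Proof.
under eq_integral do rewrite phiTE -sumEFin.
under eq_integral do under eq_bigr do rewrite EFinM.
rewrite integral_sum//; last by move=> m; apply: integrableZl => //; exact: integrable_mon.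
rewrite (big_morph phi phiD phi0) -sumEFin; apply: eq_bigr => m _.
rewrite integralZl//.
by rewrite integral_mon -EFinM termE phiZ mulrC.
Qed.

(** [phi] is the real or the imaginary part. The integrand is dominated by [M]
    times the density, uniformly in the truncation. *)
Lemma cvg_part :
  phi (\sum_(m : {ffun 'I_n.+1 -> 'I_N})
     series_term a (\row_i (0 +i* s 0 i)) (fun i => m i)) @[N --> \oo] -->
  fine (\int[lebn R n]_y (phi (L y) * w y)%:E)%E.
Proof.
have mT N : measurable_fun setT (fun y => (phi (T N y) * w y)%:E).
  apply/measurable_EFinP; under eq_fun do rewrite phiTE.
  apply: measurable_sum => m; apply: measurable_funM => //.
  exact: measurable_funM.
have cT y : (phi (T N y) * w y)%:E @[N --> \oo] --> (phi (L y) * w y)%:E.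
  by apply: cvg_EFin; [exact: nearW|apply: cvgM; [exact: phi_cvg|exact: cvg_cst]].
have iM : (lebn R n).-integrable setT (fun y => (M * w y)%:E).
  by under eq_fun do rewrite EFinM; exact: integrableZl.
have bT N y : (`|(phi (T N y) * w y)%:E| <= (M * w y)%:E)%E.
  rewrite /= lee_fin normrM (ger0_norm (w_ge0 y)) -lecR; apply: le_trans (T_bound N y).
  rewrite rmorphM -subr_ge0 -mulrBl; apply: mulr_ge0; last by rewrite ler0c.
  by rewrite subr_ge0; exact: phi_le.
have mL : measurable_fun setT (fun y => (phi (L y) * w y)%:E).
  apply: (@emeasurable_fun_cvg _ _ R setT (fun N y => (phi (T N y) * w y)%:E)
    (fun y => (phi (L y) * w y)%:E) mT) => y _.
  exact: (cT y).
have [iL _] := @dominated_convergence _ _ R (lebn R n) setT measurableT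
  (fun N y => (phi (T N y) * w y)%:E) (fun y => (phi (L y) * w y)%:E)
  (fun y => (M * w y)%:E) mT mL (aeW _ (fun y _ => cT y)) iM
  (aeW _ (fun y N _ => bT N y)).
under eq_fun do rewrite integral_phiT.
rewrite -[X in _ --> X -> _]fineK ?integrable_fin_num//.
by move=> /fine_cvg.
Qed.

End Part.

(** Termwise, the integral against the posterior replaces the monomial [y^m] by
    its moment, which is the coefficient of the series. *)
Lemma lauricella_charfun : lauricella a (\row_i (0 +i* s 0 i)) =
  charfun (posterior (dirichlet alpha) p) s.
Proof.
rewrite /lauricella /charfun.
have mlin : measurable_fun setT (fun y : n.+1.-tuple R => \sum_i s 0 i * tnth y i).
  apply: measurable_sum => i; apply: measurable_funM => //; exact: measurable_tnth.
rewrite !integral_posterior//; last 2 first.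
- by apply: measurableT_comp => //; apply: continuous_measurable_fun; exact: continuous_sin.
- by apply: measurableT_comp => //; apply: continuous_measurable_fun; exact: continuous_cos.
apply: cvgC_lim; split => /=.
- apply: (@cvg_part (@complex.Re R)) => //.
  + exact: ReD.
  + exact: Re_scale.
  + exact: normc_ge_Re.
  + by move=> y; case: (T_cvg y).
- apply: (@cvg_part (@complex.Im R)) => //.
  + exact: ImD.
  + exact: Im_scale.
  + move=> z; have := normc_ge_Re (z * 'i%C); rewrite ReiNIm normrN normrM.
    by rewrite [`|'i%C|](_ : _ = 1) ?mulr1// normc_def /= expr0n expr1n add0r sqrtr1.
  + by move=> y; case: (T_cvg y).
Qed.

End Charfun.

(** * Linear maps and subspaces *)

Section LinearMaps.
Variable K : fieldType.
Implicit Types U V W : lmodType K.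

Lemma linear_morph V W (T : V -> W) : linear T ->
  [/\ T 0 = 0, forall z x, T (z *: x) = z *: T x,
   forall x y, T (x + y) = T x + T y & forall x y, T (x - y) = T x - T y].
Proof.
move=> lT; have T0 : T 0 = 0.
  by have := lT (-1) 0 0; rewrite !scaleN1r !addNr.
have TZ z x : T (z *: x) = z *: T x by rewrite -[z *: x]addr0 lT T0 addr0.
have TD x y : T (x + y) = T x + T y by rewrite -[x]scale1r lT !scale1r.
by split=> // x y; rewrite TD -scaleN1r TZ scaleN1r.
Qed.

Lemma linear_sumE V W (T : V -> W) (I : Type) (r : seq I) (F : I -> V) :
  linear T -> T (\sum_(i <- r) F i) = \sum_(i <- r) T (F i).
Proof.
by move=> /linear_morph[T0 _ TD _]; exact: (big_morph T TD T0).
Qed.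

Lemma linear_comb U V (z : K) (S T : U -> V) : linear S -> linear T ->
  linear (z *: S + T).
Proof.
move=> lS lT c x y; rewrite /= !fctE /= lS lT !scalerDr !scalerA addrACA.
by rewrite [z * c]mulrC.
Qed.

Lemma lin_subspace_sum V (B : set V) (I : Type) (r : seq I)
    (c : I -> K) (v : I -> V) : lin_subspace B -> (forall i, B (v i)) ->
  B (\sum_(i <- r) c i *: v i).
Proof.
move=> [B0 BL] Bv; elim: r => [|i r IH]; first by rewrite big_nil.
by rewrite big_cons; exact: BL.
Qed.

Lemma lin_subspaceB V (B : set V) x y : lin_subspace B ->
  B x -> B y -> B (x - y).
Proof. by move=> [_ BL] Bx By; rewrite addrC -scaleN1r; exact: BL. Qed.

Lemma line_bij V W (S : V -> W) (B : set V) v D :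
  linear S -> (forall x, B x <-> exists c, x = c *: v) -> S v = D -> D != 0 ->
  set_bij B (lin_span [set D]) S.
Proof.
move=> /linear_morph[_ SZ' _ _] Bv SD D0.
have SZ c : S (c *: v) = c *: D by rewrite SZ' SD.
split.
- move=> x /Bv[c ->]; rewrite SZ -[c *: D]addr0.
  by have [s0 sL] := span_subspace [set D]; apply: sL => //; exact: span_subset.
- move=> x y; rewrite !inE => /Bv[c ->] /Bv[d ->]; rewrite !SZ => /eqP.
  by rewrite -subr_eq0 -scalerBl scaler_eq0 (negbTE D0) orbF subr_eq0 => /eqP ->.
- move=> _ [s [sD ->]]; exists ((\sum_(q <- s) q.1) *: v).
    by apply/Bv; eexists.
  by rewrite SZ scaler_suml; apply: eq_big_seq => q /sD /= ->.
Qed.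

End LinearMaps.

(** * Linear independence of the basis functions *)

Section BasisFun.
Variables (R : realType) (k : nat).
Local Notation C := R[i].
Implicit Types (a : 'rV[R]_k).

Lemma cpow_real (r x : R) : 0 < r -> cpow r%:C x = (r `^ x)%:C.
Proof.
move=> r0; rewrite /cpow /principal_arg /= ltxx expr0n addr0 sqrtr_sqr gtr0_norm//.
by rewrite divff ?gt_eqF// acos1 mulr0 cos0 sin0 mulr1.
Qed.

Lemma cpow1 (x : R) : cpow 1 x = 1.
Proof. by rewrite -(rmorph1 (real_complex R)) cpow_real// powR1. Qed.

Lemma series_partial0 a N :
  \sum_(m : {ffun 'I_k -> 'I_N.+1}) series_term a 0 (fun i => nat_of_ord (m i)) = 1.
Proof.
rewrite (bigD1 [ffun=> ord0])//= big1 ?addr0.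
  rewrite /series_term; under eq_bigr do rewrite ffunE /rising big_ord0.
  rewrite big1_eq; under [X in rising _ X]eq_bigr do rewrite ffunE.
  rewrite big1_eq /rising big_ord0 divr1 rmorph1 mul1r.
  under eq_bigr do rewrite ffunE expr0; rewrite big1_eq mul1r.
  by under eq_bigr do rewrite ffunE; rewrite big1_eq invr1.
move=> m m0; have /existsP[i mi] : [exists i, m i != ord0].
  apply: contraR m0; rewrite negb_exists => /forallP h; apply/eqP/ffunP => i.
  by rewrite ffunE; have := h i; rewrite negbK => /eqP.
have mi0 : (m i == 0 :> nat) = false by apply/negbTE.
have -> : series_term a 0 (fun i => m i) =
  ((\prod_i rising (a 0 i) (m i)) / rising (mass a) (\sum_i m i)%N)%:C
  * (\prod_i (0 : 'rV[C]_k) 0 i ^+ m i) / (\prod_i (m i)`!)%:R by [].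
rewrite [\prod_(j < k) (0 : 'rV[C]_k) 0 j ^+ _](_ : _ = 0) ?mulr0 ?mul0r//.
by apply/eqP/prodf_eq0; exists i => //; rewrite mxE expr0n mi0.
Qed.

Lemma lauricella0 a : lauricella a 0 = 1.
Proof.
rewrite /lauricella; apply: cvgC_lim; split; apply: cvg_near_cst.
  by exists 1%N => // -[//|N] _; rewrite series_partial0.
by exists 1%N => // -[//|N] _; rewrite series_partial0.
Qed.

Definition rmono (u : 'I_k -> R) a : R := \prod_i u i `^ a 0 i.

Lemma basis_fun_real a (u : 'I_k -> R) : (forall i, 0 < u i) ->
  basis_fun a 0 (\row_i (u i)%:C) 1 = (rmono u a)%:C.
Proof.
move=> u0; rewrite /basis_fun lauricella0 cpow1 mul1r mulr1 /rmono rmorph_prod.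
by apply: eq_bigr => i _; rewrite mxE cpow_real.
Qed.

(** Dedekind's argument. Doubling [u_i] multiplies the monomial of exponent [a]
    by [2^(a_i)]; subtracting [2^(a0_i)] times the original relation removes
    [a0], and keeps a given [a1] when [i] separates the two. *)
Lemma rmono_free (s : seq 'rV[R]_k) (c : 'rV[R]_k -> C) : uniq s ->
  (forall u, (forall i, 0 < u i) -> \sum_(a <- s) c a * (rmono u a)%:C = 0) ->
  forall a, a \in s -> c a = 0.
Proof.
elim: s c => [|a0 s IH] c //= /andP[a0s us] h.
have hs a1 : a1 \in s -> c a1 = 0.
  move=> a1s.
  have : exists i, a0 0 i != a1 0 i.
    apply/existsP; apply: contraR a0s; rewrite negb_exists => /forallP e.
    suff -> : a0 = a1 by [].
    by apply/rowP => i; have := e i; rewrite negbK => /eqP.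
  move=> [i ne].
  pose c' a := c a * (2 `^ a 0 i - 2 `^ a0 0 i : R)%:C.
  have h' u : (forall i, 0 < u i) -> \sum_(a <- s) c' a * (rmono u a)%:C = 0.
    move=> u0; pose u' j := if j == i then 2 * u j else u j.
    have u'0 j : 0 < u' j by rewrite /u'; case: eqP => _; rewrite ?mulr_gt0.
    have rE a : rmono u' a = 2 `^ a 0 i * rmono u a.
      rewrite /rmono (bigD1 i)//= [in RHS](bigD1 i)//= mulrA; congr (_ * _).
        by rewrite /u' eqxx powRM ?ltW.
      by apply: eq_bigr => j ji; rewrite /u' (negbTE ji).
    have := h _ u'0; have := h _ u0; rewrite !big_cons => e1 e2.
    have : \sum_(a <- s) c' a * (rmono u a)%:C =
        (c a0 * (rmono u' a0)%:C + \sum_(a <- s) c a * (rmono u' a)%:C) -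
        (2 `^ a0 0 i)%:C * (c a0 * (rmono u a0)%:C + \sum_(a <- s) c a * (rmono u a)%:C).
      rewrite rE mulrDr opprD addrACA rmorphM mulrCA subrr add0r mulr_sumr -sumrB.
      by apply: eq_bigr => a _; rewrite rE /c' rmorphB rmorphM /=; ring.
    by rewrite e1 e2 mulr0 subr0.
  have := IH c' us h' _ a1s; rewrite /c' => /eqP; rewrite mulf_eq0 => /orP[/eqP //|].
  rewrite -(rmorph0 (real_complex R)) (inj_eq (@complexI R)) subr_eq0 => /eqP e.
  have := congr1 (@ln R) e; rewrite !ln_powR => /mulIf e'.
  move: ne; rewrite e' ?eqxx// gt_eqF// ln_gt0// ltr1n//.
move=> a; rewrite inE => /predU1P[->|]; last exact: hs.
have := h (fun=> 1) (fun=> ltr01); rewrite big_cons [X in _ + X]big1_seq.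
  by rewrite addr0 /rmono big1 ?mulr1// => i _; rewrite powR1.
by move=> b /= bs; rewrite hs// mul0r.
Qed.

End BasisFun.

Section Lift.
Variables (R : realType) (k : nat) (alpha : 'rV[R]_k).
Local Notation C := R[i].
Local Notation latp := (latp alpha).
Local Notation f := (fO alpha).

Lemma fO_free (s : seq 'rV[R]_k) (c : 'rV[R]_k -> C) : uniq s ->
  (forall a, a \in s -> latp a) -> \sum_(a <- s) c a *: f a = 0 ->
  forall a, a \in s -> c a = 0.
Proof.
move=> us sl e; apply: rmono_free => // u u0.
have valE (t : seq 'rV[R]_k) : val (\sum_(a <- t) c a *: f a) 0 (\row_i (u i)%:C) 1 =
    \sum_(a <- t) c a * val (f a) 0 (\row_i (u i)%:C) 1.
  elim: t => [|a t IH]; first by rewrite !big_nil.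
  by rewrite !big_cons -IH spanned_valP.
have := congr1 (fun x : Osp alpha => val x 0 (\row_i (u i)%:C) 1) e.
rewrite valE => e'; rewrite -[RHS]e'; apply: eq_big_seq => a as_.
by rewrite -(basis_fun_real a u0) val_fO//; exact: sl.
Qed.

Section Lift.
Variables (V : lmodType C) (c : 'rV[R]_k -> V).

Lemma fO_rep (x : Osp alpha) : exists t : seq (C * 'rV[R]_k),
  (forall q, q \in t -> latp q.2) /\ x = \sum_(q <- t) q.1 *: f q.2.
Proof.
have /asboolP [s [sl xE]] := valP x.
suff [t [tl tE]] : exists t : seq (C * 'rV[R]_k), (forall q, q \in t -> latp q.2) /\
    \sum_(p <- s) p.1 *: p.2 = val (\sum_(q <- t) q.1 *: f q.2).
  by exists t; split => //; apply: val_inj; rewrite xE tE.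
elim: s sl {xE} => [|p s IH] sl; first by exists [::]; rewrite !big_nil.
have [|t [tl tE]] := IH; first by move=> q qs; apply: sl; rewrite inE qs orbT.
have [a la ap] := sl p (mem_head _ _).
exists ((p.1, a) :: t); split.
  by move=> q; rewrite inE => /predU1P[->|/tl].
by rewrite !big_cons spanned_valP -tE val_fO//= -ap.
Qed.

(** This is what makes [lin_extend] independent of the chosen representation. *)
Lemma rep0 (t : seq (C * 'rV[R]_k)) : (forall q, q \in t -> latp q.2) ->
  \sum_(q <- t) q.1 *: f q.2 = 0 -> \sum_(q <- t) q.1 *: c q.2 = 0.
Proof.
move=> tl e; pose s := undup [seq q.2 | q <- t].
pose m a := \sum_(q <- t | q.2 == a) q.1.
have group (W : lmodType C) (g : 'rV[R]_k -> W) :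
    \sum_(q <- t) q.1 *: g q.2 = \sum_(a <- s) m a *: g a.
  under [RHS]eq_bigr do rewrite /m scaler_suml big_mkcond.
  rewrite exchange_big; apply: eq_big_seq => q qt /=.
  rewrite (bigD1_seq q.2) ?undup_uniq//=; last by rewrite mem_undup; apply/mapP; exists q.
  by rewrite eqxx big1 ?addr0// => b; rewrite eq_sym => /negbTE ->.
rewrite group big1_seq// => a /= as_; rewrite (_ : m a = 0) ?scale0r//.
apply: (@fO_free s) as_; first exact: undup_uniq.
  by move=> b; rewrite mem_undup => /mapP[q /tl ? ->].
by rewrite -group.
Qed.

Definition lin_extend (x : Osp alpha) : V :=
  let t := projT1 (cid (fO_rep x)) in \sum_(q <- t) q.1 *: c q.2.

Lemma lin_extend_rep (t : seq (C * 'rV[R]_k)) : (forall q, q \in t -> latp q.2) ->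
  lin_extend (\sum_(q <- t) q.1 *: f q.2) = \sum_(q <- t) q.1 *: c q.2.
Proof.
move=> tl; rewrite /lin_extend; case: cid => t' [t'l e] /=.
have := @rep0 (t ++ [seq (- q.1, q.2) | q <- t']).
rewrite !big_cat /= !big_map /=.
under [X in _ + X = 0 -> _]eq_bigr do rewrite scaleNr.
under [X in _ -> _ + X = 0]eq_bigr do rewrite scaleNr.
rewrite !sumrN -e subrr => h; apply/esym/eqP; rewrite -subr_eq0; apply/eqP; apply: h => //.
by move=> q; rewrite mem_cat => /orP[/tl//|/mapP[q' /t'l ? ->]].
Qed.

Lemma lin_extend_linear : linear lin_extend.
Proof.
move=> z x y; have [t [tl ->]] := fO_rep x; have [t' [t'l ->]] := fO_rep y.
rewrite !lin_extend_rep// !scaler_sumr.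
have -> : \sum_(q <- t) z *: (q.1 *: f q.2) + \sum_(q <- t') q.1 *: f q.2 =
    \sum_(q <- [seq (z * q.1, q.2) | q <- t] ++ t') q.1 *: f q.2.
  by rewrite big_cat big_map; congr (_ + _); apply: eq_bigr => q _; rewrite scalerA.
rewrite lin_extend_rep.
  by rewrite big_cat big_map; congr (_ + _); apply: eq_bigr => q _; rewrite scalerA.
by move=> q; rewrite mem_cat => /orP[/mapP[q' /tl ? ->]|/t'l].
Qed.

Lemma lin_extend_fO a : latp a -> lin_extend (f a) = c a.
Proof.
move=> la; have := @lin_extend_rep [:: (1, a)]; rewrite !big_seq1 !scale1r; apply.
by move=> q; rewrite inE => /eqP ->.
Qed.

Lemma linear_ext (S T : Osp alpha -> V) : linear S -> linear T ->
  (forall a, latp a -> S (f a) = T (f a)) -> S =1 T.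
Proof.
move=> lS lT e x; have [t [tl ->]] := fO_rep x; elim: t tl => [|q t IH] tl.
  by rewrite !big_nil; have [-> _ _ _] := linear_morph lS; have [-> _ _ _] := linear_morph lT.
rewrite !big_cons lS lT IH ?e// => [|q' q't]; first by apply: tl; rewrite mem_head.
by apply: tl; rewrite inE q't orbT.
Qed.

End Lift.

Lemma linext_extend (c : 'rV[R]_k -> Osp alpha) : linext c = lin_extend c.
Proof.
rewrite /linext; case: xgetP => [T _ [lT Tc]|/(_ (lin_extend c))]; last first.
  by case; split; [exact: lin_extend_linear|exact: lin_extend_fO].
apply/funext; apply: linear_ext => //; first exact: lin_extend_linear.
by move=> a la; rewrite Tc// lin_extend_fO.
Qed.

Definition coord (a : 'rV[R]_k) : Osp alpha -> C^o := lin_extend (fun b => (a == b)%:R : C^o).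

Lemma coord_fO a b : latp b -> coord a (f b) = (a == b)%:R.
Proof. exact: lin_extend_fO. Qed.

Lemma fO_neq0 a : latp a -> f a != 0.
Proof.
move=> la; apply/eqP => e; have := coord_fO a la; rewrite eqxx e.
have [c0 _ _ _] := @linear_morph C (Osp alpha) C^o (coord a) (lin_extend_linear _).
by rewrite c0 => /esym/eqP; rewrite oner_eq0.
Qed.

End Lift.

(** * The action of the matrices of size k + 1 *)

Section GL.
Variables (R : realType) (k : nat) (alpha : 'rV[R]_k).
Local Notation C := R[i].
Local Notation latp := (latp alpha).
Local Notation f := (fO alpha).
Local Notation O := (Osp alpha).
Implicit Types (a : 'rV[R]_k) (i j l m : 'I_k.+1).

(** The vectors [e_i] with [e_0 = 0]. *)
Definition evx i : 'rV[R]_k := if unlift ord0 i is Some j then @ev R k j else 0.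

(** The homogeneous coordinates [(1 - |a|, a)], which sum to 1. *)
Definition ext a i : R := if unlift ord0 i is Some j then a 0 j else 1 - mass a.

Lemma massD a b : mass (a + b) = mass a + mass b.
Proof. by rewrite /mass -big_split; apply: eq_bigr => i _; rewrite mxE. Qed.

Lemma massN a : mass (- a) = - mass a.
Proof. by rewrite /mass -sumrN; apply: eq_bigr => i _; rewrite mxE. Qed.

Lemma mass_ev (i : 'I_k) : mass (@ev R k i) = 1.
Proof.
rewrite /mass (bigD1 i)//= mxE !eqxx big1 ?addr0// => j ji.
by rewrite mxE (negbTE ji) andbF.
Qed.

Lemma mass_evx i : mass (evx i) = (i != ord0)%:R.
Proof.
rewrite /evx; case: unliftP => [j|] ->; first by rewrite mass_ev.
by rewrite eqxx /mass big1// => j _; rewrite mxE.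
Qed.

Lemma ext_lift a (i : 'I_k) : ext a (lift ord0 i) = a 0 i.
Proof. by rewrite /ext liftK. Qed.

Lemma ext0 a : ext a ord0 = 1 - mass a.
Proof. by rewrite /ext unlift_none. Qed.

Lemma evx_lift (i : 'I_k) : evx (lift ord0 i) = @ev R k i.
Proof. by rewrite /evx liftK. Qed.

Lemma evx0 : evx ord0 = 0.
Proof. by rewrite /evx unlift_none. Qed.

Lemma ext_step a i j l :
  ext (a + evx i - evx j) l = ext a l + (l == i)%:R - (l == j)%:R.
Proof.
have [l'|] := unliftP ord0 l => ->.
  have e m : evx m 0 l' = (lift ord0 l' == m)%:R.
    have [m'|] := unliftP ord0 m => ->; last by rewrite evx0 mxE.
    by rewrite evx_lift mxE eqxx /= (inj_eq (@lift_inj _ ord0)).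
  by rewrite !ext_lift 2!mxE [(- _ : 'rV_k) _ _]mxE !e.
rewrite !ext0 !massD massN !mass_evx ![ord0 == _]eq_sym.
by case: (i == ord0); case: (j == ord0); rewrite /=; ring.
Qed.

Lemma sum_ext a : \sum_i ext a i = 1.
Proof.
rewrite big_ord_recl ext0 (eq_bigr (fun i : 'I_k => a 0 i)) ?subrK// => i _.
by rewrite ext_lift.
Qed.

Lemma step_inj a i j l m : i != j -> a + evx i - evx j = a + evx l - evx m ->
  i = l /\ j = m.
Proof.
move=> ij e; have h n := congr1 (ext ^~ n) e.
have := h i; have := h j; rewrite !ext_step !eqxx (negbTE ij) eq_sym (negbTE ij).
rewrite -!addrA => /addrI h1 /addrI h2; split; apply/eqP.
  apply: contraT => /negbTE il; move: h2; rewrite il; case: (i == m) => /=; lra.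
apply: contraT => /negbTE jm; move: h1; rewrite jm; case: (j == l) => /=; lra.
Qed.

Hypothesis alpha1 : mass alpha = 1.

Lemma latp_mass a : latp a -> exists n : nat, mass a = n.+1%:R.
Proof.
move=> [[z ->]]; rewrite massD alpha1.
have -> : mass (\row_i (z i)%:~R) = (\sum_i z i)%:~R :> R.
  by rewrite rmorph_sum; apply: eq_bigr => i _; rewrite mxE.
rewrite -(intrD _ 1) ltr0z; case: (1 + \sum_i z i)%R => // -[|n] // _.
by exists n.
Qed.

Lemma evxE i : exists z : 'I_k -> int, evx i = \row_j (z j)%:~R.
Proof.
have [i'|] := unliftP ord0 i => ->.
  exists (fun j : 'I_k => (j == i')%:R); apply/rowP => j.
  by rewrite evx_lift !mxE eqxx /=; case: (j == i').
by exists (fun=> 0); apply/rowP => j; rewrite evx0 !mxE.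
Qed.

(** A step can leave the half-space [|a| > 0] only if [i = 0], [j <> 0] and
    [|a| = 1], and in that case the coefficient [1 - |a|] vanishes. So the matrix
    units act without any special treatment of the boundary. *)
Lemma latp_step a i j : latp a -> ext a i != 0 -> latp (a + evx i - evx j).
Proof.
move=> la ai; have [n mn] := latp_mass la; move: (la) => [[z az] _]; split.
  have [zi ->] := evxE i; have [zj ->] := evxE j.
  exists (fun l : 'I_k => z l + zi l - zj l); rewrite az.
  by apply/rowP => l; rewrite !mxE intrB intrD !addrA.
rewrite !massD massN !mass_evx mn; move: ai.
case: (eqVneq i ord0) => [->|_ _] /=; last first.
  by case: (j != ord0) => /=; rewrite ?addrK ?subr0 ?ltr_wpDr ?ltr0n.
rewrite ext0 mn -natr1 opprD addrCA subrr addr0 oppr_eq0 pnatr_eq0 => n0.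
by case: (j != ord0) => /=; rewrite ?addr0 ?addrK ?subr0 ?ltr0n ?lt0n// natr1 ltr0n.
Qed.

Definition Eop i j : O -> O := lin_extend (fun a => (ext a i)%:C *: f (a + evx i - evx j)).

Lemma Eop_linear i j : linear (Eop i j).
Proof. exact: lin_extend_linear. Qed.

Lemma Eop_fO i j a : latp a -> Eop i j (f a) = (ext a i)%:C *: f (a + evx i - evx j).
Proof. exact: lin_extend_fO. Qed.

Lemma EopEop_fO i j l m a : latp a -> Eop l m (Eop i j (f a)) =
  (ext a i * (ext a l + (l == i)%:R - (l == j)%:R))%:C *:
    f (a + evx i - evx j + evx l - evx m).
Proof.
move=> la; have [_ EZ _ _] := linear_morph (Eop_linear l m).
rewrite Eop_fO// EZ; have [->|ai] := eqVneq (ext a i) 0; first by rewrite mul0r !scale0r.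
by rewrite (Eop_fO _ _ (latp_step j la ai)) scalerA ext_step -rmorphM.
Qed.

(** Both compositions send [f a] to multiples of the same basis vector. In the
    difference of the coefficients the products of coordinates cancel, and the
    shifts of the coordinates remain. *)
Lemma commutator_Eop i j l m :
  commutator alpha (Eop i j) (Eop l m) =
  (j == l)%:R *: Eop i m - (i == m)%:R *: Eop l j.
Proof.
apply/funext; apply: linear_ext.
- move=> c x y; rewrite /commutator !Eop_linear.
  by rewrite scalerBr opprD addrACA.
- rewrite -scaleNr; apply: linear_comb; first exact: Eop_linear.
  by move=> c x y; rewrite !fctE /= Eop_linear !scalerDr !scalerA mulrC.
move=> a la; rewrite /commutator [in RHS]fctE /= !fctE /= !EopEop_fO// !Eop_fO//.
set b := a + evx l - evx m + evx i - evx j.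
have be : b = a + evx i - evx j + evx l - evx m.
  rewrite /b -!addrA; congr (_ + _).
  by rewrite addrA addrC -!addrA; congr (_ + _); rewrite addrCA addrC -addrA.
have -> : (j == l)%:R *: ((ext a i)%:C *: f (a + evx i - evx m)) =
    ((j == l)%:R * ext a i)%:C *: f b.
  case: (eqVneq j l) be => [->|] be; last by rewrite mul0r !scale0r.
  by rewrite be subrK mul1r scale1r.
have -> : (i == m)%:R *: ((ext a l)%:C *: f (a + evx l - evx j)) =
    ((i == m)%:R * ext a l)%:C *: f b.
  have [im|_] := eqVneq i m; last by rewrite mul0r !scale0r.
  by rewrite /b im subrK mul1r scale1r.
rewrite -be -!scalerBl -!rmorphB; congr (_%:C *: _).
rewrite (eq_sym l i) (eq_sym l j); have [->|_] := eqVneq i l; rewrite ?mulr0n ?mulr1n; ring.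
Qed.

(** The representation of [gl_(k+1)] with [E_ij] as image of the matrix units. *)
Definition rho (X : 'M[C]_k.+1) : O -> O := \sum_i \sum_j X i j *: Eop i j.

Lemma rhoE X x : rho X x = \sum_i \sum_j X i j *: Eop i j x.
Proof. by rewrite /rho fct_sumE; apply: eq_bigr => i _; rewrite fct_sumE. Qed.

Lemma rho_linear X : linear (rho X).
Proof.
move=> c x y; rewrite !rhoE scaler_sumr -big_split; apply: eq_bigr => i _ /=.
rewrite scaler_sumr -big_split; apply: eq_bigr => j _ /=.
by rewrite Eop_linear scalerDr !scalerA mulrC.
Qed.

Lemma rho_lin z X Y : rho (z *: X + Y) = z *: rho X + rho Y.
Proof.
rewrite /rho scaler_sumr -big_split; apply: eq_bigr => i _ /=.
rewrite scaler_sumr -big_split; apply: eq_bigr => j _ /=.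
by rewrite !mxE scalerDl scalerA.
Qed.

Lemma rhoB X Y : rho (X - Y) = rho X - rho Y.
Proof. by rewrite addrC -scaleN1r rho_lin scaleN1r addrC. Qed.

Lemma rho_delta i j : rho (delta_mx i j) = Eop i j.
Proof.
rewrite /rho (bigD1 i)//= (bigD1 j)//= mxE !eqxx scale1r big1 ?addr0.
  rewrite big1 ?addr0// => l li; rewrite big1// => m _.
  by rewrite mxE (negbTE li) scale0r.
by move=> m mj; rewrite mxE (negbTE mj) andbF scale0r.
Qed.

Lemma commutator_rho X Y :
  commutator alpha (rho X) (rho Y) = rho (X *m Y - Y *m X).
Proof.
apply/funext => x; rewrite /commutator.
have ee i j l m : Eop i j (Eop l m x) - Eop l m (Eop i j x) =
    (j == l)%:R *: Eop i m x - (i == m)%:R *: Eop l j x.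
  by have := congr1 (@^~ x) (commutator_Eop i j l m).
have rhoP Z y : rho Z y = \sum_(p : 'I_k.+1 * 'I_k.+1) Z p.1 p.2 *: Eop p.1 p.2 y.
  by rewrite rhoE pair_bigA.
have expand S T : rho S (rho T x) = \sum_(p : 'I_k.+1 * 'I_k.+1)
    \sum_(q : 'I_k.+1 * 'I_k.+1) (S p.1 p.2 * T q.1 q.2) *: Eop p.1 p.2 (Eop q.1 q.2 x).
  rewrite [LHS]rhoP; apply: eq_bigr => p _; rewrite rhoP.
  rewrite (@linear_sumE _ _ _ (Eop p.1 p.2) _ _ _ (Eop_linear p.1 p.2)).
  rewrite scaler_sumr; apply: eq_bigr => q _.
  have [_ EZ _ _] := linear_morph (Eop_linear p.1 p.2).
  by rewrite EZ scalerA.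
rewrite !expand [X in _ - X]exchange_big /= -sumrB.
under eq_bigr => p _.
  rewrite -sumrB; under eq_bigr => q _ do
    rewrite [Y _ _ * _]mulrC -scalerBr ee scalerBr !scalerA.
  rewrite sumrB; over.
rewrite sumrB; transitivity (rho (X *m Y) x - rho (Y *m X) x); last by rewrite rhoB.
rewrite !rhoE.
congr (_ - _).
  rewrite -(pair_bigA _ (fun i j => \sum_(q : 'I_k.+1 * 'I_k.+1)
     (X i j * Y q.1 q.2 * (j == q.1)%:R) *: Eop i q.2 x)) /=.
  apply: eq_bigr => i _.
  under eq_bigr => j _.
    rewrite -(pair_bigA _ (fun l m => (X i j * Y l m * (j == l)%:R) *: Eop i m x)) /=.
    rewrite (bigD1 j)//= [X in _ + X]big1 ?addr0; last first.
      by move=> l lj; rewrite big1// => m _; rewrite eq_sym (negbTE lj) mulr0 scale0r.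
    over.
  rewrite exchange_big; apply: eq_bigr => m _ /=; rewrite mxE scaler_suml.
  by apply: eq_bigr => j _; rewrite eqxx mulr1.
rewrite exchange_big -(pair_bigA _ (fun l m => \sum_(p : 'I_k.+1 * 'I_k.+1)
     (X p.1 p.2 * Y l m * (p.1 == m)%:R) *: Eop l p.2 x)) /=.
apply: eq_bigr => l _.
under eq_bigr => m _.
  rewrite -(pair_bigA _ (fun i j => (X i j * Y l m * (i == m)%:R) *: Eop l j x)) /=.
  rewrite (bigD1 m)//= [X in _ + X]big1 ?addr0; last first.
    by move=> i im; rewrite big1// => j _; rewrite (negbTE im) mulr0 scale0r.
  over.
rewrite exchange_big; apply: eq_bigr => j _ /=; rewrite mxE scaler_suml.
by apply: eq_bigr => m _; rewrite eqxx mulr1 mulrC.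
Qed.

Hypotheses (k_gt0 : (0 < k)%N) (alpha_gt0 : forall i : 'I_k, 0 < alpha 0 i).

Lemma latp_alpha : latp alpha.
Proof.
split; last by rewrite alpha1.
by exists (fun=> 0); apply/rowP => j; rewrite !mxE addr0.
Qed.

Lemma ext_alpha_lift i : i != ord0 -> ext alpha i != 0.
Proof.
by case: (unliftP ord0 i) => [j|] ->; rewrite ?eqxx// ext_lift => _; rewrite gt_eqF.
Qed.

Lemma exists_ext_neq0 i : exists2 a, latp a & ext a i != 0.
Proof.
have [->|i0] := eqVneq i ord0; last by exists alpha; [exact: latp_alpha|exact: ext_alpha_lift].
pose j : 'I_k.+1 := fintype.lift ord0 (Ordinal k_gt0).
exists (alpha + evx j - evx ord0).
  by apply: latp_step; [exact: latp_alpha|exact: ext_alpha_lift].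
by rewrite ext_step eqxx ext0 alpha1 subrr /= add0r sub0r oppr_eq0 oner_eq0.
Qed.

Lemma coord_rho X a b : latp a -> coord b (rho X (f a)) =
  \sum_i \sum_j X i j * (ext a i)%:C * (b == a + evx i - evx j)%:R.
Proof.
move=> la; rewrite rhoE.
rewrite (@linear_sumE C O C^o (@coord _ _ alpha b) _ _ _ (lin_extend_linear _)).
apply: eq_bigr => i _.
rewrite (@linear_sumE C O C^o (@coord _ _ alpha b) _ _ _ (lin_extend_linear _)).
apply: eq_bigr => j _.
have [_ cZ _ _] := @linear_morph C O C^o (@coord _ _ alpha b) (lin_extend_linear _).
rewrite cZ Eop_fO// cZ.
have [->|ai] := eqVneq (ext a i) 0; first by rewrite scale0r scaler0 mulr0 mul0r.
by rewrite coord_fO; [rewrite scalerA|exact: latp_step].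
Qed.

(** If [rho X = 0], the off-diagonal entries vanish because the vectors
    [a + e_i - e_j] with [i <> j] are distinct from each other and from [a]. The
    diagonal satisfies [sum_i X_ii a_i = 0] for all [a]: comparing [alpha] with
    its neighbours makes the [X_ii] equal, and they vanish since [sum_i a_i = 1]. *)
Lemma rho_inj : injective rho.
Proof.
suff rho0 X : rho X = 0 -> X = 0.
  move=> X Y e; apply/eqP; rewrite -subr_eq0; apply/eqP/rho0.
  by rewrite addrC -scaleN1r rho_lin e scaleN1r addNr.
move=> e; have eb a b : latp a ->
    \sum_i \sum_j X i j * (ext a i)%:C * (b == a + evx i - evx j)%:R = 0.
  move=> la; rewrite -coord_rho// e.
  by have [c0 _ _ _] := @linear_morph C O C^o (@coord _ _ alpha b) (lin_extend_linear _).
have off i j : i != j -> X i j = 0.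
  move=> ij; have [a la ai] := exists_ext_neq0 i.
  have := eb a (a + evx i - evx j) la.
  rewrite (bigD1 i)//= (bigD1 j)//= eqxx mulr1 [\sum_(m | m != j) _]big1 ?addr0; last first.
    move=> m mj; rewrite (_ : (_ == _) = false) ?mulr0//; apply/negbTE/eqP.
    by move=> /(step_inj ij)[_ jm]; rewrite jm eqxx in mj.
  rewrite [\sum_(l | l != i) _]big1 ?addr0; last first.
    move=> l li; apply: big1 => m _.
    rewrite (_ : (_ == _) = false) ?mulr0//; apply/negbTE/eqP.
    by move=> /(step_inj ij)[il _]; rewrite il eqxx in li.
  move=> /eqP; rewrite mulf_eq0 => /orP[/eqP //|].
  by rewrite -(rmorph0 (real_complex R)) (inj_eq (@complexI R)) (negbTE ai).
have diag a : latp a -> \sum_i X i i * (ext a i)%:C = 0.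
  move=> la; rewrite -[RHS](eb a a la); apply: eq_bigr => i _.
  rewrite (bigD1 i)//= addrK eqxx mulr1 big1 ?addr0// => j ji.
  by rewrite off ?mul0r// eq_sym.
have same i : X i i = X ord0 ord0.
  have [->//|i0] := eqVneq i ord0.
  have := diag _ (latp_step ord0 latp_alpha (ext_alpha_lift i0)).
  have := diag _ latp_alpha => d0.
  under eq_bigr do rewrite ext_step rmorphB rmorphD mulrBr mulrDr.
  have pick l : \sum_j X j j * ((j == l)%:R)%:C = X l l.
    rewrite (bigD1 l)//= eqxx mulr1 big1 ?addr0// => j /negbTE ->.
    by rewrite mulr0.
  rewrite sumrB big_split /= d0 add0r !pick.
  by move=> /eqP; rewrite subr_eq0 => /eqP.
have X00 : X ord0 ord0 = 0.
  have := diag _ latp_alpha; under eq_bigr do rewrite same.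
  by rewrite -mulr_sumr -rmorph_sum sum_ext mulr1.
apply/matrixP => i j; rewrite mxE; have [->|/off //] := eqVneq i j.
by rewrite same.
Qed.

End GL.

(** * The Lie algebra, its weight module and the stable subspaces *)

Section UeaAction.
Variables (K : fieldType) (E : lmodType K) (br : E -> E -> E) (g : set E).
Variables (M : lmodType K) (act : E -> M -> M).
Hypothesis gM : lie_module br act g.
Local Notation U := (uea br g).
Local Notation uact := (@uea_act K E br g M act).

Lemma uea_act_gen (x : g) v : uact (uea_gen br x) v = act (val x) v.
Proof. by rewrite /uea_gen uea_actE. Qed.

Lemma uea_act_module : algebra_module uact.
Proof.
split.
- move=> v; rewrite -(scale1r (1 : U)) -upi_scal uea_actE//=.
  by rewrite scale1r.
- by elim/upi_ind=> a; elim/upi_ind=> b v; rewrite -upiM !uea_actE.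
- move=> k; elim/upi_ind=> a; elim/upi_ind=> b v.
  by rewrite -mulr_algl -upi_scal -upiM -upiD !uea_actE.
- by move=> k; elim/upi_ind=> a u v; rewrite !uea_actE// (uterm_act_linear gM).
Qed.

Variables (g' : set E) (sub : g' `<=` g).

Lemma uea_incl_act (t : uterm g') v :
  uact (@uea_incl K E br g' g sub (\pi_(uea br g') t)) v = uterm_act act t v.
Proof.
have [a1 aM aDl aDr] := uea_act_module.
rewrite /uea_incl uea_liftE; last first.
  have [glin gbr] := @uea_genP K E br g.
  by split=> [k x y z e|x y z e]; [apply: glin|apply: gbr].
elim: t v => [x|k|s IHs t IHt|s IHs t IHt] v /=.
- by rewrite uea_act_gen.
- by rewrite -upi_scal uea_actE.
- by rewrite -[ueval _ s]scale1r aDl scale1r IHs IHt.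
- by rewrite aM IHt IHs.
Qed.

(** Stability under an enveloping algebra has to be checked on the Lie algebra
    only. *)
Lemma uterm_stable (W : set M) : lin_subspace W ->
  (forall x v, g' x -> W v -> W (act x v)) ->
  forall (t : uterm g') v, W v -> W (uterm_act act t v).
Proof.
move=> [W0 WL] Wx; elim=> [x|k|s IHs t IHt|s IHs t IHt] v Wv /=.
- by apply: Wx => //; exact: set_valP.
- by rewrite -[_ *: _]addr0; exact: WL.
- by rewrite -[uterm_act _ s v]scale1r; apply: WL; [exact: IHs|exact: IHt].
- by apply: IHs; exact: IHt.
Qed.

Lemma uea_incl_stable (W : set M) : lin_subspace W ->
  (forall x v, g' x -> W v -> W (act x v)) ->
  forall u : uea br g', (uact (@uea_incl K E br g' g sub u)) @` W `<=` W.
Proof.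
move=> Wl Wx; elim/upi_ind=> t _ [v Wv <-]; rewrite uea_incl_act.
exact: uterm_stable.
Qed.

End UeaAction.

Section Weights.
Variables (K : fieldType) (E : lmodType K) (M : lmodType K) (act : E -> M -> M).
Variable h : set E.
Hypothesis actL : forall (x : h) (a : K) u v,
  act (val x) (a *: u + v) = a *: act (val x) u + act (val x) v.

(** Applying [x - l0 x], where [x] separates [l0] from [l1], to a relation
    removes the component of [l0] and keeps that of [l1]. *)
Lemma weight_spaces_direct (s : seq (dual_space h)) (v : dual_space h -> M) :
  uniq s -> (forall l, l \in s -> weight_space act l (v l)) ->
  \sum_(l <- s) v l = 0 -> forall l, l \in s -> v l = 0.
Proof.
elim: s v => [|l0 s IH] v //= /andP[l0s us] vw e.
have act0 (x : h) : act (val x) 0 = 0.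
  by have := actL x (-1) 0 0; rewrite !scaleN1r !addNr.
have actS (x : h) (r : seq (dual_space h)) :
    act (val x) (\sum_(l <- r) v l) = \sum_(l <- r) act (val x) (v l).
  apply: (big_morph _ _ (act0 x)) => y z.
  by rewrite -[y]scale1r actL !scale1r.
have hs l1 : l1 \in s -> v l1 = 0.
  move=> l1s; have [x ne] : exists x, l1 x != l0 x.
    apply/not_existsP => eq; case/negP: l0s; suff <- : l1 = l0 by [].
    apply/val_inj/funext => x; apply/eqP; have := eq x.
    by move=> /negP; rewrite negbK.
  have := IH (fun l => (l x - l0 x : K) *: v l) us _ _ l1 l1s.
  move=> H; have /eqP : (l1 x - l0 x : K) *: v l1 = 0.
    apply: H => [l ls y|].
      have vl := vw l; rewrite inE ls orbT in vl.
      rewrite -[_ *: v l]addr0 actL act0 addr0 (vl isT y) !scalerA mulrC.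
      by rewrite addr0.
    transitivity (act (val x) (\sum_(l <- l0 :: s) v l) - (l0 x : K) *: (\sum_(l <- l0 :: s) v l)).
      rewrite actS !big_cons (vw l0 (mem_head _ _) x) scalerDr opprD addrACA subrr add0r.
      rewrite scaler_sumr -sumrB; apply: eq_big_seq => l ls.
      have vl := vw l; rewrite inE ls orbT in vl.
      by rewrite (vl isT x) scalerBl.
    by rewrite e act0 scaler0 subr0.
  rewrite scaler_eq0 => /orP[|/eqP//]; rewrite subr_eq0 => ex.
  by move: ne; rewrite ex.
move=> l; rewrite inE => /predU1P[->|]; last exact: hs.
by move: e; rewrite big_cons [X in _ + X]big1_seq ?addr0// => l' /= l's; rewrite hs.
Qed.

End Weights.

Section Symmetry.
Variables (R : realType) (k : nat) (alpha : 'rV[R]_k).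
Hypotheses (k_gt0 : (0 < k)%N) (alpha_gt0 : forall i, 0 < alpha 0 i).
Hypothesis alpha1 : mass alpha = 1.
Local Notation C := R[i].
Local Notation latp := (latp alpha).
Local Notation f := (fO alpha).
Local Notation O := (Osp alpha).
Local Notation E := (@Eop R k alpha).
Local Notation rho := (@rho R k alpha).
Local Notation cm := (commutator alpha).
Local Notation ls i := (fintype.lift ord0 i).
Implicit Types (X Y : 'M[C]_k.+1).

Lemma linext_eq (c c' : 'rV[R]_k -> O) : (forall a, c a = c' a) -> linext c = lin_extend c'.
Proof. by move=> e; rewrite linext_extend; congr lin_extend; apply/funext. Qed.

Lemma EpE i : Ep alpha i = E (ls i) ord0.
Proof. by apply: linext_eq => a; rewrite ext_lift evx_lift evx0 subr0. Qed.

Lemma EmE i : Em alpha i = E ord0 (ls i).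
Proof. by apply: linext_eq => a; rewrite ext0 evx_lift evx0 addr0. Qed.

Lemma EpmE i j : Epm alpha i j = E (ls i) (ls j).
Proof. by apply: linext_eq => a; rewrite ext_lift !evx_lift. Qed.

Lemma JopE i : Jop alpha i = E (ls i) (ls i) - E ord0 ord0.
Proof.
rewrite /Jop linext_extend; apply/funext; apply: linear_ext.
- exact: lin_extend_linear.
- move=> c x y; rewrite !fctE /= !Eop_linear scalerBr opprD addrACA //.
move=> a la; rewrite lin_extend_fO// !fctE /= !Eop_fO// !addrK -scalerBl -rmorphB.
by rewrite ext_lift ext0; congr (_%:C *: _); ring.
Qed.

Definition trace0 : set 'M[C]_k.+1 := [set X | \tr X = 0].

Lemma tr_delta (i j : 'I_k.+1) : \tr (delta_mx i j : 'M[C]_k.+1) = (i == j)%:R.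
Proof.
rewrite /mxtrace (bigD1 i)//= big1 ?addr0 ?mxE ?eqxx//= => l li.
by rewrite mxE (negbTE li).
Qed.

Lemma rho0 : rho 0 = 0.
Proof. by rewrite -[0 in LHS](subrr 0) rhoB subrr. Qed.

Lemma image_rho_subspace (D : set 'M[C]_k.+1) : lin_subspace D ->
  lin_subspace (rho @` D).
Proof.
move=> [D0 DL]; split; first by exists 0 => //; exact: rho0.
by move=> c _ _ [X DX <-] [Y DY <-]; exists (c *: X + Y); [exact: DL|exact: rho_lin].
Qed.

Lemma trace0_subspace : lin_subspace trace0.
Proof.
split=> [|c X Y]; rewrite /trace0 /=; first exact: mxtrace0.
by move=> X0 Y0; rewrite raddfD /= mxtraceZ X0 Y0 mulr0 addr0.
Qed.

(** As the trace is zero, [E_00] can be subtracted from each diagonal unit; what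
    remains are generators of the Lie algebra. *)
Lemma rho_trace0 X : trace0 X ->
  rho X = \sum_i \sum_j X i j *: (E i j - (i == j)%:R *: E ord0 ord0).
Proof.
move=> X0; under eq_bigr do under eq_bigr do rewrite scalerBr scalerA.
under eq_bigr do rewrite sumrB.
rewrite sumrB [X in _ - X](_ : _ = 0) ?subr0//.
transitivity (\sum_i X i i *: E ord0 ord0).
  apply: eq_bigr => i _; rewrite (bigD1 i)//= eqxx mulr1 big1 ?addr0// => j ji.
  by rewrite eq_sym (negbTE ji) mulr0 scale0r.
by rewrite -scaler_suml -[X in X *: _]/(\tr X) X0 scale0r.
Qed.

Lemma gens_l_span i j : alg_l alpha (E i j - (i == j)%:R *: E ord0 ord0).
Proof.
have [l0 _] := @span_subspace _ _ (@gens_l R k alpha).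
have [->|ij] := eqVneq i j.
  rewrite mulr1n scale1r; have [j'|] := unliftP ord0 j => ->; last by rewrite subrr.
  by rewrite -JopE; apply: span_subset; right; exists j'.
rewrite mulr0n scale0r subr0; move: ij.
have [i'|] := unliftP ord0 i => ->; have [j'|] := unliftP ord0 j => ->.
- rewrite (inj_eq lift_inj) => ij; rewrite -EpmE.
  by apply: span_subset; left; right; exists (i', j').
- by rewrite -EpE => _; apply: span_subset; left; left; left; exists i'.
- by rewrite -EmE => _; apply: span_subset; left; left; right; exists j'.
- by rewrite eqxx.
Qed.

(** The Lie algebra is the image of [sl_(k+1)]. *)
Lemma alg_lE : alg_l alpha = rho @` trace0.
Proof.
apply/seteqP; split.
  apply: span_min; first exact/image_rho_subspace/trace0_subspace.
  move=> T [[[[i _ <-]|[i _ <-]]|[p pn <-]]|[i _ <-]].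
  - exists (delta_mx (ls i) ord0); last by rewrite rho_delta EpE.
    by rewrite /trace0 /= tr_delta.
  - exists (delta_mx ord0 (ls i)); last by rewrite rho_delta EmE.
    by rewrite /trace0 /= tr_delta.
  - exists (delta_mx (ls p.1) (ls p.2)); last by rewrite rho_delta EpmE.
    by rewrite /trace0 /= tr_delta (inj_eq lift_inj) (negbTE pn).
  - exists (delta_mx (ls i) (ls i) - delta_mx ord0 ord0).
      by rewrite /trace0 /= raddfB /= !tr_delta !eqxx subrr.
    by rewrite rhoB !rho_delta JopE.
move=> _ [X X0 <-]; rewrite rho_trace0// pair_bigA.
apply: lin_subspace_sum; first exact: span_subspace.
by move=> p; exact: gens_l_span.
Qed.

Definition diag0 : set 'M[C]_k.+1 :=
  [set X | exists2 d : 'rV[C]_k.+1, X = diag_mx d & \sum_i d 0 i = 0].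

Lemma diag0_subspace : lin_subspace diag0.
Proof.
split; first by exists 0; rewrite ?linear0// big1// => i _; rewrite mxE.
move=> c _ _ [d -> d0] [e -> e0]; exists (c *: d + e); first by rewrite linearP.
under eq_bigr do rewrite !mxE.
by rewrite big_split -mulr_sumr /= d0 e0 mulr0 addr0.
Qed.

Lemma diag0_trace0 : diag0 `<=` trace0.
Proof. by move=> _ [d -> d0]; rewrite /trace0 /= mxtrace_diag. Qed.

Lemma sum_delta (i : 'I_k.+1) : \sum_j (delta_mx 0 i : 'rV[C]_k.+1) 0 j = 1.
Proof.
rewrite (bigD1 i) //= mxE !eqxx big1 ?addr0// => j ji.
by rewrite mxE (negbTE ji) andbF.
Qed.

Lemma alg_hE : alg_h alpha = rho @` diag0.
Proof.
apply/seteqP; split.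
  apply: span_min; first exact/image_rho_subspace/diag0_subspace.
  move=> _ [i _ <-]; exists (delta_mx (ls i) (ls i) - delta_mx ord0 ord0); last first.
    by rewrite rhoB !rho_delta JopE.
  exists (delta_mx 0 (ls i) - delta_mx 0 ord0).
    apply/matrixP => p q; rewrite !mxE.
    have [->|pq] := eqVneq p q; first by rewrite !andbb mulr1n.
    rewrite mulr0n; case: (eqVneq p (ls i)) pq => [->|_] pq; rewrite ?andFb.
      by rewrite eq_sym (negbTE pq) /= subrr.
    case: (eqVneq p ord0) pq => [->|_] pq; rewrite ?andFb ?subrr//.
    by rewrite eq_sym (negbTE pq) subrr.
  under eq_bigr do rewrite mxE [X in _ + X]mxE.
  by rewrite sumrB !sum_delta subrr.
move=> _ [X DX <-]; rewrite rho_trace0; last exact: diag0_trace0.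
case: DX => d -> d0.
rewrite (eq_bigr (fun i => d 0 i *: (E i i - E ord0 ord0))); last first.
  move=> i _; rewrite (bigD1 i)//= mxE eqxx mulr1n scale1r big1 ?addr0// => j ji.
  by rewrite mxE eq_sym (negbTE ji) mulr0n scale0r.
apply: lin_subspace_sum; first exact: span_subspace.
move=> i; have [l0 _] := @span_subspace _ _ (range (Jop alpha)).
have [j'|] := unliftP ord0 i => ->; last by rewrite subrr.
by rewrite -JopE; apply: span_subset; exists j'.
Qed.

Lemma rho_diag (d : 'rV[C]_k.+1) a : latp a ->
  rho (diag_mx d) (f a) = (\sum_i d 0 i * (ext a i)%:C) *: f a.
Proof.
move=> la; rewrite rhoE scaler_suml; apply: eq_bigr => i _.
rewrite (bigD1 i)//= mxE eqxx mulr1n Eop_fO// addrK scalerA big1 ?addr0// => j ji.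
by rewrite mxE eq_sym (negbTE ji) mulr0n scale0r.
Qed.

Lemma alg_l_linear T : alg_l alpha T -> linear T.
Proof. by rewrite alg_lE => -[X _ <-]; exact: rho_linear. Qed.

Lemma commutator_alg_l S T : alg_l alpha S -> alg_l alpha T -> alg_l alpha (cm S T).
Proof.
rewrite alg_lE => -[X _ <-] [Y _ <-]; exists (X *m Y - Y *m X); last by rewrite commutator_rho.
by rewrite /trace0 /= raddfB /= mxtrace_mulC subrr.
Qed.

Lemma jacobi_sum (V : zmodType) (a b c d e g : V) :
  (a - b + (d - c)) + (c - e + (b - g)) + (g - d + (e - a)) = 0.
Proof.
rewrite (AC (2*2*2) (1*4*5*2*3*6)) /=.
by rewrite !addrA !subrK subrr.
Qed.

Lemma lie_algebra_l : lie_algebra cm (alg_l alpha).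
Proof.
split.
- exact: span_subspace.
- exact: commutator_alg_l.
- move=> c x y z xl yl zl; apply/funext => v; have zL := alg_l_linear zl.
  by rewrite /commutator !fctE /= zL scalerBr opprD addrACA.
- move=> c x y z xl yl zl; apply/funext => v; have zL := alg_l_linear zl.
  by rewrite /commutator !fctE /= zL scalerBr opprD addrACA.
- by move=> x _; apply/funext => v; rewrite /commutator subrr.
- move=> x y z /alg_l_linear/linear_morph[_ _ _ xB].
  move=> /alg_l_linear/linear_morph[_ _ _ yB] /alg_l_linear/linear_morph[_ _ _ zB].
  apply/funext => v; rewrite /commutator !fctE /= xB yB zB !opprB.
  exact: jacobi_sum.
Qed.

Lemma lie_module_l : lie_module cm (opact alpha) (alg_l alpha).
Proof.
split.
- exact: lie_algebra_l.
- by move=> x c u v xl; rewrite /opact; exact: (alg_l_linear xl).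
- by [].
- by [].
Qed.

(** The weight of [f a]. *)
Definition weight_fun (a : 'rV[R]_k) (H : alg_h alpha) : C^o :=
  @coord R k alpha a (val H (f a)).

Lemma weight_fun_dual a : weight_fun a \in @functional_pred C _ (alg_h alpha).
Proof.
apply/asboolP => c x y z e; rewrite /weight_fun e.
exact: (lin_extend_linear (fun b => (a == b)%:R : C^o)).
Qed.

Definition weight_of a : dual_space (alg_h alpha) := Dual (weight_fun_dual a).

Lemma weight_ofP a : latp a -> weight_space (opact alpha) (weight_of a) (f a).
Proof.
move=> la H; rewrite /opact.
have [_ [d -> d0] e] : (rho @` diag0) (val H) by rewrite -alg_hE; exact: set_valP.
have -> : weight_of a H = weight_fun a H by [].
rewrite /weight_fun -e rho_diag//.
have [_ cZ _ _] := @linear_morph C O C^o (@coord R k alpha a) (lin_extend_linear _).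
by rewrite cZ coord_fO// eqxx; congr (_ *: _); rewrite [RHS]mulr1.
Qed.

Lemma weight_module_l :
  weight_module cm (opact alpha) (alg_l alpha) (alg_h alpha).
Proof.
split.
- exact: lie_module_l.
- exact: sub_hl.
- apply/seteqP; split=> // x _; have [t [tl ->]] := fO_rep x.
  exists [seq (q.1, f q.2) | q <- t]; split; last by rewrite big_map.
  move=> p /mapP[q qt ->] /=; exists (weight_of q.2) => //.
  exact/weight_ofP/tl.
- move=> s v; apply: weight_spaces_direct => H c u w.
  exact/(alg_l_linear (sub_hl (set_valP H))).
Qed.

Lemma Osub_subspace A : lin_subspace (Osub alpha A).
Proof.
have [s0 sL] := @span_subspace _ _ (@basis_fun R k @` A).
split; first exact: s0.
move=> c x y xA yA.
have e : val (c *: x + y) = c *: val x + val y by exact: spanned_valP.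
by rewrite /Osub /mkset e; exact: sL.
Qed.

Lemma OsubZ A c x : Osub alpha A x -> Osub alpha A (c *: x).
Proof.
by have [S0 SL] := Osub_subspace A => xA; rewrite -[_ *: _]addr0; exact: SL.
Qed.

Lemma Osub_fO A a : A `<=` latp -> A a -> Osub alpha A (f a).
Proof.
move=> Al Aa; rewrite /Osub /fun_span /= val_fO; last exact: Al.
by apply: span_subset; exists a.
Qed.

Lemma Osub_rep A (x : O) : A `<=` latp -> Osub alpha A x ->
  exists t : seq (C * 'rV[R]_k), (forall q, q \in t -> A q.2) /\
    x = \sum_(q <- t) q.1 *: f q.2.
Proof.
move=> Al [s [sA xE]].
suff [t [tA tE]] : exists t : seq (C * 'rV[R]_k), (forall q, q \in t -> A q.2) /\
    \sum_(p <- s) p.1 *: p.2 = val (\sum_(q <- t) q.1 *: f q.2).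
  by exists t; split => //; apply: val_inj; rewrite [LHS]xE tE.
elim: s sA {xE} => [|p s IH] sA; first by exists [::]; rewrite !big_nil.
have [|t [tA tE]] := IH; first by move=> q qs; apply: sA; rewrite inE qs orbT.
have [a Aa ap] := sA p (mem_head _ _).
exists ((p.1, a) :: t); split.
  by move=> q; rewrite inE => /predU1P[->|/tA].
by rewrite !big_cons spanned_valP -tE val_fO//= -?ap//; exact: Al.
Qed.

Lemma Osub_stable A (T : O -> O) : A `<=` latp -> linear T ->
  (forall a, A a -> Osub alpha A (T (f a))) ->
  forall x, Osub alpha A x -> Osub alpha A (T x).
Proof.
move=> Al lT h x /(Osub_rep Al)[t [tA ->]].
have [S0 OL] := Osub_subspace A; have [T0 TZ TD _] := linear_morph lT.
elim: t tA => [|q t IH] tA; first by rewrite big_nil T0.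
rewrite big_cons TD TZ; apply: OL; first by apply: h; apply: tA; rewrite mem_head.
by apply: IH => q' q't; apply: tA; rewrite inE q't orbT.
Qed.

Lemma span_stable (G : set (O -> O)) (W : set O) : lin_subspace W ->
  (forall T x, G T -> W x -> W (T x)) ->
  forall T x, lin_span G T -> W x -> W (T x).
Proof.
move=> [W0 WL] h T x GT Wx.
suff : lin_span G `<=` [set T | W (T x)] by apply.
apply: span_min; last by move=> S GS /=; exact: h.
split=> [|c S S' /= WS WS']; first exact: W0.
by rewrite fctE /=; exact: WL.
Qed.

Lemma lat_M_sub n : lat_M alpha n `<=` latp.
Proof. by move=> a []. Qed.

Lemma lat_H_sub : lat_H alpha `<=` latp.
Proof. by move=> a []. Qed.

(** Steps between nonzero indices do not change the mass. *)
Lemma actf_stable n (u : Uf alpha) :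
  actf alpha u @` Osub alpha (lat_M alpha n) `<=` Osub alpha (lat_M alpha n).
Proof.
apply: (uea_incl_stable lie_module_l); first exact: Osub_subspace.
move=> T x fT; rewrite /opact; move: fT; apply: span_stable; first exact: Osub_subspace.
have OL := Osub_subspace (lat_M alpha n).
have Jst i x' : Osub alpha (lat_M alpha n) x' -> Osub alpha (lat_M alpha n) (Jop alpha i x').
  apply: Osub_stable; first exact: lat_M_sub.
    by apply: alg_l_linear; apply: span_subset; right; exists i.
  move=> a aM; have la := lat_M_sub aM.
  rewrite JopE !fctE /= !Eop_fO// !addrK.
  by apply: lin_subspaceB => //; apply: OsubZ; apply: Osub_fO => //; exact: lat_M_sub.
move=> {}T {}x [[p pn <-]|[p pn <-]] xM; last first.
  by rewrite !fctE /=; apply: lin_subspaceB => //; exact: Jst.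
move: x xM; apply: Osub_stable; first exact: lat_M_sub.
  by apply: alg_l_linear; apply: span_subset; left; right; exists p.
move=> a aM; have [la ma] := aM; rewrite EpmE Eop_fO//.
have [e0|e0] := eqVneq (ext a (ls p.1)) 0; first by rewrite e0 scale0r; exact: OL.1.
apply: OsubZ; apply: Osub_fO; first exact: lat_M_sub.
split; first exact: latp_step.
by rewrite /= !massD massN !evx_lift !mass_ev addrK.
Qed.

(** The basis functions are eigenvectors. *)
Lemma acth_stable (u : Uh alpha) :
  acth alpha u @` Osub alpha (lat_H alpha) `<=` Osub alpha (lat_H alpha).
Proof.
apply: (uea_incl_stable lie_module_l); first exact: Osub_subspace.
move=> T x fT; rewrite /opact; move: fT; apply: span_stable; first exact: Osub_subspace.
have OL := Osub_subspace (lat_H alpha).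
move=> {}T {}x [i _ <-]; apply: Osub_stable; first exact: lat_H_sub.
  by apply: alg_l_linear; apply: span_subset; right; exists i.
move=> a aM; have la := lat_H_sub aM.
rewrite JopE !fctE /= !Eop_fO// !addrK.
by apply: lin_subspaceB => //; apply: OsubZ; apply: Osub_fO => //; exact: lat_H_sub.
Qed.

Lemma lat_H_step a (i : 'I_k) : lat_H alpha a -> lat_H alpha (a + @ev R k i).
Proof.
move=> [la a0]; split.
  have := @latp_step _ _ _ alpha1 a (ls i) ord0 la; rewrite evx_lift evx0 subr0; apply.
  by rewrite ext_lift gt_eqF.
by move=> j; rewrite mxE ltr_wpDr// mxE ler0n.
Qed.

Lemma Ep_fO a (i : 'I_k) : latp a -> Ep alpha i (f a) = (a 0 i)%:C *: f (a + @ev R k i).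
Proof. by move=> la; rewrite EpE Eop_fO// ext_lift evx_lift evx0 subr0. Qed.

(** Raising adds 1 to a positive coordinate. *)
Lemma actr_stable (u : Ur alpha) :
  actr alpha u @` Osub alpha (lat_H alpha) `<=` Osub alpha (lat_H alpha).
Proof.
apply: (uea_incl_stable lie_module_l); first exact: Osub_subspace.
move=> T x fT; rewrite /opact; move: fT; apply: span_stable; first exact: Osub_subspace.
have OL := Osub_subspace (lat_H alpha).
move=> {}T {}x [i _ <-]; apply: Osub_stable; first exact: lat_H_sub.
  by apply: alg_l_linear; apply: span_subset; left; left; left; exists i.
move=> a aM; rewrite Ep_fO; last exact: lat_H_sub.
by apply: OsubZ; apply: Osub_fO; [exact: lat_H_sub|exact: lat_H_step].
Qed.

End Symmetry.

(** * The enveloping algebra of the raising operators *)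

Section AbelianEnveloping.
Variables (K : fieldType) (E : lmodType K) (br : E -> E -> E) (I : eqType) (e : I -> E).
Local Notation g := (lin_span (range e)).
Local Notation U := (uea br g).

Lemma span_range i : g (e i).
Proof. by apply: span_subset; exists i. Qed.

Definition gen i : U := uea_gen br (SigSub (mem_set (span_range i))).

(** Words index the monomials, so that products are concatenations. *)
Definition mon (w : seq I) : U := \prod_(i <- w) gen i.

Lemma uea_gen_span (x : g) : exists s : seq (K * I), uea_gen br x = \sum_(q <- s) q.1 *: gen q.2.
Proof.
have [glin _] := uea_genP br g.
have [s [sr xE]] := set_valP x.
elim: s sr x xE => [|q s IH] sr x xE.
  exists [::]; rewrite big_nil.
  rewrite big_nil in xE.
  by rewrite (glin (-1) x x x) ?scaleN1r ?addNr// xE scaler0 addr0.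
rewrite big_cons in xE.
have sg : g (\sum_(p <- s) p.1 *: p.2).
  by exists s; split=> // p ps; apply: sr; rewrite inE ps orbT.
have [i _ iq] := sr q (mem_head _ _).
have [|t tE] := IH _ (SigSub (mem_set sg)) erefl.
  by move=> p ps; apply: sr; rewrite inE ps orbT.
exists ((q.1, i) :: t); rewrite big_cons -tE.
by apply: glin => /=; rewrite iq.
Qed.

Lemma mon_span (u : U) : exists s : seq (K * seq I), u = \sum_(q <- s) q.1 *: mon q.2.
Proof.
elim/upi_ind: u; elim=> [x|c|a [s sE] b [t tE]|a [s sE] b [t tE]].
- have [s sE] := uea_gen_span x; exists [seq (q.1, [:: q.2]) | q <- s].
  rewrite big_map [LHS]sE; apply: eq_bigr => q _.
  by rewrite /mon big_seq1.
- by exists [:: (c, [::])]; rewrite big_seq1 /mon big_nil upi_scal.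
- by exists (s ++ t); rewrite upiD big_cat sE tE.
exists [seq (p.1 * q.1, p.2 ++ q.2) | p <- s, q <- t].
rewrite upiM sE tE mulr_suml big_allpairs_dep; apply: eq_bigr => p _.
rewrite mulr_sumr; apply: eq_bigr => q _.
by rewrite /mon big_cat -scalerAl -scalerAr scalerA.
Qed.

Hypothesis abel : forall i j, br (e i) (e j) = 0.

(** The bracket of two generators is the generator attached to 0, which is 0 by
    linearity. *)
Lemma gen_comm i j : GRing.comm (gen i) (gen j).
Proof.
have [glin gbr] := uea_genP br g.
have g0 : g 0 by have [] := @span_subspace _ _ (range e).
pose z : g := SigSub (mem_set g0).
have z0 : uea_gen br z = 0.
  by rewrite (glin (-1) z z z) ?scaleN1r ?addNr//= oppr0 addr0.
apply/eqP; rewrite -subr_eq0 -z0; apply/eqP/esym.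
by apply: gbr => /=; rewrite abel.
Qed.

Lemma perm_mon w w' : perm_eq w w' -> mon w = mon w'.
Proof.
elim: w w' => [|i w IH] w' ww'.
  by move: ww'; rewrite perm_sym => /perm_nilP ->.
have iw' : i \in w' by rewrite -(perm_mem ww') mem_head.
case/path.splitPr: iw' ww' => a b.
rewrite perm_sym perm_catC /= perm_cons perm_catC perm_sym => /IH ab.
rewrite /mon big_cons -/(mon w) ab /mon !big_cat big_cons /= !mulrA; congr (_ * _).
by apply: commr_prod => j _; exact: gen_comm.
Qed.

End AbelianEnveloping.

Section Posteriors.
Variables (R : realType) (k : nat) (alpha : 'rV[R]_k).
Hypotheses (k_gt0 : (0 < k)%N) (alpha_gt0 : forall i, 0 < alpha 0 i).
Hypothesis alpha1 : mass alpha = 1.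
Local Notation C := R[i].
Local Notation latp := (latp alpha).
Local Notation f := (fO alpha).
Local Notation O := (Osp alpha).
Local Notation cm := (commutator alpha).
Local Notation mon := (@mon C (O -> O) cm 'I_k (Ep alpha)).

(** The total shift of a monomial; it records how often each letter occurs. *)
Definition wt (w : seq 'I_k) : 'rV[R]_k := \sum_(i <- w) @ev R k i.

Lemma wtE w i : wt w 0 i = (count_mem i w)%:R.
Proof.
rewrite /wt summxE -sum1_count natr_sum [RHS]big_mkcond.
by apply: eq_bigr => j _; rewrite mxE eqxx /= eq_sym; case: (j == i).
Qed.

Lemma wt_perm w w' : wt w = wt w' -> perm_eq w w'.
Proof.
move=> e; apply/allP => i _ /=; apply/eqP.
by apply: (mulrIn (oner_neq0 R)); rewrite -!wtE e.
Qed.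

Lemma wt_surj (p : 'I_k -> nat) : exists w, wt w = \row_i (p i)%:R.
Proof.
have [w wp] := word_counts_surj p.
by exists w; apply/rowP => i; rewrite wtE wp mxE.
Qed.

Lemma Ep_abelian i j : cm (Ep alpha i) (Ep alpha j) = 0.
Proof.
rewrite !EpE// (commutator_Eop alpha1).
by rewrite -!(inj_eq val_inj) /= !mulr0n !scale0r subrr.
Qed.

Lemma actr_pi (t : uterm (alg_r alpha)) x :
  actr alpha (\pi_(uea cm (alg_r alpha)) t) x = uterm_act (opact alpha) t x.
Proof. exact: (uea_incl_act (lie_module_l alpha1) (@sub_rl _ _ alpha)). Qed.

Lemma actr_module : algebra_module (actr alpha).
Proof.
split.
- move=> x; rewrite -(scale1r (1 : Ur alpha)) -upi_scal actr_pi/=.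
  by rewrite scale1r.
- by elim/upi_ind=> a; elim/upi_ind=> b x; rewrite -upiM !actr_pi.
- move=> c; elim/upi_ind=> a; elim/upi_ind=> b x.
  by rewrite -mulr_algl -upi_scal -upiM -upiD !actr_pi.
- move=> c u x y; exact: (alg_actDr (uea_act_module (lie_module_l alpha1))).
Qed.

Lemma actr_gen i x : actr alpha (gen cm (Ep alpha) i) x = Ep alpha i x.
Proof. by rewrite /gen /uea_gen actr_pi. Qed.

(** Each letter multiplies by a coordinate of a vector with positive coordinates,
    hence by a nonzero scalar. *)
Lemma mon_act w a : lat_H alpha a ->
  lat_H alpha (a + wt w) /\
  exists2 c : C, c != 0 & actr alpha (mon w) (f a) = c *: f (a + wt w).
Proof.
have [M1 MM _ MD] := actr_module.
move=> aH; elim: w => [|i w [bH [c c0 e]]].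
  rewrite /mon /wt !big_nil addr0; split=> //.
  by exists 1; [exact: oner_neq0|rewrite M1 scale1r].
have lb := lat_H_sub bH; have [_ b0] := bH.
rewrite /mon /wt !big_cons (addrC (ev _ i)) addrA -/(wt w); split; first exact: lat_H_step.
exists (c * ((a + wt w) 0 i)%:C).
  by rewrite mulf_neq0// -(rmorph0 (real_complex R)) (inj_eq (@complexI R)) gt_eqF.
rewrite MM -/(mon w) e actr_gen.
have EL : linear (Ep alpha i) by rewrite EpE//; exact: Eop_linear.
have [_ EZ _ _] := linear_morph EL.
by rewrite EZ Ep_fO// scalerA.
Qed.

(** A normal form for monomials with a given shift; the default word is only
    reached for vectors that are not shifts. *)
Definition word_of (b : 'rV[R]_k) : seq 'I_k := xget [::] [set w | wt w = b].

Lemma word_of_wt w : wt (word_of (wt w)) = wt w.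
Proof. exact: (@xgetPex _ [::] [set w' | wt w' = wt w] (ex_intro _ w erefl)). Qed.

(** Commuting monomials are determined by their shift; terms with equal shift are
    collected. *)
Lemma mon_basis (u : Ur alpha) : exists (s : seq 'rV[R]_k) (c : 'rV[R]_k -> C),
  [/\ uniq s, forall b, b \in s -> exists w, wt w = b &
   u = \sum_(b <- s) c b *: mon (word_of b)].
Proof.
have [t ->] := mon_span u; exists (undup [seq wt q.2 | q <- t]).
exists (fun b => \sum_(q <- t | wt q.2 == b) q.1); split; first exact: undup_uniq.
  by move=> b; rewrite mem_undup => /mapP[q _ ->]; exists q.2.
under [RHS]eq_bigr do rewrite scaler_suml big_mkcond.
rewrite exchange_big; apply: eq_big_seq => q qt /=.
rewrite (bigD1_seq (wt q.2)) ?undup_uniq//=; last by rewrite mem_undup; apply/mapP; exists q.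
rewrite eqxx big1 ?addr0; last by move=> b; rewrite eq_sym => /negbTE ->.
congr (_ *: _); apply: perm_mon; first exact: Ep_abelian.
by apply: wt_perm; rewrite word_of_wt.
Qed.

Lemma Osub1 a x : latp a -> Osub alpha [set a] x <-> exists c, x = c *: f a.
Proof.
move=> la; have al : [set a] `<=` latp by move=> _ ->.
split=> [/(Osub_rep al)[t [ta ->]]|[c ->]]; last exact/OsubZ/Osub_fO.
exists (\sum_(q <- t) q.1); rewrite scaler_suml; apply: eq_big_seq => q /ta.
by move=> /= ->.
Qed.

(** Evaluated at [f alpha], the terms of [w] produce independent basis vectors,
    each with a nonzero factor. Hence only the term with shift [p] may occur. *)
Lemma raising_unique (p : 'I_k -> nat) : let a : 'rV[R]_k := alpha + \row_i (p i)%:R in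
  exists v : Ur alpha,
    actr alpha v @` Osub alpha [set alpha] = Osub alpha [set a] /\
    forall w : Ur alpha,
      actr alpha w @` Osub alpha [set alpha] = Osub alpha [set a] <->
      exists2 c : C, c != 0 & w = c *: v.
Proof.
move=> a; have [w0 w0E] := wt_surj p.
have aH : lat_H alpha alpha by split; first exact: latp_alpha.
have la : latp a.
  by have [[]] := mon_act w0 aH; rewrite w0E.
have [M1 MM ML MD] := actr_module.
have [MZ M0] :
    (forall c (u : Ur alpha) x, actr alpha (c *: u) x = c *: actr alpha u x) /\
    forall x, actr alpha 0 x = 0.
  have z x : actr alpha 0 x = 0.
    by have := ML (-1) 0 0 x; rewrite !scaleN1r !addNr => ->.
  by split=> // c u x; rewrite -[c *: u]addr0 ML z addr0.
have actr_sum (I : Type) (r : seq I) (F : I -> Ur alpha) x :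
    actr alpha (\sum_(i <- r) F i) x = \sum_(i <- r) actr alpha (F i) x.
  apply: (@big_morph _ _ (actr alpha ^~ x)) => [u u'|]; last exact: M0.
  by rewrite -[u in LHS]scale1r ML scale1r.
set v := mon (word_of (wt w0)); have vv : wt (word_of (wt w0)) = wt w0 := word_of_wt w0.
have vscale c : c != 0 -> actr alpha (c *: v) @` Osub alpha [set alpha] = Osub alpha [set a].
  move=> c0; have [_ [d d0 dE]] := mon_act (word_of (wt w0)) aH.
  rewrite vv [in RHS]w0E -/a -/v in dE.
  have [_ vZ _ _] := linear_morph (MD^~ (c *: v)).
  apply/seteqP; split=> [_ [x /(Osub1 _ aH.1)[z ->] <-]|x /(Osub1 _ la)[z ->]].
    by rewrite vZ MZ dE; apply/(Osub1 _ la); exists (z * c * d); rewrite !scalerA.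
  exists ((z / (c * d)) *: f alpha); first by apply/(Osub1 _ aH.1); eexists.
  by rewrite vZ MZ dE !scalerA -mulrA divfK// mulf_neq0.
exists v; split; first by rewrite -[v]scale1r; exact/vscale/oner_neq0.
move=> w; split=> [we|[c c0 ->]]; last exact: vscale.
have [s [m [us sw wE]]] := mon_basis w.
pose co b := @coord R k alpha (alpha + b).
have [z ze] : exists z, actr alpha w (f alpha) = z *: f a.
  apply/(Osub1 _ la); rewrite -we; exists (f alpha) => //.
  by apply/(Osub1 _ aH.1); exists 1; rewrite scale1r.
(* Both expressions of the image of [f alpha] are compared at [alpha + b]. *)
have m0 b : b \in s -> b != wt w0 -> m b = 0.
  move=> bs bp; have [wb wbE] := sw b bs.
  have [_ [d d0 dE]] := mon_act (word_of b) aH.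
  have [_ coZ _ _] := @linear_morph C O C^o (co b) (lin_extend_linear _).
  have coF b' : latp b' -> co b (f b') = (alpha + b == b')%:R := @coord_fO R k alpha _ b'.
  have := congr1 (co b) ze; rewrite coZ coF//.
  rewrite (inj_eq (addrI alpha)) -w0E (negbTE bp) scaler0 wE.
  rewrite actr_sum (@linear_sumE C O C^o (co b) _ _ _ (lin_extend_linear _)).
  rewrite (bigD1_seq b)//= big1_seq ?addr0.
    have wb2 : wt (word_of b) = b by rewrite -wbE word_of_wt.
    rewrite MZ dE coZ coZ wb2 coF.
      rewrite eqxx /GRing.scale /= mulr1 => /eqP.
      by rewrite mulf_eq0 (negbTE d0) orbF => /eqP.
    by have [] := mon_act wb aH; rewrite wbE => /lat_H_sub.
  move=> b' /andP[b'b /sw[wb' wb'E]].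
  have [lb' [d' _ d'E]] := mon_act (word_of b') aH.
  rewrite MZ d'E coZ coZ coF; last exact: lat_H_sub.
  by rewrite -wb'E word_of_wt wb'E (inj_eq (addrI alpha)) eq_sym (negbTE b'b) !scaler0.
have wv : w = (\sum_(b <- s | b == wt w0) m b) *: v.
  rewrite wE scaler_suml (bigID (fun b => b == wt w0))/= [X in _ + X]big1_seq ?addr0.
    by apply: eq_bigr => b /eqP ->.
  by move=> b /andP[bp bs]; rewrite m0// scale0r.
(* With a zero scalar the image would be 0, but it contains [f a]. *)
exists (\sum_(b <- s | b == wt w0) m b) => //; apply/eqP => c0.
have : Osub alpha [set a] (f a) by apply/(Osub1 _ la); exists 1; rewrite scale1r.
rewrite -we => -[x _]; rewrite wv c0 scale0r M0 => /esym/eqP.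
by apply/negP; exact: fO_neq0.
Qed.

Lemma slice_fO (p : 'I_k -> nat) :
  slice alpha (fO alpha (alpha + \row_i (p i)%:R)) =
  charfun (posterior (dirichlet alpha) p).
Proof.
have [w wE] := wt_surj p.
have aH : lat_H alpha alpha by split; first exact: latp_alpha.
have [/lat_H_sub la _] := mon_act w aH; rewrite wE in la.
apply/funext => s; rewrite /slice val_fO// /basis_fun cpow1 mulr1.
under eq_bigr do rewrite mxE cpow1.
rewrite big1_eq mulr1.
move: k_gt0 alpha alpha_gt0 alpha1 p s {la aH wE w}; case: k => [//|n] _ b b0 b1 p s.
exact: lauricella_charfun.
Qed.

(** The value at 0 shows that the characteristic function is not the zero
    function. *)
Lemma slice_fO0 a : latp a -> slice alpha (f a) 0 = 1.
Proof.
move=> la; rewrite /slice val_fO// /basis_fun cpow1 mulr1.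
under eq_bigr do rewrite mxE cpow1.
rewrite big1_eq mulr1 -[RHS](lauricella0 a); congr lauricella.
by apply/rowP => i; rewrite !mxE.
Qed.

Lemma slice_bij (p : 'I_k -> nat) : let a : 'rV[R]_k := alpha + \row_i (p i)%:R in
  set_bij (Osub alpha [set a])
    (lin_span [set charfun (posterior (dirichlet alpha) p)]) (slice alpha).
Proof.
move=> a; have [w wE] := wt_surj p.
have aH : lat_H alpha alpha by split; first exact: latp_alpha.
have la : latp a by have [/lat_H_sub] := mon_act w aH; rewrite wE.
have D0 := slice_fO0 la; rewrite slice_fO in D0.
apply: (@line_bij _ _ _ _ _ (f a)).
- exact: slice_linear.
- by move=> x; exact: Osub1.
- exact: slice_fO.
- by apply/eqP => e; move: D0; rewrite e => /esym/eqP; rewrite oner_eq0.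
Qed.

End Posteriors.

(** * Roots and the Weyl group *)

Lemma push_vertex (R : realType) k (pi : 'S_k) (i : 'I_k) :
  push pi (vertex R i) = vertex R (pi i).
Proof.
apply/eq_from_tnth => l; rewrite !tnth_mktuple.
under eq_bigr do rewrite tnth_mktuple.
have [->|li] := eqVneq l (pi i).
  rewrite (bigD1 i)//= eqxx big1 ?addr0// => j /andP[/eqP/perm_inj -> ].
  by rewrite eqxx.
rewrite big1// => j /eqP jl; rewrite -jl (inj_eq perm_inj) in li.
by rewrite (negbTE li).
Qed.

Section Weyl.
Variables (R : realType) (k : nat) (alpha : 'rV[R]_k).
Hypotheses (k_gt0 : (0 < k)%N) (alpha_gt0 : forall i, 0 < alpha 0 i).
Hypothesis alpha1 : mass alpha = 1.
Local Notation C := R[i].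
Local Notation O := (Osp alpha).
Local Notation E := (@Eop R k alpha).
Local Notation rho := (@rho R k alpha).
Local Notation cm := (commutator alpha).
Local Notation ls i := (fintype.lift ord0 i).
Local Notation h := (alg_h alpha).
Local Notation dual := (dual_space h).
Implicit Types (X Y : 'M[C]_k.+1) (d : 'rV[C]_k.+1) (H : h) (i j l m : 'I_k.+1).
Implicit Types (s t : 'S_k.+1).

Let rhoI : injective rho := rho_inj alpha1 k_gt0 alpha_gt0.

Lemma diag_inj : injective (@diag_mx C k.+1).
Proof.
move=> d e de; apply/rowP => i; have := congr1 (fun X => X i i) de.
by rewrite !mxE eqxx !mulr1n.
Qed.

Lemma hdiag_subproof H : exists d, val H = rho (diag_mx d) /\ \sum_i d 0 i = 0.
Proof.
have [_ [d -> d0] <-] : (rho @` @diag0 R k) (val H).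
  by rewrite -alg_hE//; exact: set_valP.
by exists d.
Qed.

(** The diagonal of the matrix representing [H], unique because [rho] is
    injective. *)
Definition hdiag H : 'rV[C]_k.+1 := projT1 (cid (hdiag_subproof H)).

Lemma hdiagE H : val H = rho (diag_mx (hdiag H)).
Proof. by rewrite /hdiag; case: cid => d [] /=. Qed.

Lemma hdiag0 H : \sum_i hdiag H 0 i = 0.
Proof. by rewrite /hdiag; case: cid => d [] /=. Qed.

Lemma hdiag_lin (c : C) (x y z : h) : val z = c *: val x + val y ->
  hdiag z = c *: hdiag x + hdiag y.
Proof.
by rewrite !hdiagE -rho_lin => /rhoI; rewrite -linearP => /diag_inj.
Qed.

Lemma hdiag_inj : injective hdiag.
Proof. by move=> x y e; apply: val_inj; rewrite /= !hdiagE e. Qed.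

Lemma hdiag_surj d : \sum_i d 0 i = 0 -> exists H, hdiag H = d.
Proof.
move=> d0; have hd : h (rho (diag_mx d)) by rewrite alg_hE//; exists (diag_mx d) => //; exists d.
exists (SigSub (mem_set hd)); apply/diag_inj/rhoI.
by rewrite -hdiagE.
Qed.

Definition eps_fun i H : C^o := hdiag H 0 i.

Lemma eps_dual i : eps_fun i \in @functional_pred C _ h.
Proof.
by apply/asboolP => c x y z /hdiag_lin e; rewrite /eps_fun e !mxE.
Qed.

(** The coordinate functionals of the Cartan subalgebra; their sum is zero. *)
Definition eps i : dual := Dual (eps_dual i).

Definition root_of i j : dual := eps i - eps j.

Lemma root_ofE i j H : root_of i j H = hdiag H 0 i - hdiag H 0 j.
Proof. by []. Qed.

Lemma root_ofN i j : - root_of i j = root_of j i.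
Proof. by rewrite /root_of opprB. Qed.

Lemma coroot_subproof i j : \sum_l (delta_mx 0 i - delta_mx 0 j : 'rV[C]_k.+1) 0 l = 0.
Proof.
under eq_bigr do rewrite mxE [X in _ + X]mxE.
by rewrite sumrB !sum_delta subrr.
Qed.

(** The element of the Cartan subalgebra with diagonal [e_i - e_j]. *)
Definition coroot_of i j : h := projT1 (cid (hdiag_surj (coroot_subproof i j))).

Lemma coroot_ofE i j l : hdiag (coroot_of i j) 0 l = (l == i)%:R - (l == j)%:R.
Proof. by rewrite /coroot_of; case: cid => H /= ->; rewrite !mxE. Qed.

(** A difference of two entries of [e_i - e_j] is 2 only for the entries 1 and
    -1. The value 2 at one coroot thus recognises the root among all differences
    of coordinates. *)
Lemma root_of_coroot_of i j l m : i != j -> root_of l m (coroot_of i j) = 2 -> l = i /\ m = j.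
Proof.
move=> ij; rewrite root_ofE !coroot_ofE; have lij : ~~ ((l == i) && (l == j)).
  by apply: contraNN ij => /andP[/eqP <- /eqP <-].
have mij : ~~ ((m == i) && (m == j)).
  by apply: contraNN ij => /andP[/eqP <- /eqP <-].
move=> /(congr1 (@complex.Re R)) e; suff /andP[/eqP -> /eqP ->] : (l == i) && (m == j) by [].
move: lij mij e; case: (l == i); case: (l == j); case: (m == i); case: (m == j) => //= _ _; lra.
Qed.

Lemma root_of_inj i j l m : i != j -> root_of i j = root_of l m -> l = i /\ m = j.
Proof.
move=> ij e; apply: (root_of_coroot_of ij); rewrite -e root_ofE !coroot_ofE !eqxx (negbTE ij).
by rewrite eq_sym (negbTE ij) subr0 sub0r opprK.
Qed.

Lemma eps_inj : injective eps.
Proof.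
move=> i j e; apply/eqP; apply: contraT => ij.
have : root_of i j = root_of i i by rewrite /root_of e.
by move/(root_of_inj ij) => [_ ji]; rewrite ji eqxx in ij.
Qed.

(** A diagonal matrix acts on matrix entries by differences of its eigenvalues;
    roots and root spaces are read off from this. *)
Lemma bracket_diag H X : cm (val H) (rho X) =
  rho (\matrix_(i, j) ((hdiag H 0 i - hdiag H 0 j) * X i j)).
Proof.
rewrite hdiagE (commutator_rho alpha1); congr rho; apply/matrixP => i j.
by rewrite mul_diag_mx mul_mx_diag !mxE mulrBl; congr (_ - _); rewrite mulrC.
Qed.

Lemma Eop_root i j : i != j -> root_space cm (alg_l alpha) (root_of i j) (E i j).
Proof.
move=> ij; split.
  rewrite alg_lE; exists (delta_mx i j); last exact: rho_delta.
  by rewrite /trace0 /= tr_delta (negbTE ij).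
move=> H; rewrite -rho_delta bracket_diag -[RHS]addr0 -[X in _ + X](rho0 alpha) -rho_lin.
congr rho; apply/matrixP => l m; rewrite !mxE addr0 root_ofE.
by case: eqP => [->|]; case: eqP => [->|]; rewrite ?mulr0.
Qed.

Lemma Eop_neq0 i j : E i j != 0.
Proof.
rewrite -rho_delta -(rho0 alpha); apply: contra_neq (oner_neq0 C) => /rhoI/matrixP/(_ i j).
by rewrite !mxE !eqxx.
Qed.

(** At a nonzero entry [X i j] the eigenvalue must be that of the matrix unit. *)
Lemma root_spaceP (c : dual) x : root_space cm (alg_l alpha) c x ->
  exists X, [/\ x = rho X, trace0 X & forall i j, X i j != 0 -> c = root_of i j].
Proof.
move=> []; rewrite alg_lE => -[X X0 <-] hX; exists X; split=> // i j Xij.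
apply/val_inj/funext => H; have := hX H.
rewrite bracket_diag -[RHS]addr0 -(rho0 alpha) -rho_lin => /rhoI/matrixP/(_ i j).
by rewrite !mxE addr0 => /(mulIf Xij).
Qed.

Lemma rootP (c : dual) : lie_root cm (alg_l alpha) c <->
  exists i j, i != j /\ c = root_of i j.
Proof.
split=> [[c0 [x /root_spaceP[X [-> X0 hX]] x0]]|[i [j [ij ->]]]].
  have : exists i j, X i j != 0.
    apply: contrapT => hn; case/negP: x0; apply/eqP.
    rewrite -(rho0 alpha); congr rho; apply/matrixP => i j; rewrite mxE.
    by apply: contrapT => /eqP Xij; apply: hn; exists i, j.
  move=> [i [j Xij]]; exists i, j; have cE := hX i j Xij; split=> //.
  by apply: contraNneq c0 => ij; rewrite cE ij /root_of subrr.
split.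
  apply/eqP => e; have : root_of i j = root_of i i by rewrite e /root_of subrr.
  by move/(root_of_inj ij) => [_ ji]; rewrite ji eqxx in ij.
exists (E i j); first exact: Eop_root.
exact: Eop_neq0.
Qed.

Lemma root_space_root_of i j x : i != j ->
  root_space cm (alg_l alpha) (root_of i j) x -> exists c : C, x = c *: E i j.
Proof.
move=> ij /root_spaceP[X [-> X0 hX]]; exists (X i j).
rewrite -rho_delta -[RHS]addr0 -[X in _ + X](rho0 alpha) -rho_lin.
congr rho; apply/matrixP => l m; rewrite !mxE addr0.
have [Xlm|Xlm] := eqVneq (X l m) 0.
  by case: (l =P i) Xlm => [->|_]; case: (m =P j) => [->|_] ->; rewrite ?mulr0 ?mul0r.
have [-> ->] := root_of_inj ij (hX l m Xlm).
by rewrite !eqxx mulr1.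
Qed.

Lemma val_coroot_of i j : val (coroot_of i j) = E i i - E j j.
Proof.
rewrite hdiagE -!rho_delta -rhoB; congr rho.
apply/matrixP => l m; rewrite !mxE coroot_ofE.
have [->|lm] := eqVneq l m; first by rewrite !andbb mulr1n.
rewrite mulr0n; case: (eqVneq l i) lm => [->|_] lm; rewrite ?andFb.
  rewrite eq_sym (negbTE lm) /= sub0r.
  by case: (eqVneq i j) lm => [->|_] lm; rewrite ?andFb ?oppr0// eq_sym (negbTE lm) oppr0.
case: (eqVneq l j) lm => [->|_] lm; rewrite ?andFb ?subrr//.
by rewrite eq_sym (negbTE lm) subrr.
Qed.

(** The root spaces of opposite roots are spanned by [E_ij] and [E_ji], whose
    bracket is [E_ii - E_jj]; the normalisation fixes the multiple. *)
Lemma coroot_root_of i j H : i != j ->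
  coroot cm (alg_l alpha) (root_of i j) H <-> H = coroot_of i j.
Proof.
move=> ij; have ji : j != i by rewrite eq_sym.
have two : root_of i j (coroot_of i j) = 2.
  by rewrite root_ofE !coroot_ofE !eqxx (negbTE ij) (negbTE ji) subr0 sub0r opprK.
have brE : cm (E i j) (E j i) = E i i - E j j.
  by rewrite (commutator_Eop alpha1) !eqxx !scale1r.
split=> [[hspan h2]|->]; last first.
  split=> //; apply: span_subset; exists (E i j), (E j i); split.
  - exact: Eop_root.
  - by rewrite root_ofN; exact: Eop_root.
  - by rewrite brE; exact: val_coroot_of.
have [z ze] : exists z : C, val H = z *: val (coroot_of i j).
  suff : lin_span [set x | exists y z,
            [/\ root_space cm (alg_l alpha) (root_of i j) y,
                root_space cm (alg_l alpha) (- root_of i j) z & x = cm y z]] `<=`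
         [set x | exists z : C, x = z *: val (coroot_of i j)].
    exact.
  apply: span_min.
    split; first by exists 0; rewrite scale0r.
    by move=> c _ _ [y ->] [z ->]; exists (c * y + z); rewrite scalerA scalerDl.
  move=> x [y [z [/(root_space_root_of ij)[c ->]]]]; rewrite root_ofN.
  move=> /(root_space_root_of ji)[c' ->] ->; exists (c * c').
  rewrite val_coroot_of -brE; apply/funext => v; rewrite /commutator !fctE /=.
  have [_ EZ _ _] := linear_morph (@Eop_linear R k alpha i j).
  have [_ EZ' _ _] := linear_morph (@Eop_linear R k alpha j i).
  by rewrite EZ EZ' !scalerA scalerBr (mulrC c').
have hz : hdiag H = z *: hdiag (coroot_of i j).
  have h00 : h 0 by have [] := @span_subspace _ _ (range (Jop alpha)).
  pose o : h := SigSub (mem_set h00).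
  have o0 : hdiag o = 0.
    by rewrite (@hdiag_lin (-1) o o o) ?scaleN1r ?addNr//= oppr0 addr0.
  by rewrite (@hdiag_lin z (coroot_of i j) o H) ?o0 ?addr0//= addr0.
apply: hdiag_inj; rewrite hz; suff -> : z = 1 by rewrite scale1r.
have : z * root_of i j (coroot_of i j) = 2 by rewrite -h2 !root_ofE hz !mxE mulrBr.
by rewrite two -[RHS]mul1r; apply: mulIf; rewrite pnatr_eq0.
Qed.

Lemma permh_subproof s H : \sum_i (\row_j hdiag H 0 (s j) : 'rV[C]_k.+1) 0 i = 0.
Proof.
under eq_bigr do rewrite mxE.
by rewrite -[RHS](hdiag0 H) [RHS](reindex_inj (@perm_inj _ s)).
Qed.

Definition permh s H : h := projT1 (cid (hdiag_surj (permh_subproof s H))).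

Lemma permhE s H i : hdiag (permh s H) 0 i = hdiag H 0 (s i).
Proof. by rewrite /permh; case: cid => H' /= ->; rewrite mxE. Qed.

Lemma hdiag_lin_inv (c : C) (x y z : h) : hdiag z = c *: hdiag x + hdiag y ->
  val z = c *: val x + val y.
Proof. by move=> e; rewrite !hdiagE -rho_lin -linearP e. Qed.

Lemma dual_lin (l : dual) (c : C) (x y z : h) : val z = c *: val x + val y ->
  l z = c * l x + l y.
Proof. by have /asboolP := valP l; exact. Qed.

Lemma perm_dual_subproof s (l : dual) : (l \o permh s : h -> C^o) \in @functional_pred C _ h.
Proof.
apply/asboolP => c x y z e; apply: dual_lin; apply: hdiag_lin_inv.
by apply/rowP => i; rewrite !mxE !permhE (hdiag_lin e) !mxE.
Qed.

(** The action of permutations of the [k + 1] coordinates of [h] on functionals. *)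
Definition perm_dual s (l : dual) : dual := Dual (perm_dual_subproof s l).

Lemma perm_dualE s (l : dual) H : perm_dual s l H = l (permh s H).
Proof. by []. Qed.

Lemma perm_dual_eps s i : perm_dual s (eps i) = eps (s i).
Proof. by apply/val_inj/funext => H; rewrite /= /eps_fun permhE. Qed.

Lemma perm_dual_root_of s i j : perm_dual s (root_of i j) = root_of (s i) (s j).
Proof. by apply/val_inj/funext => H; rewrite [LHS]perm_dualE !root_ofE !permhE. Qed.

Lemma perm_dualM s t : perm_dual (t * s)%g = perm_dual s \o perm_dual t.
Proof.
apply/funext => l; apply/val_inj/funext => H /=; congr (l _).
by apply/hdiag_inj/rowP => i; rewrite !permhE permM.
Qed.

Lemma perm_dual1 : perm_dual 1%g = idfun.
Proof.
apply/funext => l; apply/val_inj/funext => H /=; congr (l _).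
by apply/hdiag_inj/rowP => i; rewrite !permhE perm1.
Qed.

Lemma perm_dual_inj : injective perm_dual.
Proof.
move=> s t e; apply/permP => i; apply: eps_inj.
by rewrite -!perm_dual_eps e.
Qed.

(** Exchanging two entries of a diagonal subtracts a multiple of [e_i - e_j], the
    multiple being the difference of the entries, that is the value of the root. *)
Lemma reflection_root_of i j r : i != j ->
  reflection cm (alg_l alpha) (root_of i j) r <-> r = perm_dual (tperm i j).
Proof.
move=> ij.
have tE (l : dual) : perm_dual (tperm i j) l = l - (l (coroot_of i j) : C) *: root_of i j.
  apply/val_inj/funext => H.
  have -> : val (l - (l (coroot_of i j) : C) *: root_of i j) H =
    l H - l (coroot_of i j) * root_of i j H by [].
  rewrite [LHS]perm_dualE (@dual_lin l (- root_of i j H) (coroot_of i j) H); first by ring.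
  apply: hdiag_lin_inv; apply/rowP => m; rewrite permhE !mxE coroot_ofE root_ofE.
  by case: tpermP => [->|->|/eqP/negbTE -> /eqP/negbTE ->]; rewrite ?eqxx ?(negbTE ij);
    rewrite ?(eq_sym j) ?(negbTE ij) /=; ring.
split=> [[H /(coroot_root_of _ ij) -> hr]|->].
  by apply/funext => l; rewrite hr tE.
by exists (coroot_of i j); [exact/(coroot_root_of _ ij)|exact: tE].
Qed.

(** Permutations are products of transpositions, which are the reflections. *)
Lemma weyl_groupE : weyl_group cm (alg_l alpha) h = range perm_dual.
Proof.
apply/seteqP; split=> [w|_ [s _ <-]].
  elim=> [|c r v /rootP[i [j [ij ->]]] /(reflection_root_of _ ij) -> _ [s _ <-]].
    by exists 1%g => //; exact: perm_dual1.
  by exists (s * tperm i j)%g; rewrite ?perm_dualM.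
have [ts -> /allP dts] := prod_tpermP s.
elim/last_ind: ts dts => [|ts [i j] IH] dts.
  by rewrite big_nil perm_dual1; exact: weyl_id.
rewrite -cats1 big_cat big_seq1 perm_dualM.
have ij : i != j by have := dts (i, j); rewrite mem_rcons mem_head => /(_ isT).
apply: (@weyl_comp _ _ _ _ _ (root_of i j)).
- by apply/rootP; exists i, j.
- exact/reflection_root_of.
- by apply: IH => t tt; apply: dts; rewrite mem_rcons inE tt orbT.
Qed.

Definition gamma (i : 'I_k) : dual := root_of (ls i) ord0.

(** Permutations of the nonzero indices, extended by fixing 0. *)
Definition lperm (pi : 'S_k) : 'S_k.+1 := lift_perm ord0 ord0 pi.

Lemma lperm_inj : injective lperm.
Proof.
move=> p q e; apply/permP => i; apply: (@lift_inj _ ord0).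
by rewrite -!(lift_perm_lift ord0) -/(lperm p) e.
Qed.

Lemma lperm_surj s : s ord0 = ord0 -> exists p, s = lperm p.
Proof.
move=> s0; have sl (i : 'I_k) : {j | s (ls i) = ls j}.
  have : s (ls i) != ord0 by rewrite -{2}s0 (inj_eq perm_inj) eq_sym neq_lift.
  by case: (unliftP ord0 (s (ls i))) => [j -> _|->]; [exists j|rewrite eqxx].
have pI : injective (fun i : 'I_k => projT1 (sl i)).
  move=> i j e; apply/(@lift_inj _ ord0)/(@perm_inj _ s).
  by rewrite (projT2 (sl i)) (projT2 (sl j)) e.
exists (perm pI); apply/permP => i.
have [j|] := unliftP ord0 i => ->; last by rewrite lift_perm_id.
by rewrite lift_perm_lift permE; exact: (projT2 (sl j)).
Qed.

Definition weyl_sym (pi : 'S_k) : dual -> dual := perm_dual (lperm pi).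

Lemma weyl_sym_gamma (p : 'S_k) (i : 'I_k) : weyl_sym p (gamma i) = gamma (p i).
Proof. by rewrite /weyl_sym perm_dual_root_of lift_perm_lift lift_perm_id. Qed.

Lemma weyl_sym_iso : sym_iso (range weyl_sym) weyl_sym.
Proof.
split=> // [s t|s t e]; first by rewrite /weyl_sym -perm_dualM /lperm lift_permM.
exact/lperm_inj/perm_dual_inj.
Qed.

Lemma weyl_sym_subgroup :
  subgroup (weyl_group cm (alg_l alpha) h) (range weyl_sym).
Proof.
have [M _ _] := weyl_sym_iso.
have one : weyl_sym 1%g = idfun.
  by rewrite /weyl_sym /lperm lift_perm1 perm_dual1.
split.
- by move=> _ [p _ <-]; rewrite weyl_groupE; exists (lperm p).
- by exists 1%g.
- by move=> _ _ [p _ <-] [q _ <-]; exists (q * p)%g; rewrite ?M.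
- move=> _ [p _ <-]; exists (weyl_sym p^-1%g).
  by split; [exists p^-1%g|rewrite -M mulgV|rewrite -M mulVg].
Qed.

(** The index 0 is the common second index of the roots [gamma i]; a permutation
    that maps one of them into the family fixes it. *)
Lemma weyl_stabilizer w : weyl_group cm (alg_l alpha) h w ->
  w @` range gamma `<=` range gamma -> range weyl_sym w.
Proof.
rewrite weyl_groupE => -[s _ <-] st.
have [|i _] := st (perm_dual s (gamma (Ordinal k_gt0))).
  by exists (gamma (Ordinal k_gt0)) => //; exists (Ordinal k_gt0).
rewrite perm_dual_root_of => e.
have [|_ s0] := root_of_inj _ e; first by rewrite eq_sym neq_lift.
by have [p ->] := lperm_surj s0; exists p.
Qed.

(** A group with the stability property consists of elements [weyl_sym r]. Being
    isomorphic to the symmetric group, it has as many elements as there are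
    permutations [r], and an injection of a finite set into itself is onto. *)
Lemma weyl_sym_unique (G : set (dual -> dual)) (phi : 'S_k -> dual -> dual) :
  subgroup (weyl_group cm (alg_l alpha) h) G -> sym_iso G phi ->
  (forall w, G w -> w @` range gamma `<=` range gamma) -> G = range weyl_sym.
Proof.
move=> [GW _ _ _] [_ phiI phiG] st.
have Gs w : G w -> range weyl_sym w by move=> Gw; apply: weyl_stabilizer; [exact: GW|exact: st].
apply/seteqP; split=> // _ [p _ <-].
have phis q : exists r, weyl_sym r = phi q.
  have [|r _ e] := Gs (phi q); first by rewrite -phiG; exists q.
  by exists r.
pose r q := projT1 (cid (phis q)).
have rE q : weyl_sym (r q) = phi q by rewrite /r; case: cid.
have rI : injective r by move=> q q' e; apply: phiI; rewrite -!rE e.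
by rewrite -phiG -(f_invF rI p) rE; exists (invF rI p).
Qed.

End Weyl.

Theorem theorem4p12 (R : realType) (k : nat) (alpha : 'rV[R]_k)
    (k_gt0 : (0 < k)%N)
    (alpha_gt0 : forall i, 0 < alpha 0 i) (alpha1 : \sum_i alpha 0 i = 1) :
  (* (i) *)
  [/\ weight_module (commutator alpha) (opact alpha) (alg_l alpha)
        (alg_h alpha),
      algebra_module (actl alpha) &
      forall (x : alg_l alpha) (v : Osp alpha),
        actl alpha (uea_gen (commutator alpha) x) v = val x v] /\
  (* (ii) *)
  [/\ forall l : nat, (1 <= l)%N -> forall u : Uf alpha,
        actf alpha u @` Osub alpha (lat_M alpha l)
          `<=` Osub alpha (lat_M alpha l),
      forall u : Uh alpha,
        acth alpha u @` Osub alpha (lat_H alpha)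
          `<=` Osub alpha (lat_H alpha) &
      forall u : Ur alpha,
        actr alpha u @` Osub alpha (lat_H alpha)
          `<=` Osub alpha (lat_H alpha)] /\
  (* (iii) *)
  (forall p : 'I_k -> nat,
     let a : 'rV[R]_k := alpha + \row_i (p i)%:R in
     let D := charfun (posterior (dirichlet alpha) p) in
     [/\ exists v : Ur alpha,
           actr alpha v @` Osub alpha [set alpha] = Osub alpha [set a] /\
           forall w : Ur alpha,
             actr alpha w @` Osub alpha [set alpha] = Osub alpha [set a] <->
             exists2 c : R[i], c != 0 & w = c *: v,
         slice alpha (fO alpha a) = D,
         linear (slice alpha) &
         set_bij (Osub alpha [set a]) (lin_span [set D]) (slice alpha)]) /\
  (* (iv) *)
  (exists gamma : 'I_k -> dual_space (alg_h alpha),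
     (forall i,
        [/\ lie_root (commutator alpha) (alg_l alpha) (gamma i),
            root_space (commutator alpha) (alg_l alpha) (gamma i)
              (Ep alpha i) &
            Ep alpha i != 0]) /\
     exists G : set (dual_space (alg_h alpha) -> dual_space (alg_h alpha)),
       let sym_stable G' :=
         [/\ subgroup
               (weyl_group (commutator alpha) (alg_l alpha) (alg_h alpha)) G',
             exists phi : 'S_k -> _, sym_iso G' phi &
             forall g, G' g -> g @` range gamma `<=` range gamma] in
       [/\ sym_stable G,
           forall G', sym_stable G' -> G' = G &
           exists2 phi : 'S_k -> _, sym_iso G phi &
             forall (pi : 'S_k) (i : 'I_k),
               phi pi (gamma i) = gamma (pi i) /\
               push pi (vertex R i) = vertex R (pi i)]).
Proof.
have a1 : mass alpha = 1 by [].
have lm := lie_module_l a1.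
split; [|split; [|split]].
- split; [exact: weight_module_l|exact: (uea_act_module lm)|].
  exact: (uea_act_gen lm).
- split; [by move=> l _; exact: actf_stable|exact: acth_stable|exact: actr_stable].
- move=> p a D; split.
  + exact: raising_unique.
  + exact: slice_fO.
  + exact: slice_linear.
  + exact: slice_bij.
exists (@gamma R k alpha k_gt0 alpha_gt0 a1); split=> [i|].
  have l0 : fintype.lift ord0 i != ord0 by rewrite eq_sym neq_lift.
  split; rewrite ?EpE.
  - by apply/rootP; do 2 eexists; split; first exact: l0.
  - exact: Eop_root.
  - exact: Eop_neq0.
have iso := @weyl_sym_iso R k alpha k_gt0 alpha_gt0 a1.
exists (range (@weyl_sym R k alpha k_gt0 alpha_gt0 a1)); split.
- split; [exact: weyl_sym_subgroup|by eexists; exact: iso|].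
  move=> _ [p _ <-] _ [_ [i _ <-] <-]; exists (p i) => //.
  by rewrite weyl_sym_gamma.
- by move=> G' [sG [phi isoG] st]; exact: weyl_sym_unique sG isoG st.
exists (@weyl_sym R k alpha k_gt0 alpha_gt0 a1) => // p i.
by rewrite weyl_sym_gamma push_vertex.
Qed.
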